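(* Let $X$ and $Y$ be connected Finsler manifolds. Assume that $X$ is complete and $Y$ is simply connected. Let $f:X\to Y$ be a $C^1$ Fredholm map of index $0$, and let $\mu(x)$ denote either of the two numbers $\operatorname{Inj} df(x)$ or $\operatorname{Sur} df(x)$. Then the following statements are equivalent: (1) $f$ is a strong submersion: there is no sequence $\{x_n\}$ in $X$ such that $f(x_n)\to y$ for some $y\in Y$ and $\operatorname{Sur} df(x_n)\to0$. (2) $f$ is a strong submersion with continuous weight: there exist a continuous weight $\eta=1/\omega$ and a point $x_0\in X$ such that there is no sequence $\{x_n\}$ in $X$ with $f(x_n)\to y$ for some $y\in Y$ and $\operatorname{Sur} df(x_n)\,\omega(d_X(x_0,x_n))\to0$. (3) $f$ satisfies the Earle-Eells condition: for every $y\in Y$ there exist $\alpha>0$ and a neighborhood $V$ of $y$ such that $\mu(x)\ge\alpha$ for all $x\in f^{-1}(V)$. (4) $f$ satisfies the Earle-Eells condition with nonincreasing weight: there exist a nonincreasing weight $\eta=1/\omega$ and a point $x_0\in X$ such that for every $y\in Y$ there exist $\alpha>0$ and a neighborhood $V$ of $y$ with $\mu(x)\,\omega(d_X(x_0,x))\ge\alpha$ for all $x\in f^{-1}(V)$. (5) $f$ is a global diffeomorphism from $X$ onto $Y$.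
   Context: Manifolds are nonempty, paracompact, real Banach manifolds, at least $C^1$, without boundary. A Finsler manifold (in the sense of Palais) is a manifold $X$ modeled on a Banach space $(E,|\cdot|)$ with a continuous map $\|\cdot\|_X:TX\to[0,\infty)$ such that (1) for every $x\in X$, $v\mapsto\|v\|_x:=\|(x,v)\|_X$ is a norm on $T_xX$ which in every chart at $x$ is equivalent to $|\cdot|$; (2) for every $x_0\in X$ and $k>1$ there is a chart $(W,\varphi)$ at $x_0$ such that for all $x\in W$, $w\in E$, $k^{-1}\|v_{x_0}(w)\|_{x_0}\le\|v_x(w)\|_x\le k\|v_{x_0}(w)\|_{x_0}$, where $v_x(w)=d(\varphi^{-1})(\varphi(x))w$. For connected $X$, $d_X(x,x')$ is the infimum of lengths $\int\|\dot\alpha(t)\|dt$ of $C^1$ paths joining $x$ to $x'$; $X$ is complete if $(X,d_X)$ is complete. A $C^1$ map $f$ is Fredholm of index $0$ if for every $x\in X$, $df(x):T_xX\to T_{f(x)}Y$ has finite-dimensional kernel and cokernel of equal dimension. With $y=f(x)$: $\operatorname{Inj} df(x)=\inf_{\|v\|_x=1}\|df(x)v\|_y$ and $\operatorname{Sur} df(x)=\inf\{\|df(x)^*v^*\|_x: v^*\in(T_yY)^*,\ \|v^*\|_y=1\}$ (dual norms). A weight is a function $\eta:[0,\infty)\to(0,\infty)$ with $\int_0^\infty\eta(\rho)\,d\rho=\infty$; one writes $\omega=1/\eta$. *)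

(* Defs.v *)
From HB Require Import structures.
From mathcomp Require Import all_boot all_order all_algebra.
From mathcomp Require Import all_classical all_reals all_analysis.

Set Implicit Arguments.
Unset Strict Implicit.
Unset Printing Implicit Defensive.
Import Order.TTheory GRing.Theory Num.Theory.
Import numFieldNormedType.Exports.
Local Open Scope classical_set_scope.
Local Open Scope ring_scope.

(* Paracompactness includes the Hausdorff axiom. *)
Definition paracompact (T : topologicalType) : Prop :=
  hausdorff_space T /\
  forall C : set (set T),
    (forall U, C U -> open U) -> \bigcup_(U in C) U = setT ->
    exists D : set (set T),
      [/\ forall V, D V -> open V,
          \bigcup_(V in D) V = setT,
          forall V, D V -> exists2 U, C U & V `<=` U &
          forall x : T, exists2 N, nbhs x N &
            finite_set [set V | D V /\ V `&` N !=set0]].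

Definition path_connected (R : realType) (T : topologicalType) : Prop :=
  forall x y : T, exists g : R -> T,
    [/\ {within `[0, 1], continuous g}, g 0 = x & g 1 = y].

(* Every loop is homotopic, relative to its base point, to a constant one. *)
Definition simply_connected (R : realType) (T : topologicalType) : Prop :=
  path_connected R T /\
  forall g : R -> T, {within `[0, 1], continuous g} -> g 0 = g 1 ->
    exists H : R * R -> T,
      [/\ {within `[0, 1] `*` `[0, 1], continuous H},
          forall t, t \in `[0, 1] -> H (t, 0) = g t /\ H (t, 1) = g 0 &
          forall s, s \in `[0, 1] -> H (0, s) = g 0 /\ H (1, s) = g 0].

(* Intended for open U. The last clause is continuity of p |-> 'd g p for the
   operator norm. *)
Definition C1_on (R : realType) (E F : normedModType R) (U : set E)
    (g : E -> F) : Prop :=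
  forall p, U p -> differentiable g p /\
    forall e : R, 0 < e ->
      \forall q \near p, forall v, `|'d g q v - 'd g p v| <= e * `|v|.

(* The values of the total functions fwd outside dom and bwd outside
   fwd @` dom are irrelevant. *)
Record chart (T : Type) (E : Type) := Chart {
  dom : set T;
  fwd :> T -> E;
  bwd : E -> T }.

Definition is_chart (R : realType) (T : topologicalType)
    (E : normedModType R) (c : chart T E) : Prop :=
  [/\ open (dom c), open (fwd c @` dom c),
      forall x, dom c x -> bwd c (fwd c x) = x,
      {within dom c, continuous (fwd c)} &
      {within fwd c @` dom c, continuous (bwd c)}].

Definition C1_compatible (R : realType) (T : topologicalType)
    (E : normedModType R) (c c' : chart T E) : Prop :=
  C1_on (fwd c @` (dom c `&` dom c')) (fwd c' \o bwd c) /\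
  C1_on (fwd c' @` (dom c `&` dom c')) (fwd c \o bwd c').

(* A manifold carries its maximal C^1 atlas; a manifold of higher class is
   regarded as a C^1 manifold. *)
Record banach_manifold (R : realType) (E : completeNormedModType R) :=
  BanachManifold {
    carrier :> topologicalType;
    atlas : set (chart carrier E);
    carrier_nonempty : [set: carrier] !=set0;
    carrier_paracompact : paracompact carrier;
    atlas_chart : forall c, atlas c -> is_chart c;
    atlas_cover : forall x, exists c, atlas c /\ dom c x;
    atlas_compatible : forall c c', atlas c -> atlas c' -> C1_compatible c c';
    atlas_maximal : forall c, is_chart c ->
      (forall c', atlas c' -> C1_compatible c c') -> atlas c }.

Definition chart_at (R : realType) (E : completeNormedModType R)
    (X : banach_manifold E) (x : X) : chart X E :=
  projT1 (cid (atlas_cover x)).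

(* The tangent space at x is E itself: v : E stands for the tangent vector
   whose coordinate in the preferred chart [chart_at x] is v. Its vector space
   structure and its topology do not depend on the preferred chart. As a set,
   the tangent bundle is then X * E; its topology is the one for which
   (x, w) |-> (x, tvec c x w) is a homeomorphism from dom c * E onto an open
   set for each chart c. *)
Definition tangent (R : realType) (E : completeNormedModType R)
  (X : banach_manifold E) (x : X) : completeNormedModType R := E.

(* v_x(w) = d(c^-1)(c(x)) w, the tangent vector with coordinate w in c. *)
Definition tvec (R : realType) (E : completeNormedModType R)
    (X : banach_manifold E) (c : chart X E) (x : X) (w : E) : tangent x :=
  'd (fwd (chart_at x) \o bwd c) (fwd c x) w.

Record finsler_manifold (R : realType) (E : completeNormedModType R) :=
  FinslerManifold {
    underlying :> banach_manifold E;
    fnorm : forall x : underlying, tangent x -> R;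
    fnormD : forall (x : underlying) (v w : tangent x),
      fnorm (v + w) <= fnorm v + fnorm w;
    fnormZ : forall (x : underlying) (a : R) (v : tangent x),
      fnorm (a *: v) = `|a| * fnorm v;
    fnorm_eq0 : forall (x : underlying) (v : tangent x),
      fnorm v = 0 -> v = 0;
    fnorm_equiv : forall (x : underlying) (c : chart underlying E),
      atlas c -> dom c x ->
      exists a b : R, [/\ 0 < a, 0 < b &
        forall w, a * `|w| <= fnorm (tvec c x w) <= b * `|w|];
    fnorm_continuous : forall c : chart underlying E, atlas c ->
      {within dom c `*` [set: E],
        continuous (fun p : underlying * E => fnorm (tvec c p.1 p.2))};
    fnorm_local : forall (x0 : underlying) (k : R), 1 < k ->
      exists c : chart underlying E, [/\ atlas c, dom c x0 &
        forall x w, dom c x ->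
          k^-1 * fnorm (tvec c x0 w) <= fnorm (tvec c x w)
            <= k * fnorm (tvec c x0 w)] }.

(* Derivative at t of the path a, read in the chart c; it is one-sided at the
   endpoints of [0, 1]. *)
Definition chart_deriv (R : realType) (E : completeNormedModType R)
    (X : banach_manifold E) (c : chart X E) (a : R -> X) (t : R) : E :=
  lim ((fun s => (s - t)^-1 *: (fwd c (a s) - fwd c (a t)))
         @ within `[0, 1] t^').

Definition C1_path (R : realType) (E : completeNormedModType R)
    (X : banach_manifold E) (a : R -> X) : Prop :=
  {within `[0, 1], continuous a} /\
  forall (c : chart X E) (t : R), atlas c -> t \in `[0, 1] -> dom c (a t) ->
    cvg ((fun s => (s - t)^-1 *: (fwd c (a s) - fwd c (a t)))
           @ within `[0, 1] t^') /\
    chart_deriv c a s @[s --> within `[0, 1] (nbhs t)] --> chart_deriv c a t.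

Definition velocity (R : realType) (E : completeNormedModType R)
    (X : banach_manifold E) (a : R -> X) (t : R) : tangent (a t) :=
  chart_deriv (chart_at (a t)) a t.

Definition path_length (R : realType) (E : completeNormedModType R)
    (X : finsler_manifold E) (a : R -> X) : R :=
  \int[lebesgue_measure]_(t in `[0, 1]) fnorm (velocity a t).

Definition fdist (R : realType) (E : completeNormedModType R)
    (X : finsler_manifold E) (x x' : X) : R :=
  inf [set path_length a | a in
         [set a : R -> X | [/\ C1_path a, a 0 = x & a 1 = x']]].

Definition finsler_complete (R : realType) (E : completeNormedModType R)
    (X : finsler_manifold E) : Prop :=
  forall u : nat -> X,
    (forall e : R, 0 < e -> exists N : nat,
       forall m n, (N <= m)%N -> (N <= n)%N -> fdist (u m) (u n) < e) ->
    exists x : X, fdist (u n) x @[n --> \oo] --> (0 : R).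

Definition C1_map (R : realType) (E F : completeNormedModType R)
    (X : banach_manifold E) (Y : banach_manifold F) (f : X -> Y) : Prop :=
  continuous f /\
  forall (c : chart X E) (c' : chart Y F), atlas c -> atlas c' ->
    C1_on (fwd c @` (dom c `&` f @^-1` dom c')) (fwd c' \o f \o bwd c).

Definition global_diffeomorphism (R : realType)
    (E F : completeNormedModType R) (X : banach_manifold E)
    (Y : banach_manifold F) (f : X -> Y) : Prop :=
  C1_map f /\
  exists g : Y -> X, [/\ cancel f g, cancel g f & C1_map g].

Definition tdiff (R : realType) (E F : completeNormedModType R)
    (X : banach_manifold E) (Y : banach_manifold F) (f : X -> Y) (x : X) :
    {linear tangent x -> tangent (f x)} :=
  'd (fwd (chart_at (f x)) \o f \o bwd (chart_at x)) (fwd (chart_at x) x).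

(* For subspaces W `<=` V, the quotient V / W has dimension n: the e i are
   representatives of a basis. *)
Definition quotient_dim (R : realType) (E : lmodType R) (V W : set E)
    (n : nat) : Prop :=
  exists e : 'I_n -> E,
    [/\ forall i, V (e i),
        forall a : 'I_n -> R, W (\sum_i a i *: e i) -> forall i, a i = 0 &
        forall v, V v -> exists a : 'I_n -> R, W (v - \sum_i a i *: e i)].

Definition fredholm_index0 (R : realType) (E F : completeNormedModType R)
    (X : banach_manifold E) (Y : banach_manifold F) (f : X -> Y) : Prop :=
  forall x : X, exists n : nat,
    quotient_dim [set v | tdiff f x v = 0] [set 0] n /\
    quotient_dim setT (range (tdiff f x)) n.

(* Both moduli take values in \bar R so that the infimum over an empty unit
   sphere (zero-dimensional manifolds) is +oo. *)
Definition inj_modulus (R : realType) (E F : completeNormedModType R)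
    (X : finsler_manifold E) (Y : finsler_manifold F) (f : X -> Y) (x : X) :
    \bar R :=
  ereal_inf [set (fnorm (tdiff f x v))%:E | v in
               [set v : tangent x | fnorm v = 1]].

Definition dual_norm (R : realType) (E : completeNormedModType R)
    (X : finsler_manifold E) (x : X) (l : tangent x -> R) : \bar R :=
  ereal_sup [set `|l v|%:E | v in [set v : tangent x | fnorm v <= 1]].

Definition sur_modulus (R : realType) (E F : completeNormedModType R)
    (X : finsler_manifold E) (Y : finsler_manifold F) (f : X -> Y) (x : X) :
    \bar R :=
  ereal_inf [set dual_norm (l \o tdiff f x) | l in
               [set l : {linear tangent (f x) -> R^o} |
                  continuous l /\ dual_norm l = 1%:E]].

(* Only the values of eta on [0, +oo[ matter. *)
Definition weight (R : realType) (eta : R -> R) : Prop :=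
  (forall r : R, 0 <= r -> 0 < eta r) /\
  (\int[lebesgue_measure]_(r in `[0%R, +oo[) (eta r)%:E = +oo)%E.

Definition continuous_weight (R : realType) (eta : R -> R) : Prop :=
  weight eta /\ {within `[0, +oo[, continuous eta}.

Definition nonincreasing_weight (R : realType) (eta : R -> R) : Prop :=
  weight eta /\ forall r s : R, 0 <= r -> r <= s -> eta s <= eta r.

Definition strong_submersion (R : realType) (E F : completeNormedModType R)
    (X : finsler_manifold E) (Y : finsler_manifold F) (f : X -> Y) : Prop :=
  ~ exists (u : nat -> X) (y : Y),
      f (u n) @[n --> \oo] --> y /\ sur_modulus f (u n) @[n --> \oo] --> 0%:E.

Definition strong_submersion_continuous_weight (R : realType)
    (E F : completeNormedModType R) (X : finsler_manifold E)
    (Y : finsler_manifold F) (f : X -> Y) : Prop :=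
  exists (eta : R -> R) (x0 : X), continuous_weight eta /\
    ~ exists (u : nat -> X) (y : Y),
        f (u n) @[n --> \oo] --> y /\
        (sur_modulus f (u n) * ((eta (fdist x0 (u n)))^-1)%:E)%E @[n --> \oo] --> 0%:E.

Definition earle_eells (R : realType) (E F : completeNormedModType R)
    (X : finsler_manifold E) (Y : finsler_manifold F) (f : X -> Y)
    (mu : X -> \bar R) : Prop :=
  forall y : Y, exists (alpha : R) (V : set Y),
    [/\ 0 < alpha, nbhs y V &
        forall x, (f @^-1` V) x -> (alpha%:E <= mu x)%E].

Definition earle_eells_nonincreasing_weight (R : realType)
    (E F : completeNormedModType R) (X : finsler_manifold E)
    (Y : finsler_manifold F) (f : X -> Y) (mu : X -> \bar R) : Prop :=
  exists (eta : R -> R) (x0 : X), nonincreasing_weight eta /\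
    forall y : Y, exists (alpha : R) (V : set Y),
      [/\ 0 < alpha, nbhs y V &
          forall x, (f @^-1` V) x ->
            (alpha%:E <= mu x * ((eta (fdist x0 x))^-1)%:E)%E].

(* Main.v *)
From HB Require Import structures.
Require Import Defs.
From mathcomp Require Import all_boot all_order all_algebra.
From mathcomp Require Import all_classical all_reals all_analysis.
From mathcomp Require Import measurable_realfun.
From mathcomp Require Import ring lra.
Set Implicit Arguments.
Unset Strict Implicit.
Unset Printing Implicit Defensive.
Import Order.TTheory GRing.Theory Num.Theory.
Import numFieldNormedType.Exports.
Local Open Scope classical_set_scope.
Local Open Scope ring_scope.

(* By a Gronwall-type estimate, a weighted lower bound on df near y keeps the
   lift of a coordinate segment near y at bounded distance from x0, because the
   weight has infinite integral; df is then uniformly expanding along the lift,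
   which is therefore Lipschitz and converges at the end time by completeness.
   So f has continuous local sections through every point of the fibre over y,
   hence lifts paths and homotopies, and is bijective because Y is simply
   connected.  For Inj the Fredholm condition turns the lower bound into
   surjectivity of df; for Sur it turns surjectivity, obtained from Hahn-Banach,
   into injectivity. *)

(** * Derivatives of paths *)

(** Distances along a lift have no derivative in general and a nonincreasing weight may jump, so no
    differential inequality can be integrated. The estimates use local upper slopes only, propagated
    by induction on a real interval, and the weight enters through a primitive [N]: in the growth of
    [N] at the distance from [x0], the weight cancels against the local Lipschitz constant of the
    lift. The distance is an infimum over C^1 paths, whose concatenations are only piecewise C^1;
    paths are therefore made to rest at both ends before they are joined. The section through [x]
    sends [z] to the endpoint of the lift of the coordinate segment from [f x] to [z]; its
    continuity is the continuous dependence of lifts on a parameter. The Hahn-Banach argument for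
    Sur yields only approximate solutions with a controlled norm; summing the corrections costs the
    constant 4. *)

Lemma real_induction (R : realType) (a b : R) (P : R -> Prop) :
  P a ->
  (forall t, a <= t < b -> (forall s, a <= s <= t -> P s) ->
     exists2 d : R, 0 < d & forall s, t < s < t + d -> s <= b -> P s) ->
  (forall t, a < t <= b -> (forall s, a <= s < t -> P s) -> P t) ->
  forall t, a <= t <= b -> P t.
Proof.
move=> Pa Pstep Plim t0 t0ab; apply: contrapT => nPt0.
(* The points of failure: [P] holds below their infimum, the limit hypothesis gives [P] at the
   infimum, and the step hypothesis moves past it, against the choice of the infimum. *)
pose S := [set s | a <= s <= b /\ ~ P s].
have infS : has_inf S by split; [exists t0 | exists a => s [/andP[]]].
have Sge s : S s -> inf S <= s by move=> Ss; apply: ge_inf => //; exact: infS.2.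
have am : a <= inf S by apply: lb_le_inf => [|s [/andP[]]//]; exists t0.
have mb : inf S <= b.
  by apply: (le_trans (Sge t0 (conj t0ab nPt0))); case/andP: t0ab.
have Plt s : a <= s < inf S -> P s.
  move=> /andP[as_ sm]; apply: contrapT => nPs.
  have : S s by split => //; rewrite as_/= (le_trans (ltW sm)).
  by move=> /Sge; rewrite leNgt sm.
have Pm : P (inf S).
  move: am; rewrite le_eqVlt => /predU1P[<-//|am].
  by apply: Plim => //; rewrite am.
have Ple s : a <= s <= inf S -> P s.
  move=> /andP[as_]; rewrite le_eqVlt => /predU1P[->//|sm].
  by apply: Plt; rewrite as_.
move: mb; rewrite le_eqVlt => /predU1P[mb|mb].
  by apply: nPt0; apply: Ple; rewrite mb.
have [|d d0 Pd] := Pstep (inf S) _ Ple; first by rewrite am.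
have [s [sab nPs] sd] := inf_adherent d0 infS.
have := Sge s (conj sab nPs); rewrite le_eqVlt => /predU1P[ms|ms].
  by apply: nPs; rewrite -ms.
by apply: nPs; apply: Pd; [rewrite ms | case/andP: sab].
Qed.

Lemma near_distP (R : realType) (E : normedModType R) (p : E) (P : set E) :
  (\forall q \near p, P q) <->
  exists2 d : R, 0 < d & forall q, `|q - p| < d -> P q.
Proof.
split=> [/nbhs_normP[d /= d0 Pd]|[d d0 Pd]]; last first.
  by apply/nbhs_normP; exists d => // q /=; rewrite distrC => /Pd.
by exists d => // q; rewrite distrC => qp; apply: Pd.
Qed.

(** A derivative without division, relative to [A]: for the unit interval it is the one-sided notion
    of [chart_deriv] at the endpoints, for [setT] the usual one. *)
Definition deriv_in (R : realType) (E : normedModType R) (A : set R)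
    (g : R -> E) (t : R) (v : E) : Prop :=
  forall e : R, 0 < e -> \forall s \near t,
    A s -> `|g s - g t - (s - t) *: v| <= e * `|s - t|.

Section deriv_in_theory.
Context {R : realType}.

Lemma deriv_in_lipschitz (E : normedModType R) A (g : R -> E) t v :
  deriv_in A g t v ->
  \forall s \near t, A s -> `|g s - g t| <= (`|v| + 1) * `|s - t|.
Proof.
move=> /(_ 1 ltr01); apply: filterS => s gs /gs {}gs.
rewrite -[g s - g t](subrK ((s - t) *: v)) (le_trans (ler_normD _ _))//.
rewrite normrZ mulrDl addrC mul1r (mulrC `|v|) lerD2l.
by rewrite (le_trans gs)// mul1r.
Qed.

Lemma deriv_in_continuous (E : normedModType R) (g : R -> E) t v :
  deriv_in setT g t v -> {for t, continuous g}.
Proof.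
move=> /deriv_in_lipschitz gt; apply/cvgrPdist_le => e e0.
have d0 : 0 < e / (`|v| + 1) by rewrite divr_gt0// ltr_wpDl.
have /near_distP[d d1 gd] := gt.
suff : \forall s \near t, `|g t - g s| <= e by [].
apply/near_distP; exists (Num.min d (e / (`|v| + 1))); first by rewrite lt_min d1.
move=> s; rewrite lt_min => /andP[/gd/(_ I) gs]; move=> st.
by rewrite distrC (le_trans gs)// mulrC -ler_pdivlMr ?ltr_wpDl// ltW.
Qed.

Lemma deriv_in_subset (E : normedModType R) (A B : set R) (g : R -> E) t v :
  A `<=` B -> deriv_in B g t v -> deriv_in A g t v.
Proof. by move=> AB gv e /gv; apply: filterS => s gs /AB. Qed.

Lemma deriv_in_near_eq (E : normedModType R) (A : set R) (g h : R -> E) t v :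
  (\forall s \near t, g s = h s) -> deriv_in A g t v -> deriv_in A h t v.
Proof.
move=> gh gv e /gv; have ght := nbhs_singleton gh; apply: filterS2 gh => s.
by move=> ->; rewrite ght.
Qed.

Lemma deriv_inP (E : normedModType R) (A : set R) (g : R -> E) t v :
  deriv_in A g t v <->
  (s - t)^-1 *: (g s - g t) @[s --> within A t^'] --> v.
Proof.
have key s e : s != t -> 0 < e ->
  (`|v - (s - t)^-1 *: (g s - g t)| <= e) =
  (`|g s - g t - (s - t) *: v| <= e * `|s - t|).
  move=> st e0; have st0 : s - t != 0 by rewrite subr_eq0.
  have -> : g s - g t - (s - t) *: v =
      - ((s - t) *: (v - (s - t)^-1 *: (g s - g t))).
    by rewrite scalerBr scalerA divff// scale1r opprB.
  by rewrite normrN normrZ mulrC ler_pM2r// normr_gt0.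
split=> [gv|gv e e0].
  apply/cvgrPdist_le => e e0; near_simpl.
  rewrite near_withinE /dnbhs near_withinE; apply: filterS (gv _ e0).
  by move=> s + st As => /(_ As); rewrite key.
move/cvgrPdist_le : gv => /(_ _ e0); near_simpl; rewrite near_withinE.
rewrite /dnbhs near_withinE; apply: filterS => s + As.
have [->|st] := eqVneq s t; last by move=> /(_ isT As); rewrite key.
by rewrite !subrr scale0r subrr !normr0 mulr0.
Qed.

Lemma differentiable_nearP (E F : normedModType R) (f : E -> F) p :
  differentiable f p <-> continuous ('d f p) /\ forall e : R, 0 < e ->
  \forall q \near p, `|f q - f p - 'd f p (q - p)| <= e * `|q - p|.
Proof.
split=> [/diff_locallyP[dc /eqaddoP fp]|[dc fp]].
  split=> // e /fp /near_distP[d d0 fd]; apply/near_distP; exists d => // q qp.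
  have := fd (q - p); rewrite subr0 => /(_ qp); rewrite /= !fctE/=.
  by rewrite /shift/= subrK opprD addrA.
apply/diff_locallyP; split=> //; apply/eqaddoP => e /fp /near_distP[d d0 fd].
apply/near_distP; exists d => // q; rewrite subr0 => qp.
have := fd (q + p); rewrite addrK => /(_ qp); rewrite /= !fctE/=.
by rewrite /shift/= opprD addrA.
Qed.

Lemma differentiable_near (E F : normedModType R) (f : E -> F) p :
  differentiable f p -> forall e : R, 0 < e ->
  \forall q \near p, `|f q - f p - 'd f p (q - p)| <= e * `|q - p|.
Proof. by move=> /differentiable_nearP[]. Qed.

Lemma differentiableI (E F : normedModType R) (f : E -> F) p
    (L : {linear E -> F}) : continuous L ->
  (forall e : R, 0 < e ->
    \forall q \near p, `|f q - f p - L (q - p)| <= e * `|q - p|) ->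
  differentiable f p /\ 'd f p = L :> (E -> F).
Proof.
move=> Lc fp.
have dL : 'd f p = L :> (E -> F).
  apply: diff_unique => //; apply/eqaddoP => e /fp /near_distP[d d0 fd].
  apply/near_distP; exists d => // q; rewrite subr0 => qp.
  have := fd (q + p); rewrite addrK => /(_ qp); rewrite /= !fctE/=.
  by rewrite /shift/= opprD addrA.
by split => //; apply/differentiable_nearP; rewrite dL.
Qed.

Lemma differentiable_near_eq (E F : normedModType R) (f g : E -> F) p :
  (\forall q \near p, f q = g q) -> differentiable f p ->
  differentiable g p /\ 'd g p = 'd f p :> (E -> F).
Proof.
move=> fg /differentiable_nearP[dc fp]; apply: differentiableI => // e /fp.
by have fgp := nbhs_singleton fg; apply: filterS2 fg => q ->; rewrite fgp.
Qed.

Lemma deriv_in_diff (E F : normedModType R) A (g : R -> E) (f : E -> F) t v :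
  deriv_in A g t v -> differentiable f (g t) ->
  deriv_in A (f \o g) t ('d f (g t) v).
Proof.
move=> gv fg e e0; have [fc _] := (differentiable_nearP _ _).1 fg.
have [k k0 fk] := linear_lipschitz fc.
have v1 : 0 < `|v| + 1 by rewrite ltr_wpDl.
(* [e1] absorbs the remainder of [f], through the Lipschitz bound [|v| + 1] of [g]; [e2] absorbs the
   remainder of [g], through the bound [k] of the differential. *)
pose e1 := e / 2 / (`|v| + 1); pose e2 := e / 2 / k.
have e10 : 0 < e1 by rewrite !divr_gt0.
have e20 : 0 < e2 by rewrite !divr_gt0.
have /near_distP[d1 d10 fd1] := differentiable_near fg e10.
have /near_distP[d2 d20 gd2] := gv _ e20.
have /near_distP[d3 d30 gd3] := deriv_in_lipschitz gv.
apply/near_distP; exists (Num.min d2 (Num.min d3 (d1 / (`|v| + 1)))).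
  by rewrite !lt_min d20 d30 divr_gt0.
move=> s; rewrite !lt_min => /and3P[sd2 sd3 sd1] As.
have gs : `|g s - g t| <= (`|v| + 1) * `|s - t| by apply: gd3.
have gst : `|g s - g t| < d1.
  by rewrite (le_lt_trans gs)// mulrC -ltr_pdivlMr.
have -> : (f \o g) s - (f \o g) t - (s - t) *: 'd f (g t) v =
   (f (g s) - f (g t) - 'd f (g t) (g s - g t)) +
   'd f (g t) (g s - g t - (s - t) *: v).
  have -> : 'd f (g t) (g s - g t - (s - t) *: v) =
    'd f (g t) (g s - g t) - (s - t) *: 'd f (g t) v by rewrite linearB linearZ.
  by rewrite addrA subrK.
rewrite (le_trans (ler_normD _ _))// (splitr e) mulrDl lerD//.
  rewrite (le_trans (fd1 _ gst))//.
  rewrite (le_trans (ler_wpM2l (ltW e10) gs))// /e1.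
  by rewrite mulrA divfK// gt_eqF.
rewrite (le_trans (fk _))//.
rewrite (le_trans (ler_wpM2l (ltW k0) (gd2 _ sd2 As)))// /e2.
by rewrite mulrA mulrC [k * _]mulrC divfK ?gt_eqF// mulrC.
Qed.

Lemma deriv_in_comp (E : normedModType R) A (g : R -> E) (p : R -> R) t v c :
  (forall s, A (p s)) -> deriv_in A g (p t) v -> deriv_in setT p t c ->
  deriv_in setT (g \o p) t (c *: v).
Proof.
move=> Ap gv pc e e0.
have c1 : 0 < `|c| + 1 by rewrite ltr_wpDl.
have v1 : 0 < `|v| + 1 by rewrite ltr_wpDl.
pose e1 := e / 2 / (`|c| + 1); pose e2 := e / 2 / (`|v| + 1).
have e10 : 0 < e1 by rewrite !divr_gt0.
have e20 : 0 < e2 by rewrite !divr_gt0.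
have /near_distP[d1 d10 gd1] := gv _ e10.
have /near_distP[d2 d20 pd2] := pc _ e20.
have /near_distP[d3 d30 pd3] := deriv_in_lipschitz pc.
apply/near_distP; exists (Num.min d2 (Num.min d3 (d1 / (`|c| + 1)))).
  by rewrite !lt_min d20 d30 divr_gt0.
move=> s; rewrite !lt_min => /and3P[sd2 sd3 sd1] _.
have ps : `|p s - p t| <= (`|c| + 1) * `|s - t| by apply: pd3.
have pst : `|p s - p t| < d1 by rewrite (le_lt_trans ps)// mulrC -ltr_pdivlMr.
have -> : (g \o p) s - (g \o p) t - (s - t) *: (c *: v) =
   (g (p s) - g (p t) - (p s - p t) *: v) + (p s - p t - (s - t) * c) *: v.
  by rewrite [X in _ = _ + X]scalerBl scalerA addrA subrK.
apply: le_trans (ler_normD _ _) _.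
rewrite (splitr e) [leRHS]mulrDl lerD//.
  rewrite (le_trans (gd1 _ pst (Ap s)))//.
  by rewrite (le_trans (ler_wpM2l (ltW e10) ps))// /e1 mulrA divfK// gt_eqF.
rewrite normrZ; have p2 := pd2 _ sd2 I.
apply: (@le_trans _ _ (e2 * `|s - t| * (`|v| + 1))).
  by rewrite ler_pM// lerDl.
by rewrite /e2 mulrAC divfK// gt_eqF.
Qed.

Lemma deriv_in_affine (k m t : R) : deriv_in setT (fun s => k * s + m) t k.
Proof.
move=> e e0; apply/near_distP; exists 1 => // s _ _.
have -> : k * s + m - (k * t + m) - (s - t) *: k = 0 by rewrite /GRing.scale/=; ring.
by rewrite normr0 mulr_ge0// ltW.
Qed.

Lemma deriv_in_cst (E : normedModType R) A (v : E) t : deriv_in A (fun=> v) t 0.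
Proof.
move=> e e0; apply/near_distP; exists 1 => // s _ _.
by rewrite scaler0 !subrr normr0 mulr_ge0// ltW.
Qed.

Lemma deriv_inD (E : normedModType R) A (g h : R -> E) t v w :
  deriv_in A g t v -> deriv_in A h t w ->
  deriv_in A (fun s => g s + h s) t (v + w).
Proof.
move=> gv hw e e0; have e2 : 0 < e / 2 by rewrite divr_gt0.
have := hw _ e2; apply: filterS2 (gv _ e2) => s gs hs As.
have -> : g s + h s - (g t + h t) - (s - t) *: (v + w) =
  (g s - g t - (s - t) *: v) + (h s - h t - (s - t) *: w).
  by have D (x y z u : E) : x + y - (z + u) = x - z + (y - u);
     rewrite ?scalerDr ?D// opprD addrACA.
by rewrite (le_trans (ler_normD _ _))// (splitr e) mulrDl lerD// ?gs ?hs.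
Qed.

Lemma deriv_inZ (E : normedModType R) A (p : R -> R) (v : E) t c :
  deriv_in A p t c -> deriv_in A (fun s => p s *: v) t (c *: v).
Proof.
move=> pc e e0; have v1 : 0 < `|v| + 1 by rewrite ltr_wpDl.
have e2 : 0 < e / (`|v| + 1) by rewrite divr_gt0.
apply: filterS (pc _ e2) => s ps /ps {}ps.
rewrite -scalerBl scalerA -scalerBl normrZ.
apply: (@le_trans _ _ (e / (`|v| + 1) * `|s - t| * (`|v| + 1))).
  by rewrite ler_pM// lerDl.
by rewrite mulrAC divfK// gt_eqF.
Qed.

Lemma deriv_inN (E : normedModType R) A (g : R -> E) t v :
  deriv_in A g t v -> deriv_in A (fun s => - g s) t (- v).
Proof.
move=> gv e /gv; apply: filterS => s gs /gs; apply: le_trans.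
by rewrite scalerN -opprD -opprD normrN.
Qed.

Lemma deriv_in_is_derive (g : R -> R) t v :
  deriv_in setT g t v <-> is_derive t 1 g v.
Proof.
(* The candidate differential has to be a bundled linear map: multiplication by [v] is packed as
   one. *)
pose sc := GRing.isLinear.Build R R R *:%R ( *:%R ^~ v : R -> R)
  (fun a x y => etrans (scalerDl v (a *: x) y) (congr1 (+%R^~ _) (esym (scalerA a x v)))).
pose L : {linear R -> R} := HB.pack ( *:%R ^~ v : R -> R) sc.
split=> [gv|[/derivable1_diffP dg gv]].
  have [dg gL] : differentiable g t /\ 'd g t = L :> (R -> R).
    apply: differentiableI; first exact: scalel_continuous.
    by move=> e /gv; apply: filterS => s; exact.
  by apply: DeriveDef; [exact/derivable1_diffP|rewrite deriveE// gL/= scale1r].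
move=> e e0; apply: filterS (differentiable_near dg e0) => s + _.
by rewrite -[X in 'd g t X]mulr1 linearZ/= -deriveE// gv.
Qed.

(** Real induction: the step adds two slopes and continuity passes to the limit. Only upper slopes
    to the right are asked for, so the lemma applies to norms and to distances along a lift. *)
Lemma le_of_local_slope (f : R -> R) (a b C : R) : a <= b ->
  (forall t, a <= t <= b -> {for t, continuous f}) ->
  (forall t, a <= t < b -> exists2 d : R, 0 < d &
     forall s, t < s < t + d -> s <= b -> f s - f t <= C * (s - t)) ->
  f b - f a <= C * (b - a).
Proof.
move=> ab fc fC.
suff : forall t, a <= t <= b -> f t - f a <= C * (t - a).
  by apply; rewrite ab lexx.
apply: real_induction => [|t tab IH|t /andP[at_ tb] IH].
- by rewrite !subrr mulr0.
- have [d d0 fd] := fC _ tab; exists d => // s sd sb; have := fd _ sd sb.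
  have := IH t; rewrite lexx andbT => /(_ (proj1 (andP tab))); lra.
- have ft : {for t, continuous f} by apply: fc; rewrite tb ltW.
  apply/ler_addgt0Pr => e e0.
  have e2 : 0 < e / 2 by rewrite divr_gt0.
  have /near_distP[d d0 fd] : \forall s \near t, `|f t - f s| <= e / 2.
    by move/cvgrPdist_le : ft; apply.
  have C1 : 0 < `|C| + 1 by rewrite ltr_wpDl.
  (* [h] is so small that both the variation of [f] from [t - h] to [t] and [- C * h] cost at most
     half of [e]. *)
  pose h := Num.min (Num.min (d / 2) (t - a)) (e / 2 / (`|C| + 1)).
  have h0 : 0 < h by rewrite !lt_min subr_gt0 at_ !divr_gt0.
  have [hd ha he] : [/\ h <= d / 2, h <= t - a & h <= e / 2 / (`|C| + 1)].
    by rewrite !ge_min !lexx !orbT.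
  have := IH (t - h); rewrite gtrBl h0 andbT lerBrDr addrC -lerBrDr => /(_ ha).
  have : `|f t - f (t - h)| <= e / 2.
    by apply: fd; rewrite addrAC subrr add0r normrN gtr0_norm//; lra.
  move/ler_normlW; rewrite ler_pdivlMr// in he.
  have : - C * h <= e / 2.
    apply: le_trans he; rewrite mulrC ler_pM2l// (le_trans (ler_norm _))//.
    by rewrite normrN lerDl.
  nra.
Qed.

(** By the triangle inequality the right slopes of [|g t - g 0|] are at most [M + e]; letting [e]
    tend to 0 spares any vector-valued integral. *)
Lemma mean_value_le (E : normedModType R) (g g' : R -> E) M :
  (forall t, 0 <= t <= 1 -> deriv_in setT g t (g' t)) ->
  (forall t, 0 <= t <= 1 -> `|g' t| <= M) -> `|g 1 - g 0| <= M.
Proof.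
move=> gg' gM; apply/ler_addgt0Pr => e e0.
have gc t : 0 <= t <= 1 -> {for t, continuous g}.
  by move=> /gg'; exact: deriv_in_continuous.
have := @le_of_local_slope (fun t => `|g t - g 0|) 0 1 (M + e).
rewrite subrr normr0 !subr0 mulr1; apply => // t t01.
  apply: cvg_norm; apply: cvgB; [exact: gc|exact: cvg_cst].
have {}t01 : 0 <= t <= 1 by case/andP: t01 => -> /ltW.
have /near_distP[d d0 gd] := gg' _ t01 _ e0; exists d => // s /andP[ts sd] s1.
have := gd s; rewrite gtr0_norm ?subr_gt0// ltrBlDl => /(_ sd I) {}gd.
have gst : `|g s - g t| <= (M + e) * (s - t).
  rewrite -[g s - g t](subrK ((s - t) *: g' t)).
  rewrite (le_trans (ler_normD _ _))// mulrDl addrC lerD// normrZ.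
  by rewrite gtr0_norm ?subr_gt0// mulrC ler_pM2r ?subr_gt0// gM.
have := ler_distD (g t) (g s) (g 0); lra.
Qed.

End deriv_in_theory.

(** * A reparametrization that rests at both ends *)

Definition clamp01 (R : realType) (t : R) : R := Num.max 0 (Num.min t 1).

(** The cubic [3 u^2 - 2 u^3] rises from 0 to 1 with zero slope at both ends: a C^1 path composed
    with it stays C^1 when continued by constants. *)
Definition smoothstep (R : realType) (t : R) : R :=
  let u := clamp01 t in u ^+ 2 * (3 - 2 * u).

Definition smoothstep' (R : realType) (t : R) : R :=
  let u := clamp01 t in 6 * u * (1 - u).

Section smoothstep_theory.
Context {R : realType}.
Implicit Types t s : R.

Lemma clamp01_bounds t : 0 <= clamp01 t <= 1.
Proof. by rewrite /clamp01 le_max lexx/= ge_max ler01 ge_min lexx orbT. Qed.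

Lemma clamp01_id t : 0 <= t <= 1 -> clamp01 t = t.
Proof. by move=> /andP[t0 t1]; rewrite /clamp01 (min_idPl t1) (max_idPr t0). Qed.

Lemma clamp01_le0 t : t <= 0 -> clamp01 t = 0.
Proof. by move=> t0; apply/max_idPl; rewrite ge_min t0. Qed.

Lemma clamp01_ge1 t : 1 <= t -> clamp01 t = 1.
Proof. by move=> t0; rewrite /clamp01 (min_idPr t0) (max_idPr ler01). Qed.

Lemma clamp01_continuous : continuous (@clamp01 R).
Proof.
move=> t; apply: (@continuous_max R R (cst 0) (fun t => Num.min t 1)).
  exact: cvg_cst.
by apply: (@continuous_min R R id (cst 1)); [exact: cvg_id|exact: cvg_cst].
Qed.

Lemma smoothstep_bounds t : 0 <= smoothstep t <= 1.
Proof.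
rewrite /smoothstep; have /andP[] := clamp01_bounds t.
set u := clamp01 _ => u0 u1.
have := mulr_ge0 (sqr_ge0 u) (_ : 0 <= 3 - 2 * u).
have := mulr_ge0 (sqr_ge0 (1 - u)) (_ : 0 <= 1 + 2 * u).
by move=> A B; apply/andP; split; [apply: B; lra|move: A => /(_ ltac:(lra)); lra].
Qed.

Lemma smoothstep_le0 t : t <= 0 -> smoothstep t = 0.
Proof. by rewrite /smoothstep => /clamp01_le0 ->; ring. Qed.

Lemma smoothstep_ge1 t : 1 <= t -> smoothstep t = 1.
Proof. by rewrite /smoothstep => /clamp01_ge1 ->; ring. Qed.

Lemma smoothstep'_ge0 t : 0 <= smoothstep' t.
Proof.
rewrite /smoothstep'; have /andP[] := clamp01_bounds t.
by set u := clamp01 _ => u0 u1; nra.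
Qed.

Lemma smoothstep'_continuous : continuous (@smoothstep' R).
Proof.
move=> t; have c := @clamp01_continuous t.
apply: cvgM; first by apply: cvgM => //; exact: cvg_cst.
by apply: cvgB => //; exact: cvg_cst.
Qed.

Lemma clamp01E t : (t <= 0 /\ clamp01 t = 0) \/
  (1 <= t /\ clamp01 t = 1) \/
  (0 <= t <= 1 /\ clamp01 t = t).
Proof.
have [t0|] := boolP (t <= 0); first by left; rewrite clamp01_le0.
rewrite -ltNge => /ltW t0; right.
have [t1|] := boolP (1 <= t); first by left; rewrite clamp01_ge1.
by rewrite -ltNge => /ltW t1; right; rewrite clamp01_id t0 t1.
Qed.

Lemma clamp01_lipschitz s t :
  `|clamp01 s - clamp01 t| <= `|s - t|.
Proof.
wlog st : s t / s <= t => [H|].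
  by case/orP: (le_total s t) => /H //; rewrite distrC [leRHS]distrC.
rewrite [leRHS]distrC [leRHS]ger0_norm ?subr_ge0// distrC.
have [[s0 ->]|[[s1 ->]|[/andP[s0 s1] ->]]] := clamp01E s;
have [[t0 ->]|[[t1 ->]|[/andP[t0 t1] ->]]] := clamp01E t;
rewrite ler_norml; apply/andP; split; lra.
Qed.

(** A quadratic remainder valid at all pairs of points gives the derivative also at 0 and 1, where
    the formula changes. Inside the unit interval the remainder is [(s - t)^2] times a factor
    between -3 and 3; otherwise the quadratic contact of the cubic with 0 ([D0]) and with 1 ([D1])
    is used. The constant 9 = 3 + 6 covers the cubic and the derivative term together. *)
Lemma smoothstep_taylor s t :
  `|smoothstep s - smoothstep t - (s - t) * smoothstep' t| <= 9 * (s - t) ^+ 2.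
Proof.
have id01 (u v : R) : u ^+ 2 * (3 - 2 * u) - v ^+ 2 * (3 - 2 * v)
  - (u - v) * (6 * v * (1 - v)) = (u - v) ^+ 2 * (3 - 2 * u - 4 * v) by ring.
have D0 (u : R) : 0 <= u <= 1 -> 0 <= u ^+ 2 * (3 - 2 * u) <= 3 * u ^+ 2.
  move=> /andP[u0 u1]; have u2 := sqr_ge0 u; apply/andP; split.
    by rewrite mulr_ge0//; lra.
  by rewrite mulrC ler_wpM2r//; lra.
have D1 (u : R) : 0 <= u <= 1 ->
    0 <= 1 - u ^+ 2 * (3 - 2 * u) <= 3 * (1 - u) ^+ 2.
  move=> /andP[u0 u1].
  have -> : 1 - u ^+ 2 * (3 - 2 * u) = (1 - u) ^+ 2 * (3 - 2 * (1 - u)) by ring.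
  by apply: D0; apply/andP; split; lra.
rewrite /smoothstep /smoothstep' ler_norml.
have [[s0 ->]|[[s1 ->]|[s01 ->]]] := clamp01E s;
have [[t0 ->]|[[t1 ->]|[t01 ->]]] := clamp01E t.
- by have := sqr_ge0 (s - t); lra.
- have : 1 <= (s - t) ^+ 2 by nra.
  by lra.
- have /andP[] := D0 _ t01; have /andP[t0 t1] := t01 => A B.
  have : t ^+ 2 <= (s - t) ^+ 2 by nra.
  have : 0 <= (t - s) * (t * (1 - t)) <= (s - t) ^+ 2.
    by apply/andP; split; [rewrite !mulr_ge0//; lra|nra].
  by move=> /andP[? ?]; lra.
- have : 1 <= (s - t) ^+ 2 by nra.
  by lra.
- by have := sqr_ge0 (s - t); lra.
- have /andP[] := D1 _ t01; have /andP[t0 t1] := t01 => A B.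
  have : (1 - t) ^+ 2 <= (s - t) ^+ 2 by nra.
  have : 0 <= (s - t) * (t * (1 - t)) <= (s - t) ^+ 2.
    by apply/andP; split; [rewrite !mulr_ge0//; lra|nra].
  by move=> /andP[? ?]; lra.
- have /andP[] := D0 _ s01; have /andP[s0 s1] := s01 => A B.
  have : s ^+ 2 <= (s - t) ^+ 2 by nra.
  by lra.
- have /andP[] := D1 _ s01; have /andP[s0 s1] := s01 => A B.
  have : (1 - s) ^+ 2 <= (s - t) ^+ 2 by nra.
  by lra.
- rewrite id01; have d2 := sqr_ge0 (s - t).
  have /andP[s0 s1] := s01; have /andP[t0 t1] := t01.
  have := mulr_ge0 d2 (_ : 0 <= 9 - (3 - 2 * s - 4 * t)).
  have := mulr_ge0 d2 (_ : 0 <= 9 + (3 - 2 * s - 4 * t)).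
  by move=> /(_ ltac:(lra)) A /(_ ltac:(lra)) B; lra.
Qed.

Lemma smoothstep_deriv t : deriv_in setT (@smoothstep R) t (smoothstep' t).
Proof.
move=> e e0; apply/near_distP; exists (e / 9); first by rewrite divr_gt0.
move=> s st _; apply: (le_trans (smoothstep_taylor s t)).
rewrite -real_normK ?num_real// expr2 mulrA ler_wpM2r// mulrC.
by rewrite -ler_pdivlMr// ltW.
Qed.

End smoothstep_theory.

(** * Primitives of continuous functions *)

Section ftc.
Context {R : realType}.
Local Notation mu := (@lebesgue_measure R).

Lemma primitive_of_continuous (g : R -> R) : continuous g ->
  exists G : R -> R, forall t, 0 <= t <= 1 -> deriv_in setT G t (g t).
Proof.
(* Starting at -1 and integrating beyond [t] makes every point of [0, 1] interior, so the derivative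
   is two-sided at 0 and 1 as well. *)
move=> gc; pose G (x : R) : R := \int[mu]_(t in `[-1, x]) g t.
have gint (a b : R) : mu.-integrable `[a, b] (EFin \o g).
  apply: continuous_compact_integrable; first exact: segment_compact.
  exact: continuous_subspaceT.
exists G => t /andP[t0 t1].
have tt : t < t + 1 by lra.
have m1t : -1 < t by lra.
have [dG GE] := continuous_FTC1_closed tt (gint (-1) (t + 1)) m1t (gc t).
by apply/deriv_in_is_derive; split; [exact: dG|rewrite -derive1E; exact: GE].
Qed.

Lemma Rintegral01_deriv (g G : R -> R) : continuous g ->
  (forall t, 0 <= t <= 1 -> deriv_in setT G t (g t)) ->
  \int[mu]_(t in `[0, 1]) g t = G 1 - G 0.
Proof.
move=> gc Gg; rewrite /Rintegral (@continuous_FTC2 _ g G)//.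
- exact: continuous_subspaceT.
- have Gc t : 0 <= t <= 1 -> {for t, continuous G}.
    by move=> /Gg; exact: deriv_in_continuous.
  split.
  + move=> x; rewrite in_itv/= => /andP[/ltW x0 /ltW x1].
    by have /deriv_in_is_derive[] := Gg x (introT andP (conj x0 x1)).
  + by apply: cvg_at_right_filter; apply: Gc; rewrite lexx ler01.
  + by apply: cvg_at_left_filter; apply: Gc; rewrite lexx ler01.
- move=> x; rewrite in_itv/= => /andP[/ltW x0 /ltW x1]; rewrite derive1E.
  by have /deriv_in_is_derive[] := Gg x (introT andP (conj x0 x1)).
Qed.

End ftc.

(** * Linear operators between Banach spaces *)

Definition seminorm_on (R : realType) (V : lmodType R) (p : V -> R) : Prop :=
  (forall u v, p (u + v) <= p u + p v) /\ (forall a v, p (a *: v) = `|a| * p v).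

Section hahn_banach.
Context {R : realType} {V : lmodType R} (p : V -> R).
Hypothesis pS : seminorm_on p.

Let p0 : p 0 = 0.
Proof. by rewrite -(scale0r 0) pS.2 normr0 mul0r. Qed.

(* A set of pairs is the graph of a partial linear functional below [p]:
   being a graph is automatic, since [(0, r)] in [G] forces [a * r <= p 0 = 0]
   for every [a]. *)
Let dominated (w : V) (G : set (V * R)) :=
  [/\ forall z, G z -> z.2 <= p z.1,
      forall z1 z2 a, G z1 -> G z2 -> G (a *: z1.1 + z2.1, a * z1.2 + z2.2) &
      forall z, G z -> G (w, p w)].

(** The value at [v0] must lie above all [z.2 - p (z.1 - v0)] and below all [p (z.1 + v0) - z.2];
    subadditivity keeps these bounds from crossing, and the supremum of the first is taken. If [v0]
    already lies in the domain, domination still makes the result a graph. *)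
Let extend (w v0 : V) (A : set (V * R)) : dominated w A -> A !=set0 ->
  exists B, [/\ dominated w B, A `<=` B & exists r, B (v0, r)].
Proof.
move=> [Ale Alin Aw] [z0 Az0].
have A0 : A (0, 0).
  have := Alin _ _ (-1) Az0 Az0.
  by rewrite scaleN1r mulN1r !addNr.
pose S := [set z.2 - p (z.1 - v0) | z in A].
have Sub z' : A z' -> ubound S (p (z'.1 + v0) - z'.2).
  move=> Az' _ [z Az <-]; rewrite lerBlDr addrAC lerBrDr.
  have := Ale _ (Alin _ _ 1 Az Az'); rewrite /= scale1r mul1r => /le_trans; apply.
  have -> : z.1 + z'.1 = (z.1 - v0) + (z'.1 + v0).
    by rewrite [z'.1 + v0]addrC addrA subrK.
  by rewrite addrC pS.1.
have S0 : S !=set0 by exists (z0.2 - p (z0.1 - v0)); exists z0.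
have supS : has_sup S by split => //; exists (p (z0.1 + v0) - z0.2); exact: Sub.
pose r0 := sup S.
have r0l z : A z -> z.2 - r0 <= p (z.1 - v0).
  move=> Az; rewrite lerBlDr -lerBlDl; apply: ub_le_sup; first exact: supS.2.
  by exists z.
have r0u z : A z -> z.2 + r0 <= p (z.1 + v0).
  by move=> Az; rewrite -lerBrDl; apply: ge_sup => //; exact: Sub.
have Asc z a : A z -> A (a *: z.1, a * z.2).
  by move=> Az; have := Alin _ _ a Az A0; rewrite !addr0.
pose B := [set z : V * R | exists z' t, A z' /\ z = (z'.1 + t *: v0, z'.2 + t * r0)].
exists B; split; last first.
- by exists r0; exists (0, 0), 1; rewrite /= scale1r mul1r !add0r.
- by move=> [v r] Az; exists (v, r), 0; rewrite /= scale0r mul0r !addr0.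
split.
- move=> _ [z [t [Az ->]]] /=.
  have [t0|t0|->] := ltgtP t 0; last by rewrite mul0r scale0r !addr0 Ale.
  + have := r0l _ (Asc _ (- t)^-1 Az); rewrite /= => /(ler_wpM2l (ltW (_ : 0 < - t))).
    rewrite oppr_gt0 => /(_ t0); rewrite -[X in X * p _]gtr0_norm ?oppr_gt0// -pS.2.
    rewrite mulrBr mulrA divff ?oppr_eq0 ?lt_eqF// mul1r mulNr opprK.
    by rewrite scalerBr scalerA divff ?oppr_eq0 ?lt_eqF// scale1r scaleNr opprK.
  + have := r0u _ (Asc _ t^-1 Az); rewrite /= => /(ler_wpM2l (ltW t0)).
    rewrite -[X in X * p _]gtr0_norm// -pS.2 mulrDr mulrA divff ?gt_eqF// mul1r.
    by rewrite scalerDr scalerA divff ?gt_eqF// scale1r.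
- move=> _ _ a [z1 [t1 [Az1 ->]]] [z2 [t2 [Az2 ->]]] /=.
  exists (a *: z1.1 + z2.1, a * z1.2 + z2.2), (a * t1 + t2); split.
    exact: Alin.
  rewrite /= scalerDr scalerDl -scalerA -!addrA; congr (_, _).
    by congr (_ + _); rewrite addrCA.
  by ring.
- by move=> _ _; exists (w, p w), 0; rewrite /= scale0r mul0r !addr0; split => //; exact: Aw Az0.
Qed.

Theorem hahn_banach (w : V) :
  exists l : {linear V -> R^o}, (forall v, l v <= p v) /\ l w = p w.
Proof.
have [|A [[Ale Alin Aw] Amax]] := @Zorn_bigcup _ (dominated w).
  move=> F FP Ftot; split.
  - by move=> z [X FX Xz]; have [+ _ _] := FP _ FX; apply.
  - move=> z1 z2 a [X FX Xz1] [Y FY Yz2].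
    have [XY|YX] := Ftot _ _ FX FY.
      by exists Y => //; have [_ + _] := FP _ FY; apply => //; exact: XY.
    by exists X => //; have [_ + _] := FP _ FX; apply => //; exact: YX.
  - by move=> z [X FX Xz]; exists X => //; have [_ _] := FP _ FX; apply; exact: Xz.
have A0 : A !=set0.
  apply/set0P/eqP => A0.
  apply: (Amax [set z | exists a, z = (a *: w, a * p w)]).
    rewrite A0; split => // /(_ (w, p w)); apply.
    by exists 1; rewrite scale1r mul1r.
  split.
  - by move=> _ [a ->] /=; rewrite pS.2 ler_wpM2r ?ler_norm//;
      have := pS.1 w (- w); rewrite subrr p0 -scaleN1r pS.2 normrN1 mul1r; lra.
  - move=> _ _ a [b ->] [c ->]; exists (a * b + c).
    by rewrite /= scalerDl scalerA mulrDl mulrA.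
  - by move=> _ _; exists 1; rewrite scale1r mul1r.
have Atot v : exists r, A (v, r).
  have [B [domB AB [r Br]]] := extend v (And3 Ale Alin Aw) A0.
  exists r; apply: contrapT => nAr; apply: (Amax B) => //; split => //.
  by move=> BA; apply: nAr; exact: BA.
pose l v := projT1 (cid (Atot v)).
have Al v : A (v, l v) by rewrite /l; case: cid.
(* The difference of two values over the same [v] is a value over 0, as is its negative, so both are
   at most [p 0 = 0]. *)
have Auniq v r : A (v, r) -> r = l v.
  move=> Ar; have := Ale _ (Alin _ _ (-1) Ar (Al v)).
  have := Ale _ (Alin _ _ (-1) (Al v) Ar).
  by rewrite /= scaleN1r addNr p0 !mulN1r; lra.
have llin : linear (l : V -> R^o).
  by move=> a u v; apply/esym/Auniq; exact: Alin (Al u) (Al v).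
pose lM := GRing.isLinear.Build R V R^o _ (l : V -> R^o) llin.
pose L : {linear V -> R^o} := HB.pack (l : V -> R^o) lM.
exists L; split; first by move=> v; exact: Ale (Al v).
by case: A0 => z0 Az0; apply/esym/Auniq; exact: Aw Az0.
Qed.

End hahn_banach.

Definition equiv_norm (R : realType) (E : normedModType R) (N : E -> R) : Prop :=
  seminorm_on N /\ exists a b : R,
    [/\ 0 < a, 0 < b & forall v, a * `|v| <= N v <= b * `|v|].

Section seminorm_theory.
Context {R : realType}.

Lemma seminorm0 (V : lmodType R) (N : V -> R) : seminorm_on N -> N 0 = 0.
Proof. by move=> NS; rewrite -(scale0r 0) NS.2 normr0 mul0r. Qed.

Lemma seminormN (V : lmodType R) (N : V -> R) v : seminorm_on N -> N (- v) = N v.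
Proof. by move=> NS; rewrite -scaleN1r NS.2 normrN1 mul1r. Qed.

Lemma seminorm_ge0 (V : lmodType R) (N : V -> R) v : seminorm_on N -> 0 <= N v.
Proof.
by move=> NS; have := NS.1 v (- v); rewrite subrr seminorm0// seminormN//; lra.
Qed.

Lemma seminormB (V : lmodType R) (N : V -> R) u v : seminorm_on N ->
  N u <= N v + N (u - v).
Proof. by move=> NS; rewrite -{1}(subrK v u) addrC NS.1. Qed.

(* Iterate on the error: the corrections form a geometric series. *)
Lemma approximate_solution (E F : completeNormedModType R)
    (T : {linear E -> F}) (NE : E -> R) (NF : F -> R) (K : R) :
  continuous T -> equiv_norm NE -> equiv_norm NF -> 0 < K ->
  (forall w, exists v, NF (w - T v) <= 2^-1 * NF w /\ NE v <= K * NF w) ->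
  forall w, exists v, T v = w /\ NE v <= 2 * K * NF w.
Proof.
move=> Tc [NES [a [b [a0 b0 NEab]]]] [NFS [a' [b' [a'0 b'0 NFab]]]] K0 approx w.
pose S x := projT1 (cid (approx x)).
have S1 x : NF (x - T (S x)) <= 2^-1 * NF x by rewrite /S; case: cid => ? [].
have S2 x : NE (S x) <= K * NF x by rewrite /S; case: cid => ? [].
(* [r n] is the error left after [n] corrections and [s n] the sum of these corrections. *)
pose r n := iter n (fun x => x - T (S x)) w.
have rn n : NF (r n) <= 2^-1 ^+ n * NF w.
  elim: n => [|n IH]; first by rewrite expr0 mul1r.
  by rewrite (le_trans (S1 _))// exprS -mulrA ler_wpM2l.
pose s := series (fun n => S (r n)).
have Ts n : T (s n) = w - r n.
  elim: n => [|n IH]; first by rewrite /s /series/= big_geq// linear0 subrr.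
  by rewrite /s seriesS linearD -/s IH /= opprB addrCA [RHS]addrC addrC.
have Nw := seminorm_ge0 w NFS.
have sc : cvgn s.
  apply: normed_cvg; rewrite /=.
  apply: (@series_le_cvg _ _ (geometric (K * NF w / a) 2^-1)).
  - by move=> n /=.
  - by move=> n; rewrite /geometric/= !mulr_ge0 ?invr_ge0 ?exprn_ge0// ?ltW.
  - move=> n; rewrite /geometric/= mulrAC ler_pdivlMr// mulrC.
    have /andP[+ _] := NEab (S (r n)); move=> /le_trans; apply.
    by rewrite (le_trans (S2 _))// -mulrA ler_pM2l// mulrC.
  - by apply: is_cvg_geometric_series; rewrite ger0_norm//; lra.
exists (limn s); split.
  have : T (s n) @[n --> \oo] --> T (limn s).
    exact: cvg_comp sc (Tc (limn s)).
  suff : T (s n) @[n --> \oo] --> w by move=> H1 H2; exact: cvg_unique H2 H1.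
  apply/cvgrPdist_le => e e0.
  have : (NF w / a') * 2^-1 ^+ n @[n --> \oo] --> (0 : R).
    by apply: (@cvg_geometric R (NF w / a') 2^-1); rewrite ger0_norm//; lra.
  move=> /cvgrPdist_le/(_ e e0); apply: filterS => n.
  rewrite Ts opprB addrCA subrr addr0 sub0r normrN.
  rewrite ger0_norm; last by rewrite !mulr_ge0 ?invr_ge0 ?exprn_ge0//; lra.
  apply: le_trans; rewrite mulrAC ler_pdivlMr// mulrC.
  by have /andP[+ _] := NFab (r n); move=> /le_trans; apply; rewrite mulrC rn.
have sb n : NE (s n) <= 2 * K * NF w.
  (* The exact partial sum of the geometric series; the weaker bound by 2 would not survive the
     induction. *)
  have : NE (s n) <= (2 - 2 * 2^-1 ^+ n) * (K * NF w).
    elim: n => [|n IH].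
      by rewrite /s /series/= big_geq// seminorm0// expr0 mulr1 subrr mul0r.
    rewrite /s seriesS -/s (le_trans (NES.1 _ _))//.
    rewrite (le_trans (lerD (le_trans (S2 _) (ler_wpM2l (ltW K0) (rn n))) IH))//.
    by rewrite le_eqVlt; apply/orP; left; apply/eqP; rewrite exprS; field.
  move=> /le_trans; apply; rewrite -mulrA ler_wpM2r ?mulr_ge0// ?(ltW K0)//.
  by rewrite gerBl mulr_ge0// exprn_ge0.
apply/ler_addgt0Pr => e e0.
have eb : 0 < e / b by rewrite divr_gt0.
have /cvgrPdist_le/(_ _ eb)[n _ /(_ n (leqnn n)) sn] : s n @[n --> \oo] --> limn s by [].
rewrite (le_trans (seminormB _ (s n) NES))// lerD//.
have /andP[_] := NEab (limn s - s n); move=> /le_trans; apply.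
by rewrite mulrC -ler_pdivlMr.
Qed.

End seminorm_theory.

Lemma linear_continuousP (R : realType) (E F : normedModType R)
    (l : {linear E -> F}) (K : R) : (forall v, `|l v| <= K * `|v|) -> continuous l.
Proof.
move=> lK v; apply/cvgrPdist_le => e e0.
have K1 : 0 < `|K| + 1 by rewrite ltr_wpDl.
suff : \forall u \near v, `|l v - l u| <= e by [].
apply/near_distP; exists (e / (`|K| + 1)); first by rewrite divr_gt0.
move=> u; rewrite ltr_pdivlMr// => uv; rewrite distrC -linearB.
rewrite (le_trans (lK _))// (le_trans _ (ltW uv))// mulrC ler_wpM2l//.
by rewrite (le_trans (ler_norm _))// lerDl.
Qed.

(* Hahn-Banach applied to the seminorm [w |-> inf_v NF (w - T v) + c/4 * NE v]:
   a functional it dominates has norm at most 1/4, by the hypothesis. *)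
Lemma bounded_below_adjoint_solution (R : realType)
    (E F : completeNormedModType R) (T : {linear E -> F})
    (NE : E -> R) (NF : F -> R) (c : R) :
  continuous T -> equiv_norm NE -> equiv_norm NF -> 0 < c ->
  (forall (l : {linear F -> R^o}) (K : R), continuous l -> 0 <= K ->
     (forall v, `|l (T v)| <= K * NE v) -> forall w, c * `|l w| <= K * NF w) ->
  forall w, exists v, T v = w /\ NE v <= 4 / c * NF w.
Proof.
move=> Tc NEe NFe c0 H.
have [NES [a [b [a0 b0 NEab]]]] := NEe; have [NFS [a' [b' [a'0 b'0 NFab]]]] := NFe.
have -> : 4 / c = 2 * (2 / c) by rewrite mulrA -natrM.
apply: (approximate_solution Tc NEe NFe); first by rewrite divr_gt0.
pose q w v := NF (w - T v) + c / 4 * NE v.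
have c4 : 0 <= c / 4 by rewrite divr_ge0// ltW.
have q_ge0 w v : 0 <= q w v.
  by rewrite addr_ge0 ?mulr_ge0 ?(seminorm_ge0 _ NES) ?(seminorm_ge0 _ NFS)// ltW.
pose Q w := [set q w v | v in setT].
have Qlb w : has_lbound (Q w) by exists 0 => _ [v _ <-].
have Qn0 w : Q w !=set0 by exists (q w 0); exists 0.
pose p w := inf (Q w).
have pq w v : p w <= q w v by apply: ge_inf => //; exists v.
have pZ k w : p (k *: w) <= `|k| * p w.
  have [->|k0] := eqVneq k 0.
    rewrite scale0r normr0 mul0r (le_trans (pq _ 0))// /q linear0 subrr.
    by rewrite (seminorm0 NFS) (seminorm0 NES) mulr0 addr0.
  have kn0 : 0 < `|k| by rewrite normr_gt0.
  rewrite -ler_pdivrMl//; apply: lb_le_inf => // _ [v _ <-].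
  rewrite ler_pdivrMl// (le_trans (pq _ (k *: v)))// /q linearZ -scalerBr.
  by rewrite NFS.2 NES.2 mulrDr lerD// mulrCA.
have pS : seminorm_on p.
  split=> [u v|k v]; last first.
    apply/eqP; rewrite eq_le pZ/=.
    have [->|k0] := eqVneq k 0.
      rewrite normr0 mul0r; apply: lb_le_inf => // _ [? _ <-].
      exact: q_ge0.
    have kn0 : 0 < `|k| by rewrite normr_gt0.
    rewrite -ler_pdivlMl// -normfV; apply: le_trans (pZ _ _).
    by rewrite scalerA mulVf// scale1r.
  rewrite -lerBlDr; apply: lb_le_inf => // _ [v1 _ <-].
  rewrite lerBlDr -lerBlDl; apply: lb_le_inf => // _ [v2 _ <-].
  rewrite lerBlDl (le_trans (pq _ (v1 + v2)))// /q linearD opprD addrACA.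
  have := NFS.1 (u - T v1) (v - T v2); have := NES.1 v1 v2.
  by move=> /(ler_wpM2l c4); rewrite mulrDr; lra.
have pNF w : p w <= NF w.
  by rewrite (le_trans (pq _ 0))// /q linear0 subr0 (seminorm0 NES) mulr0 addr0.
have pT v : p (T v) <= c / 4 * NE v.
  by rewrite (le_trans (pq _ v))// /q subrr (seminorm0 NFS) add0r.
move=> w; have [l [lp lw]] := hahn_banach pS w.
have lpn v : `|l v| <= p v.
  rewrite ler_norml lp andbT lerNl -linearN.
  by rewrite (le_trans (lp _))// seminormN.
have lc : continuous l.
  apply: (@linear_continuousP _ _ _ l b') => v; rewrite (le_trans (lpn _))//.
  by rewrite (le_trans (pNF _))//; have /andP[] := NFab v.
have := H l (c / 4) lc c4 (fun v => le_trans (lpn _) (pT v)) w.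
rewrite lw ger0_norm; last by rewrite (seminorm_ge0 w pS).
have [w0|w0] := eqVneq w 0.
  move=> _; exists 0; rewrite w0 linear0 subrr (seminorm0 NFS) (seminorm0 NES).
  by rewrite !mulr0.
have NFw : 0 < NF w.
  have /andP[+ _] := NFab w; apply: lt_le_trans.
  by rewrite mulr_gt0// normr_gt0.
move=> pw.
(* The hypothesis gave [c * p w <= c / 4 * NF w]. The strict inequality with 1/2 leaves room for a
   near-minimizer [v] of the infimum: its error is at most half of [NF w], and its own norm at most
   [2 / c * NF w]. *)
have {}pw : p w < 2^-1 * NF w.
  by rewrite -(ltr_pM2l c0) (le_lt_trans pw)// mulrCA mulrA ltr_pM2r//; lra.
have [_ [v _ <-] qv] := inf_lt (Qn0 w) pw.
have := seminorm_ge0 v NES; have := seminorm_ge0 (w - T v) NFS.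
move: qv; rewrite /q => qv n1 n2; exists v; split.
  by have := mulr_ge0 (divr_ge0 (ltW c0) (ler0n R 4)) n2; lra.
have : c / 4 * NE v <= 2^-1 * NF w by lra.
have c40 : 0 < c / 4 by rewrite divr_gt0.
move=> h; rewrite -(ler_pM2l c40) (le_trans h)// le_eqVlt; apply/orP; left.
by apply/eqP; field; rewrite gt_eqF.
Qed.

(** * Inverse functions *)

Lemma segment_in_ball (R : realType) (E : normedModType R) (p u v : E) (r t : R) :
  0 <= t <= 1 -> `|u - p| < r -> `|v - p| < r -> `|v + t *: (u - v) - p| < r.
Proof.
move=> /andP[t0 t1] ur vr.
have -> : v + t *: (u - v) - p = t *: (u - p) + (1 - t) *: (v - p).
  rewrite scalerBl scale1r !scalerBr opprB addrAC [RHS]addrC -[RHS]addrA.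
  by congr (_ + _); rewrite [RHS]addrC addrA subrK.
rewrite (le_lt_trans (ler_normD _ _))// !normrZ !ger0_norm ?subr_ge0//.
have [->|t00] := eqVneq t 0; first by rewrite mul0r add0r subr0 mul1r.
have tp : 0 < t by rewrite lt0r t00.
have h1 : t * `|u - p| < t * r by rewrite ltr_pM2l.
have h2 : (1 - t) * `|v - p| <= (1 - t) * r.
  by rewrite ler_wpM2l ?subr_ge0// ltW.
by lra.
Qed.

Section inverse_function.
Context {R : realType}.

(** The mean value inequality is applied to [g] minus its differential at [p] along the segment from
    [v] to [u]; the derivative there is the difference of two differentials, small by continuity. *)
Lemma C1_strict_differentiability (E F : normedModType R) (U : set E)
    (g : E -> F) p (e : R) : open U -> C1_on U g -> U p -> 0 < e ->
  exists2 r : R, 0 < r & forall u v, `|u - p| < r -> `|v - p| < r ->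
    [/\ U u, U v & `|g u - g v - 'd g p (u - v)| <= e * `|u - v|].
Proof.
move=> Uo gU Up e0; have [gp gC] := gU _ Up.
have /near_distP[r1 r10 Ur] : nbhs p U by exact: open_nbhs_nbhs.
have /near_distP[r2 r20 gr] := gC _ e0.
exists (Num.min r1 r2); first by rewrite lt_min r10.
move=> u v; rewrite !lt_min => /andP[u1 u2] /andP[v1 v2].
split; [exact: Ur|exact: Ur|].
pose l (t : R) : E := t *: (u - v) + v.
have lb t r : 0 <= t <= 1 -> `|u - p| < r -> `|v - p| < r -> `|l t - p| < r.
  by rewrite /l [_ + v]addrC; exact: segment_in_ball.
pose h (t : R) := g (l t) + (- t) *: 'd g p (u - v).
have := @mean_value_le R F h (fun t => 'd g (l t) (u - v) + (-1) *: 'd g p (u - v)) (e * `|u - v|).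
rewrite /h /l scale1r scale0r add0r subrK oppr0 scale0r addr0 scaleN1r addrAC.
apply=> t t01.
  apply: deriv_inD.
    apply: (@deriv_in_diff R E F setT l g t (u - v)).
      rewrite -[u - v]addr0; apply: deriv_inD; last exact: deriv_in_cst.
      rewrite -[X in deriv_in _ _ _ X]scale1r; apply: deriv_inZ.
      have := @deriv_in_affine R 1 0 t; apply: deriv_in_near_eq.
      by apply/near_distP; exists 1 => // s _; rewrite mul1r addr0.
    by have [] := gU _ (Ur _ (lb _ _ t01 u1 v1)).
  rewrite -scaleN1r; apply: deriv_inZ; have := @deriv_in_affine R (-1) 0 t; apply: deriv_in_near_eq.
  by apply/near_distP; exists 1 => // s _; rewrite mulN1r addr0.
by apply: gr; exact: lb.
Qed.

(** For a linear map this is invertibility with inverse of norm at most [1 / c], without naming the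
    inverse. *)
Definition expanding_bijection (E F : normedModType R) (T : E -> F) (c : R) :=
  [/\ 0 < c, forall v, c * `|v| <= `|T v| & forall w, exists v, T v = w].

(** With [S] inverse to the differential at [p], a solution of [g u = y] is a fixed point of
    [u + S (y - g u)]. Strict differentiability with error [c / 2] makes this map a contraction of
    factor 1/2 that preserves the closed ball of radius [s], and also gives the lower bound. *)
Lemma local_inverse (E F : completeNormedModType R) (U : set E) (g : E -> F) p c :
  open U -> C1_on U g -> U p -> expanding_bijection ('d g p) c ->
  exists r : R, [/\ 0 < r,
    forall u v, `|u - p| < r -> `|v - p| < r -> c / 2 * `|u - v| <= `|g u - g v| &
    forall s y, 0 < s -> s < r -> `|y - g p| <= c / 2 * s ->
      exists u, `|u - p| <= s /\ g u = y].
Proof.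
move=> Uo gU Up [c0 cA Asurj].
have c2 : 0 < c / 2 by rewrite divr_gt0.
have [r r0 gr] := C1_strict_differentiability Uo gU Up c2.
exists r; split => // [u v ur vr|s y s0 sr ys].
  have [_ _] := gr _ _ ur vr; have := cA (u - v).
  by have := ler_normB (g u - g v) (g u - g v - 'd g p (u - v)); rewrite subKr; lra.
pose S w := projT1 (cid (Asurj w)).
have AS w : 'd g p (S w) = w by rewrite /S; case: cid.
pose Phi u := u + S (y - g u).
have Phi_lip u v : `|u - p| < r -> `|v - p| < r -> `|Phi u - Phi v| <= 2^-1 * `|u - v|.
  move=> ur vr; rewrite -(ler_pM2l c0) (le_trans (cA _))//.
  have -> : 'd g p (Phi u - Phi v) = - (g u - g v - 'd g p (u - v)).
    have SB x z : 'd g p (S x - S z) = x - z by rewrite linearB /= !AS.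
    rewrite /Phi opprD addrACA linearD /= SB [RHS]opprB; congr (_ + _).
    by rewrite opprB addrC addrA subrK opprB.
  rewrite normrN mulrA; have [_ _] := gr _ _ ur vr; move/le_trans; apply.
  by rewrite ler_wpM2r.
pose B := [set u : E | `|u - p| <= s].
have PhiB : set_fun B B Phi.
  move=> u us; rewrite /B /= -(ler_pM2l c0) (le_trans (cA _))//.
  have ur : `|u - p| < r by exact: le_lt_trans us sr.
  have -> : 'd g p (Phi u - p) = (y - g p) - (g u - g p - 'd g p (u - p)).
    rewrite /Phi addrAC linearD AS opprB [RHS]addrCA; congr (_ + _).
    by rewrite opprB addrA subrK.
  rewrite (le_trans (ler_normB _ _))//.
  have [_ _] := gr u p ur ltac:(by rewrite subrr normr0).
  have : c / 2 * `|u - p| <= c / 2 * s by rewrite ler_wpM2l// ltW.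
  by lra.
have [|||u Bu uE] := @banach_fixed_point R E B (mkfun_fun PhiB).
- have h0 : 0 <= 2^-1 :> R by lra.
  exists (NngNum h0); split => /=; first by lra.
  by move=> [u v] [/= us vs]; apply: Phi_lip; exact: le_lt_trans sr.
- have -> : B = closed_ball p s.
    rewrite closed_ballE//; apply/seteqP; split => u; rewrite /B /closed_ball_/=;
    by rewrite distrC.
  exact: closed_ball_closed.
- by exists p; rewrite /B /= subrr normr0 ltW.
- exists u; split => //.
  have uS : u = u + S (y - g u) := uE.
  have : S (y - g u) = 0 by apply/(addrI u); rewrite addr0 -uS.
  move=> /(congr1 ('d g p)); rewrite AS linear0 => /eqP.
  by rewrite subr_eq0 => /eqP.
Qed.

(** The expansion of [g] at [h q], pulled back by the inverse differential, is the expansion of [h]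
    at [q]; continuity of [h] brings [h q'] into the range where it holds. *)
Lemma C1_inverse (E F : normedModType R) (U : set E) (V : set F)
    (g : E -> F) (h : F -> E) :
  open U -> open V -> C1_on U g ->
  (forall p, U p -> exists c, expanding_bijection ('d g p) c) ->
  (forall q, V q -> [/\ U (h q), g (h q) = q & {for q, continuous h}]) ->
  C1_on V h.
Proof.
move=> Uo Vo gU gbij hV.
have dh q c : V q -> expanding_bijection ('d g (h q)) c ->
    differentiable h q /\ forall w, 'd g (h q) ('d h q w) = w.
  move=> Vq [c0 cA Asurj]; have [Uhq ghq hc] := hV _ Vq.
  set p := h q in cA Asurj *.
  pose S w := projT1 (cid (Asurj w)).
  have AS w : 'd g p (S w) = w by rewrite /S; case: cid.
  have Ainj v : 'd g p v = 0 -> v = 0.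
    move=> Av; apply/eqP; rewrite -normr_le0 -(ler_pM2l c0) mulr0.
    by rewrite (le_trans (cA _))// Av normr0.
  have Slin : linear S.
    move=> a u v; apply/eqP; rewrite -subr_eq0; apply/eqP/Ainj.
    by rewrite linearB linearP !AS subrr.
  pose SM := GRing.isLinear.Build R F E _ S Slin.
  pose L : {linear F -> E} := HB.pack S SM.
  have Lc : continuous L.
    apply: (@linear_continuousP _ _ _ L c^-1) => w.
    by rewrite ler_pdivlMl// (le_trans (cA _))//= AS.
  have [gp _] := gU _ Uhq.
  suff [dhq hL] : differentiable h q /\ 'd h q = L :> (F -> E).
    by split => // w; rewrite hL /= AS.
  apply: differentiableI => // e e0.
  have c2 : 0 < c / 2 by rewrite divr_gt0.
  (* The bound by [c / 2] makes [h] Lipschitz at [q] with constant [2 / c]; the other bound then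
     turns the remainder of [g] into at most [e * c * |q' - q|]. *)
  pose e1 := Num.min (c / 2) (e * c * c / 2).
  have e10 : 0 < e1 by rewrite lt_min c2 !(divr_gt0, mulr_gt0).
  have e1c : e1 <= c / 2 by rewrite ge_min lexx.
  have e1e : e1 <= e * c * c / 2 by rewrite ge_min lexx orbT.
  have /near_distP[d1 d10 gd1] := differentiable_near gp e10.
  have /near_distP[d2 d20 hd2] : \forall q' \near q, `|h q' - p| < d1.
    by move/cvgrPdist_lt : hc => /(_ _ d10); apply: filterS => q'; rewrite distrC.
  have /near_distP[d3 d30 Vd3] : nbhs q V by exact: open_nbhs_nbhs.
  apply/near_distP; exists (Num.min d2 d3); first by rewrite lt_min d20.
  move=> q'; rewrite lt_min => /andP[/hd2 /gd1 gq' /Vd3 Vq'].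
  have [Uhq' ghq' _] := hV _ Vq'.
  rewrite ghq' /p ghq -/p in gq'.
  have lip : c / 2 * `|h q' - p| <= `|q' - q|.
    have := cA (h q' - p); have := ler_normB (q' - q) (q' - q - 'd g p (h q' - p)).
    rewrite subKr; have : e1 * `|h q' - p| <= c / 2 * `|h q' - p| by rewrite ler_wpM2r.
    by lra.
  rewrite -(ler_pM2l c0) (le_trans (cA _))// linearB /= AS -normrN opprB.
  rewrite (le_trans gq')//.
  have h1 : e1 * `|h q' - p| <= e * c * c / 2 * `|h q' - p| by rewrite ler_wpM2r.
  have ec : 0 < e * c by rewrite mulr_gt0.
  have : e * c * (c / 2 * `|h q' - p|) <= e * c * `|q' - q| by rewrite ler_pM2l.
  by lra.
move=> q Vq; have [Uhq ghq hc] := hV _ Vq.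
have [c cbij] := gbij _ Uhq; have [dhq hgq] := dh _ _ Vq cbij.
split => // e e0; have [c0 cA _] := cbij.
have [gp gC] := gU _ Uhq.
have c2 : 0 < c / 2 by rewrite divr_gt0.
pose e1 := Num.min (c / 2) (e * c * c / 2).
have e10 : 0 < e1 by rewrite lt_min c2 !(divr_gt0, mulr_gt0).
have e1c : e1 <= c / 2 by rewrite ge_min lexx.
have e1e : e1 <= e * c * c / 2 by rewrite ge_min lexx orbT.
have Vn : nbhs q V by exact: open_nbhs_nbhs.
have := hc _ (gC _ e10); apply: filterS2 Vn => q' Vq' gq' w.
have [Uhq' ghq' _] := hV _ Vq'.
have [c' c'bij] := gbij _ Uhq'; have [_ hgq'] := dh _ _ Vq' c'bij.
(* Both vectors are preimages of [w], under different differentials of [g]; hence ['d g (h q)] sends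
   [v' - v] to the difference of these differentials applied to [v']. *)
set v' := 'd h q' w; set v := 'd h q w.
have A'v' : 'd g (h q') v' = w by exact: hgq'.
have Av : 'd g (h q) v = w by exact: hgq.
have := gq' v'; rewrite /= A'v' => d1.
have := cA v'; have := ler_normB w (w - 'd g (h q) v'); rewrite subKr => d2 d3.
have := cA (v' - v); rewrite linearB Av -normrN opprB => d4.
have n1 : e1 * `|v'| <= c / 2 * `|v'| by rewrite ler_wpM2r.
have n2 : e1 * `|v'| <= e * c * c / 2 * `|v'| by rewrite ler_wpM2r.
have d5 : c / 2 * `|v'| <= `|w| by lra.
have ec : 0 < e * c by rewrite mulr_gt0.
have : e * c * (c / 2 * `|v'|) <= e * c * `|w| by rewrite ler_pM2l.
by move=> d6; rewrite -(ler_pM2l c0); lra.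
Qed.

End inverse_function.

(** * Lifting along local homeomorphisms *)

Lemma near_leftP (R : realType) (T : R) (P : set R) :
  (\forall t \near T^'-, P t) <->
  exists2 d : R, 0 < d & forall t, T - d < t < T -> P t.
Proof.
rewrite /at_left near_withinE; split=> [/near_distP[d d0 Pd]|[d d0 Pd]].
  by exists d => // t /andP[Tt tT]; apply: Pd => //; rewrite ltr0_norm; lra.
apply/(@near_distP R R); exists d => // t; rewrite ltr_norml => /andP[Tt _] tT.
by apply: Pd; rewrite tT andbT; lra.
Qed.

Section continuity_at.
Context {S T U : topologicalType}.

Lemma continuous_near (g : S -> T) x W : {for x, continuous g} ->
  nbhs (g x) W -> \forall y \near x, W (g y).
Proof. by move=> gx /gx. Qed.

Lemma continuous_compose (g : S -> T) (h : T -> U) x :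
  {for x, continuous g} -> {for g x, continuous h} ->
  {for x, continuous (fun y => h (g y))}.
Proof. by move=> gx hx W Wx; exact: gx _ (hx _ Wx). Qed.

Lemma near_eq_continuous (g h : S -> T) x : (\forall y \near x, g y = h y) ->
  {for x, continuous g} -> {for x, continuous h}.
Proof.
move=> gh gx W Wx; suff : \forall y \near x, W (h y) by [].
rewrite -(nbhs_singleton gh) in Wx.
by apply: filterS2 gh (continuous_near gx Wx) => y ->.
Qed.

Lemma within_continuousP (A : set S) (g : S -> T) : {within A, continuous g} <->
  forall x, A x -> forall W, nbhs (g x) W -> \forall y \near x, A y -> W (g y).
Proof.
rewrite subspace_continuousP; split=> gA x Ax W Wg; first exact: gA.
have : \forall y \near within A (nbhs x), W (g y).
  by rewrite near_withinE; exact: gA.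
by [].
Qed.

Lemma continuous_within_comp (A : set S) (g : S -> T) (r : U -> S) :
  {within A, continuous g} -> (forall z, A (r z)) -> continuous r ->
  continuous (fun z => g (r z)).
Proof.
move=> /within_continuousP gA Ar rc z W Wg.
have : \forall z' \near z, A (r z') -> W (g (r z')) := rc z _ (gA _ (Ar z) _ Wg).
by apply: filterS => z'; exact.
Qed.

End continuity_at.

Definition local_homeomorphism (X Y : topologicalType) (f : X -> Y) : Prop :=
  [/\ continuous f,
      forall (p : X) W, nbhs p W -> nbhs (f p) (f @` W) &
      forall x : X, exists2 U, nbhs x U &
        forall p q, U p -> U q -> f p = f q -> p = q].

Section lifting.
Context {R : realType} {X Y : topologicalType} (f : X -> Y).
Hypothesis flh : local_homeomorphism f.
Hypothesis hX : hausdorff_space X.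
Hypothesis hY : hausdorff_space Y.
Implicit Types (t a b T : R).

Let fc : continuous f. Proof. by have [] := flh. Qed.

(** Local injectivity makes [s] an inverse of [f] on [U]; openness makes [N] open and [s]
    continuous. Off [N] the section has the default value [x]. *)
Lemma local_section x : exists (U : set X) (N : set Y) (s : Y -> X),
  [/\ open U, U x, open N,
      forall p, U p -> N (f p) /\ s (f p) = p &
      forall y, N y -> [/\ U (s y), f (s y) = y & {for y, continuous s}]].
Proof.
have [_ fo finj] := flh; have [U0 U0x U0inj] := finj x.
pose U := interior U0.
have Uo : open U by exact: open_interior.
have UU0 : U `<=` U0 by exact: interior_subset.
pose N := f @` U.
pose s y := if pselect (exists2 p, U p & f p = y) is left e
            then projT1 (cid2 e) else x.
have sf p : U p -> s (f p) = p.
  move=> Up; rewrite /s; case: pselect => [e|]; last by case; exists p.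
  by case: cid2 => q /= Uq fq; apply: U0inj => //; exact: UU0.
exists U, N, s; split => //.
- by rewrite openE => _ [p Up <-]; apply: fo; exact: open_nbhs_nbhs.
- by move=> p Up; split; [exists p|exact: sf].
- move=> _ [p Up <-]; rewrite sf//; split => // W; rewrite /= sf// => Wp.
  have : nbhs (f p) (f @` (W `&` U)).
    by apply: fo; apply: filterI => //; exact: open_nbhs_nbhs.
  by apply: filterS => _ [q [Wq Uq] <-] /=; rewrite sf.
Qed.

(** Agreement spreads to the right by local injectivity and passes to limits because [X] is
    Hausdorff. *)
Lemma lift_unique (g h : R -> X) a b : a <= b ->
  (forall t, a <= t <= b -> [/\ {for t, continuous g}, {for t, continuous h} &
     f (g t) = f (h t)]) -> g a = h a -> g b = h b.
Proof.
move=> ab ghc gha.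
suff : forall t, a <= t <= b -> g t = h t by apply; rewrite ab lexx.
apply: real_induction => // t.
  move=> /andP[at_ tb] IH; have [_ _ /(_ (g t))[U Ux Uinj]] := flh.
  have [gt ht _] := ghc t (introT andP (conj at_ (ltW tb))).
  have ght : g t = h t by apply: IH; rewrite at_ lexx.
  have /near_distP[d d0 gd] : \forall r \near t, U (g r) /\ U (h r).
    have Ug : \forall r \near t, U (g r) := continuous_near gt Ux.
    rewrite ght in Ux.
    by apply: filterS2 Ug (continuous_near ht Ux) => r; split.
  exists d => // s /andP[ts sd] sb; have [|Ug Uh'] := gd s.
    by rewrite gtr0_norm; lra.
  apply: Uinj => //; have [|_ _ //] := ghc s.
  by rewrite sb (le_trans at_ (ltW ts)).
move=> /andP[at_ tb] IH; apply: hX => A B Ag Bh.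
have [gt ht _] := ghc t (introT andP (conj (ltW at_) tb)).
have /near_distP[d d0 ghd] : \forall r \near t, A (g r) /\ B (h r).
  have Ag' : \forall r \near t, A (g r) := continuous_near gt Ag.
  by apply: filterS2 Ag' (continuous_near ht Bh) => r; split.
pose s := Num.max a (t - d / 2).
have [sa st] : a <= s /\ s < t.
  by rewrite le_max lexx gt_max at_; split => //; lra.
have sd : t - d / 2 <= s by rewrite le_max lexx orbT.
have [|Ags Bhs] := ghd s; first by rewrite ltr0_norm; lra.
by exists (g s); split => //; rewrite IH// sa st.
Qed.

(* A lift of [h] on [0, T[, extended to negative times as a constant. *)
Definition lift_before (h : R -> Y) (x : X) T (g : R -> X) : Prop :=
  [/\ forall t, t <= 0 -> g t = x,
      forall t, t < T -> {for t, continuous g} &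
      forall t, 0 <= t < T -> f (g t) = h t].

(** The lift continues past [T] by the local section through its left limit [x']. That [x'] lies
    over [h T] is uniqueness of limits in [Y]; at [T = 0], where the lift has no past, it needs
    [x' = x]. *)
Let lift_extend (h : R -> Y) x T (g : R -> X) x' : continuous h -> f x = h 0 ->
  0 <= T -> lift_before h x T g -> (T = 0 -> x' = x) ->
  g t @[t --> T^'-] --> x' ->
  exists2 d, 0 < d & exists g', lift_before h x (T + d) g'.
Proof.
move=> hc fx T0 [g0 gc gh] Tx gx'.
have fx' : f x' = h T.
  have [T00|Tn0] := eqVneq T 0; first by rewrite Tx// T00 fx.
  have Tp : 0 < T by rewrite lt0r Tn0.
  have : f (g t) @[t --> T^'-] --> f x' by move=> W /fc /gx'.
  have : h t @[t --> T^'-] --> h T by apply: cvg_at_left_filter; exact: hc.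
  have hE : \forall t \near T^'-, f (g t) = h t.
    near=> t; apply: gh; apply/andP; split; last by near: t; exact: nbhs_left_lt.
    by apply/ltW; near: t; exact: nbhs_left_gt.
  move=> hT fgT; apply: (@cvg_unique _ hY (h t @[t --> T^'-])) => //.
  by apply: cvg_trans fgT; apply: near_eq_cvg; apply: filterS hE => t ->.
have [U [N [s [Uo Ux No sU sN]]]] := local_section x'.
have NhT : N (h T) by rewrite -fx'; exact: (sU _ Ux).1.
have /near_distP[d d0 Nd] : nbhs T (h @^-1` N) by apply: hc; exact: open_nbhs_nbhs.
have shc t : `|t - T| < d -> {for t, continuous (s \o h)}.
  move=> td; have [_ _ sc] := sN _ (Nd _ td).
  by apply: continuous_comp => //; exact: hc.
have shT : s (h T) = x' by rewrite -fx' (sU _ Ux).2.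
pose g' t := if t < T then g t else s (h t).
exists d => //; exists g'; split.
- move=> t t0; rewrite /g'; case: ltP => Tt; first exact: g0.
  have TT : T = 0 by apply/eqP; rewrite eq_le T0 (le_trans Tt).
  have -> : t = T by apply/eqP; rewrite eq_le Tt TT t0.
  by rewrite shT Tx.
- move=> t tTd; have [tT|] := ltP t T.
    have e : \forall s \near t, g s = g' s.
      apply/near_distP; exists (T - t); first by rewrite subr_gt0.
      move=> r; rewrite ltr_norml => /andP[_ rt]; rewrite /g' ifT//; lra.
    exact: near_eq_continuous e (gc _ tT).
  rewrite le_eqVlt => /predU1P[<-|Tt].
    move=> W; rewrite {1}/g' ltxx shT => Wx'.
    suff : \forall r \near T, W (g' r) by [].
    have /near_distP[d1 d10 shd] : \forall r \near T, W (s (h r)).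
      by apply: (continuous_near (shc T _)); rewrite ?subrr ?normr0//= shT.
    have /near_leftP[d2 d20 gd] : \forall t \near T^'-, W (g t) by exact: gx'.
    apply/near_distP; exists (Num.min d1 d2); first by rewrite lt_min d10.
    move=> r; rewrite lt_min /g' /= ltr_norml => /andP[/andP[r1 r2] r3].
    case: ltP => rT; last by apply: shd; rewrite ger0_norm; lra.
    by apply: gd; rewrite rT andbT; move: r3; rewrite ltr_norml => /andP[]; lra.
  have td : `|t - T| < d by rewrite gtr0_norm; lra.
  have e : \forall r \near t, (s \o h) r = g' r.
    apply/near_distP; exists (t - T); first by rewrite subr_gt0.
    by move=> r; rewrite ltr_norml => /andP[rt _]; rewrite /g' ifF//; apply/negbTE; rewrite -leNgt; lra.
  exact: near_eq_continuous e (shc _ td).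
- move=> t /andP[t0 tT]; rewrite /g'; case: ltP => Tt; first by rewrite gh// t0.
  by have [|_ ->] := sN (h t); first by apply: Nd; rewrite ger0_norm; lra.
Unshelve. all: by end_near. Qed.

Let lift_before_unique (h : R -> Y) x T T' (g g' : R -> X) t :
  lift_before h x T g -> lift_before h x T' g' -> t < T -> t < T' -> g t = g' t.
Proof.
move=> [g0 gc gh] [g'0 g'c g'h] tT tT'.
have [t0|/ltW t0] := leP t 0; first by rewrite g0// g'0.
apply: (@lift_unique g g' 0 t t0); last by rewrite g0// g'0.
move=> r /andP[r0 rt]; split.
- exact: gc (le_lt_trans rt _).
- exact: g'c (le_lt_trans rt _).
- by rewrite gh ?g'h// r0 (le_lt_trans rt).
Qed.

(** Lifting is reduced to the existence of left limits of partial lifts. These come from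
    completeness for coordinate segments, and later from local sections for arbitrary paths. *)
Lemma lift_exists (h : R -> Y) x b : continuous h -> f x = h 0 -> 0 <= b ->
  (forall T g, 0 < T <= b -> lift_before h x T g ->
     exists x' : X, g t @[t --> T^'-] --> x') ->
  exists g : R -> X, [/\ continuous g, forall t, t <= 0 -> g t = x &
    forall t, 0 <= t <= b -> f (g t) = h t].
Proof.
move=> hc fx b0 glim.
have ext T g : 0 <= T <= b -> lift_before h x T g ->
    exists2 d, 0 < d & exists g', lift_before h x (T + d) g'.
  move=> /andP[T0 Tb] gT; have [T00|Tn0] := eqVneq T 0.
    apply: (@lift_extend h x T g x) => //.
    move=> W Wx; suff : \forall t \near T^'-, W (g t) by [].
    apply/near_leftP; exists 1 => // t /andP[_ tT].
    have [g0 _ _] := gT; rewrite g0; first exact: nbhs_singleton.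
    by rewrite -T00 ltW.
  have Tp : 0 < T by rewrite lt0r Tn0.
  have [|x' gx'] := glim T g _ gT; first by rewrite Tp.
  by apply: (@lift_extend h x T g x') => // T00; rewrite T00 ltxx in Tp.
have [g gb] : exists g, lift_before h x b g.
  suff : forall T, 0 <= T <= b -> exists g, lift_before h x T g.
    by apply; rewrite b0 lexx.
  apply: real_induction.
  - exists (cst x); split => //; first by move=> t _; exact: cvg_cst.
    by move=> t /andP[t0 t1]; have := le_lt_trans t0 t1; rewrite ltxx.
  - move=> T /andP[T0 Tb] IH; have [|g gT] := IH T; first by rewrite T0 lexx.
    have [|d d0 [g' g'T]] := ext T g _ gT; first by rewrite T0 ltW.
    exists d => // s /andP[Ts sTd] _; exists g'; case: g'T => g0 gc gh; split => //.
      by move=> t ts; apply: gc; exact: lt_trans sTd.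
    by move=> t /andP[t0 ts]; apply: gh; rewrite t0 (lt_trans ts).
  - move=> T /andP[T0 Tb] IH.
    (* Limit step: at time [t] the glued lift uses the partial lift up to [sig t], a time strictly
       between [t] and [T]; by uniqueness the partial lifts agree wherever both are defined. *)
    have /choice[G GP] : forall s, exists g, 0 <= s < T -> lift_before h x s g.
      move=> s; have [sT|nsT] := boolP (0 <= s < T); last by exists (cst x).
      by have [g gs] := IH _ sT; exists g.
    pose sig t := (Num.max t 0 + T) / 2.
    have sigP t : t < T -> [/\ 0 <= sig t, sig t < T & t < sig t].
      move=> tT; rewrite /sig; have m0 : 0 <= Num.max t 0 by rewrite le_max lexx orbT.
      have mt : t <= Num.max t 0 by rewrite le_max lexx.
      have mT : Num.max t 0 < T by rewrite gt_max tT.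
      by split; lra.
    have GE s t : 0 <= s < T -> t < s -> G (sig t) t = G s t.
      move=> sT ts; have [s0 s1] := andP sT.
      have [g0 g1 g2] := sigP t (lt_trans ts s1).
      by apply: (@lift_before_unique h x (sig t) s) => //; apply: GP => //; rewrite g0.
    exists (fun t => G (sig t) t); split.
    + move=> t t0; have [g0 g1 g2] := sigP t (le_lt_trans t0 T0).
      by have [|-> //] := GP (sig t); rewrite g0.
    + move=> t tT; have [g0 g1 g2] := sigP t tT.
      have e : \forall r \near t, G (sig t) r = G (sig r) r.
        apply/near_distP; exists (sig t - t); first by rewrite subr_gt0.
        move=> r; rewrite ltr_norml => /andP[_ rt].
        by apply/esym; apply: GE; [rewrite g0|lra].
      have [|_ Gc _] := GP (sig t); first by rewrite g0.
      exact: near_eq_continuous e (Gc _ g2).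
    + move=> t /andP[t0 tT]; have [g0 g1 g2] := sigP t tT.
      by have [|_ _ ->] := GP (sig t); rewrite ?g0 ?t0.
have [|d d0 [g' [g'0 g'c g'h]]] := ext b g _ gb; first by rewrite b0 lexx.
(* The lift [g'] reaches beyond [b], hence is continuous at [b] from both sides, and may be frozen
   there. *)
exists (fun t => g' (Num.min t b)); split.
- move=> t; apply: (@continuous_comp _ _ _ (fun t => Num.min t b) g').
    by apply: (@continuous_min R R id (cst b)); [exact: cvg_id|exact: cvg_cst].
  by apply: g'c; rewrite gt_min; apply/orP; right; lra.
- by move=> t t0; apply: g'0; rewrite ge_min t0.
- by move=> t /andP[t0 tb]; rewrite (min_idPl tb) g'h// t0; lra.
Unshelve. all: by end_near. Qed.

(** Near [(t, z0)] the projected paths stay in the domain of one local section. A lift that starts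
    in its sheet [U] at time [a] is, by uniqueness, that section applied to the projected path, so
    continuity in [z] passes from time [a] to time [b]; real induction covers [0, 1]. *)
Lemma lift_continuous_param (Z : topologicalType) (G : Z -> R -> X) z0 :
  (\forall z \near z0, continuous (G z)) ->
  (forall t, 0 <= t <= 1 ->
     {for (t, z0), continuous (fun p : R * Z => f (G p.2 p.1))}) ->
  {for z0, continuous (G^~ 0)} ->
  forall t, 0 <= t <= 1 -> {for z0, continuous (G^~ t)}.
Proof.
move=> Gc fGc G0.
have Gz0 : continuous (G z0) by exact: nbhs_singleton Gc.
have step t : 0 <= t <= 1 -> exists2 d, 0 < d &
    forall a b, `|a - t| < d -> `|b - t| < d -> a <= b -> 0 <= b <= 1 ->
    {for z0, continuous (G^~ a)} -> {for z0, continuous (G^~ b)}.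
  move=> t01; have [U [N [s [Uo Ux No sU sN]]]] := local_section (G z0 t).
  have : nbhs (t, z0) ((fun p : R * Z => f (G p.2 p.1)) @^-1` N).
    by apply: fGc => //; apply: open_nbhs_nbhs; split => //=; exact: (sU _ Ux).1.
  move=> [[I Z0] /= [/near_distP[d1 d10 Id] Z0z] IZ].
  have /near_distP[d2 d20 Ud] : nbhs t (G z0 @^-1` U).
    by apply: Gz0; exact: open_nbhs_nbhs.
  exists (Num.min d1 d2); first by rewrite lt_min d10.
  move=> a b; rewrite !lt_min => /andP[a1 a2] /andP[b1 b2] ab b01 Ga.
  have NG z r : Z0 z -> a <= r <= b -> N (f (G z r)).
    move=> Z0z' /andP[ar rb]; apply: (IZ (r, z)); split => //=; apply: Id.
    by move: a1 b1; rewrite !ltr_norml => /andP[? ?] /andP[? ?]; apply/andP; split; lra.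
  have Ua : \forall z \near z0, U (G z a).
    by apply: Ga; apply: open_nbhs_nbhs; split => //; exact: Ud.
  have GE : \forall z \near z0, s (f (G z b)) = G z b.
    near=> z; have Z0' : Z0 z by near: z.
    have Gzc : continuous (G z) by near: z.
    apply/esym; apply: (@lift_unique (G z) (fun r => s (f (G z r))) a b) => //.
      move=> r rab; have [_ -> sc] := sN _ (NG _ _ Z0' rab); split => //.
        exact: Gzc.
      apply: (@continuous_compose _ _ _ (fun r => f (G z r)) s r) => //.
      by apply: (@continuous_compose _ _ _ (G z) f r); [exact: Gzc|exact: fc].
    by rewrite (sU _ _).2//; near: z.
  have Gb : G z0 b = s (f (G z0 b)) by apply/esym; exact: nbhs_singleton GE.
  have : {for z0, continuous (fun z => s (f (G z b)))}.
    have Z00 : Z0 z0 by exact: nbhs_singleton.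
    have [|_ _ sc] := sN (f (G z0 b)); first by apply: NG; rewrite ?ab ?lexx.
    apply: (@continuous_compose _ _ _ (fun z => f (G z b)) s z0) => //.
    apply: (@continuous_compose _ _ _ (fun z => (b, z))
      (fun p : R * Z => f (G p.2 p.1)) z0).
      move=> W [[A B] /= [Ab Bz] AB]; suff : \forall z \near z0, W (b, z) by [].
      by apply: filterS Bz => z Bz; apply: AB; split => //; exact: nbhs_singleton.
    exact: fGc.
  exact: near_eq_continuous GE.
apply: real_induction => // t /andP[t0 t1] IH.
  have t01 : 0 <= t <= 1 by rewrite t0 ltW.
  have [d d0 dP] := step t t01; exists d => // s /andP[ts sd] s1.
  apply: (dP t s); rewrite ?subrr ?normr0 ?s1 ?andbT ?(ltW ts) ?(le_trans t0 (ltW ts))//.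
    by rewrite gtr0_norm; lra.
  by apply: IH; rewrite t0 lexx.
have t01 : 0 <= t <= 1 by rewrite (ltW t0).
have [d d0 dP] := step t t01; pose s := Num.max 0 (t - d / 2).
have st : s < t by rewrite gt_max t0; lra.
have ds : t - d / 2 <= s by rewrite le_max lexx orbT.
have s0 : 0 <= s by rewrite le_max lexx.
apply: (dP s t); rewrite ?subrr ?normr0 ?(ltW st)//.
  by rewrite ltr0_norm; lra.
by apply: IH; rewrite s0.
Unshelve. all: by end_near. Qed.

(** [V] is chosen before [x]: one neighbourhood serves all points above it. A local homeomorphism
    alone lets it depend on [x], and a lift could then fail to converge at its end time. *)
Definition has_local_sections : Prop :=
  forall y, exists V : set Y, [/\ open V, V y & forall x, V (f x) ->
    exists s : Y -> X, s (f x) = x /\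
      forall z, V z -> f (s z) = z /\ {for z, continuous s}].

Hypothesis fsec : has_local_sections.

(** Shortly before an end time [T] the path lies in the set [V] around [h T]; the section through
    the lift at such a time follows the lift by uniqueness and is continuous at [T]. *)
Lemma path_lifting (h : R -> Y) x : continuous h -> f x = h 0 ->
  exists g : R -> X, [/\ continuous g, g 0 = x &
    forall t, 0 <= t <= 1 -> f (g t) = h t].
Proof.
move=> hc fx.
have [T g /andP[T0 T1] [g0 gc gh]|g [gc g0 gh]] := @lift_exists h x 1 hc fx ler01;
  last by exists g; split => //; exact: g0.
have [V [Vo VhT Vs]] := fsec (h T).
have hV : \forall t \near T, V (h t).
  by apply: continuous_near (hc T) _; exact: open_nbhs_nbhs.
have /near_distP[d d0 Vd] := hV.
pose a := Num.max 0 (T - d / 2).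
have aT : a < T by rewrite gt_max T0; lra.
have da : T - d / 2 <= a by rewrite le_max lexx orbT.
have a0 : 0 <= a by rewrite le_max lexx.
have hVt t : a <= t -> t <= T -> V (h t).
  by move=> at_ tT; apply: Vd; rewrite ltr_norml; apply/andP; split; lra.
have [|s [sg sV]] := Vs (g a).
  by rewrite gh ?a0//; apply: hVt => //; exact: ltW.
have shc t : a <= t -> t <= T -> {for t, continuous (fun r => s (h r))}.
  move=> at_ tT; apply: (@continuous_compose _ _ _ h s t); first exact: hc.
  by have [] := sV _ (hVt _ at_ tT).
have gE t : a <= t -> t < T -> s (h t) = g t.
  move=> at_ tT; apply/esym; apply: (@lift_unique g (fun r => s (h r)) a t at_).
    move=> r /andP[ar rt]; have rT := le_lt_trans rt tT; split.
    - exact: gc.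
    - exact/shc/ltW.
    - have [|-> _] := sV (h r); first by apply: hVt => //; exact: ltW.
      by rewrite gh// rT (le_trans a0).
  by rewrite -gh ?a0// sg.
exists (s (h T)) => W Ws.
suff : \forall t \near T^'-, W (g t) by [].
have /near_distP[e e0 We] := continuous_near (shc T (ltW aT) (lexx T)) Ws.
apply/near_leftP; exists (Num.min e (T - a)); first by rewrite lt_min e0 subr_gt0.
move=> t /andP[Tt tT]; rewrite -gE//; last first.
  have : Num.min e (T - a) <= T - a by rewrite ge_min lexx orbT.
  by lra.
apply: We; have : Num.min e (T - a) <= e by rewrite ge_min lexx.
by rewrite ltr0_norm; lra.
Qed.

End lifting.

Section coverings.
Context {R : realType} {X Y : topologicalType} (f : X -> Y).

(* Over a simply connected base, the square of lifts of a null-homotopy of the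
   loop [f \o a] has constant right edge, so [a] is itself a loop. *)
Theorem covering_bijective : local_homeomorphism f -> has_local_sections f ->
  hausdorff_space X -> hausdorff_space Y -> simply_connected R Y ->
  [set: X] !=set0 ->
  (forall x x', exists a : R -> X, [/\ continuous a, a 0 = x & a 1 = x']) ->
  injective f /\ forall y, exists x, f x = y.
Proof.
move=> flh fsec hX hY [Ypc Ysc] [xx _] Xpc.
have c01 t : `[0%R, 1%R]%classic (clamp01 t : R).
  by rewrite /= in_itv/=; exact: clamp01_bounds.
have cc : continuous (@clamp01 R) by exact: clamp01_continuous.
have cid t : 0 <= t <= 1 -> clamp01 t = t :> R by exact: clamp01_id.
have z01 : 0 <= (0 : R) <= 1 by rewrite lexx ler01.
have o01 : 0 <= (1 : R) <= 1 by rewrite lexx ler01.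
split=> [x x' fxx'|y]; last first.
  have [g [gc g0 g1]] := Ypc (f xx) y.
  have hc : continuous (fun t : R => g (clamp01 t)).
    exact: (continuous_within_comp gc).
  have [|l [lc l0 lh]] := path_lifting flh hX hY fsec hc (x := xx).
    by rewrite cid.
  by exists (l 1); rewrite lh// cid.
have [a [ac a0 a1]] := Xpc x x'.
pose g (t : R) := f (a t).
have fc : continuous f by have [] := flh.
have gc : continuous g.
  by move=> t; apply: (@continuous_compose _ _ _ a f t); [exact: ac|exact: fc].
have [||H [Hc Ht Hs]] := Ysc g.
- exact: continuous_subspaceT.
- by rewrite /g a0 a1.
(* The homotopy is controlled on the square only; clamping both variables makes it continuous on the
   plane, as lifting requires. *)
pose h (p : R * R) := H (clamp01 p.1, clamp01 p.2).
have hc : continuous h.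
  apply: (continuous_within_comp Hc (r := fun p : R * R => (clamp01 p.1, clamp01 p.2))).
  - by move=> p; split; exact: c01.
  - move=> p W [[A B] /= [Ap Bp] AB].
    exists (clamp01 (R:=R) @^-1` A, clamp01 (R:=R) @^-1` B) => /=.
      by split; exact: cc.
    by move=> q [/= qA qB]; exact: AB.
have i01 (t : R) : 0 <= t <= 1 -> t \in `[0%R, 1%R] by rewrite in_itv.
have h1 s : continuous (fun t : R => h (t, s)).
  move=> t; apply: (@continuous_compose _ _ _ (fun t => (t, s)) h t); last exact: hc.
  move=> W [[A B] /= [At Bs] AB]; suff : \forall t' \near t, W (t', s) by [].
  by apply: filterS At => t' At'; apply: AB; split => //; exact: nbhs_singleton.
have /choice[G GP] s : exists l : R -> X, [/\ continuous l, l 0 = x &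
    forall t, f (l t) = h (t, s)].
  have [|l [lc l0 lh]] := path_lifting flh hX hY fsec (h1 s) (x := x).
    by rewrite /h /= (cid _ z01); have [-> _] := Hs _ (c01 s); rewrite /g a0.
  exists (fun t => l (clamp01 t)); split => [t||t].
  - by apply: (@continuous_compose _ _ _ (@clamp01 R) l t); [exact: cc|exact: lc].
  - by rewrite (cid _ z01).
  - by rewrite lh ?clamp01_bounds// /h /= (cid (clamp01 t))//; exact: clamp01_bounds.
have Gend s : {for s, continuous (fun s => G s 1)}.
  apply: (lift_continuous_param flh hX (Z := R)) => //.
  - by apply: filterE => z; have [] := GP z.
  - have -> : (fun p : R * R => f (G p.2 p.1)) = h.
      by apply/funext => -[t' s'] /=; have [_ _ ->] := GP s'.
    by move=> t _; exact: hc.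
  - have -> : G^~ 0 = cst x by apply/funext => z; have [] := GP z.
    exact: cvg_cst.
have fG1 s : f (G s 1) = g 0.
  by have [_ _ ->] := GP s; rewrite /h /= (cid _ o01); have [_ ->] := Hs _ (c01 s).
have Gconst : G 0 1 = G 1 1.
  apply: (@lift_unique R X Y f flh hX (cst (G 0 1)) (fun s => G s 1) 0 1 ler01) => //.
  by move=> t _; split; [exact: cvg_cst|exact: Gend|rewrite !fG1].
(* The slice [s = 1] of the homotopy is constant, so its lift stays at [x]; the slice [s = 0] is
   [g], whose lift from [x] is [a] and ends at [x']. *)
have G1 : G 1 1 = x.
  have [Gc G10 Gh] := GP 1; rewrite -G10.
  apply/esym; apply: (@lift_unique R X Y f flh hX (cst (G 1 0)) (G 1) 0 1 ler01) => //.
  move=> t t01; split; [exact: cvg_cst|exact: Gc|].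
  rewrite !Gh /h /= (cid _ o01) (cid _ z01) (cid _ t01).
  have [_ ->] := Ht _ (i01 _ z01).
  by have [_ ->] := Ht _ (i01 _ t01).
have G0 : G 0 1 = x'.
  have [Gc G00 Gh] := GP 0; rewrite -a1.
  apply: (@lift_unique R X Y f flh hX (G 0) a 0 1 ler01); last by rewrite G00 a0.
  move=> t t01; split; [exact: Gc|exact: ac|].
  by rewrite Gh /h /= (cid _ z01) (cid _ t01); have [-> _] := Ht _ (i01 _ t01).
by rewrite -G1 -Gconst G0.
Qed.

End coverings.

(** * Weights *)

(* The only properties of a weight that the inversion theorem uses; both
   continuous and nonincreasing weights have them, with [N] a primitive. *)
Definition integrable_growth (R : realType) (eta N : R -> R) : Prop :=
  [/\ forall r, 0 <= r -> exists2 e : R, 0 < e &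
        forall s, 0 <= s <= r -> e <= eta s,
      forall r s, r <= s -> N r <= N s,
      continuous N,
      forall r, 0 <= r -> exists2 d : R, 0 < d &
        forall s, r <= s < r + d -> N s - N r <= 2 * eta r * (s - r) &
      forall K : R, exists2 r, 0 <= r & K < N r].

Section weights.
Context {R : realType}.
Local Notation mu := (@lebesgue_measure R).

(** Common ground of the two kinds of weight, once frozen at negative arguments. [N] is the integral
    from 0, and its increments are bounded by the local bounds on [eta]; the factor 2 is the
    tolerance that a continuous weight needs to the right of [r]. *)
Let integrable_growth_of_locally_bounded (eta : R -> R) :
  (forall r, r <= 0 -> eta r = eta 0) -> (forall r, 0 < eta r) ->
  measurable_fun setT eta ->
  (forall r, exists M, forall s, s <= r -> eta s <= M) ->
  (forall r, exists2 e : R, 0 < e & forall s, s <= r -> e <= eta s) ->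
  (forall r, exists2 d : R, 0 < d & forall s, r <= s < r + d -> eta s <= 2 * eta r) ->
  (\int[mu]_(r in `[0%R, +oo[) (eta r)%:E = +oo)%E ->
  exists N, integrable_growth eta N.
Proof.
move=> eta_neg eta0 meta etaM etam eta2 etaoo.
pose N (r : R) : R := \int[mu]_(t in `[0, Num.max 0 r]) eta t.
have ieta (a b : R) (l r : bool) : mu.-integrable [set` Interval (BSide l a) (BSide r b)] (EFin \o eta).
  have [M etaM'] := etaM b.
  apply: measurable_bounded_integrable => //.
  - by rewrite /= lebesgue_measure_itv/=; case: ifP => // _; rewrite -EFinD ltry.
  - exact: measurable_funTS.
  - exists M; split; first exact: num_real.
    move=> x Mx t; rewrite /= in_itv/= => /andP[_ tb].
    by rewrite ger0_norm ?(ltW (eta0 _))// (le_trans (etaM' t (lteifW tb)))// ltW.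
have NB r s c : 0 <= r <= s -> (forall t, r <= t <= s -> eta t <= c) ->
    0 <= N s - N r <= c * (s - r).
  move=> /andP[r0 rs] etac; have s0 := le_trans r0 rs.
  rewrite /N !(max_idPr _)// (@Rintegral_itvB _ _ (BLeft 0) (BRight s))//.
  apply/andP; split; first by apply: Rintegral_ge0 => t _; exact/ltW.
  have -> : c * (s - r) = \int[mu]_(t in `]r, s]) c.
    rewrite Rintegral_cst//= lebesgue_measure_itv/= lte_fin.
    case: ltP => [_|sr]; first by rewrite -EFinD.
    have -> : r = s by apply/eqP; rewrite eq_le rs.
    by rewrite subrr !mulr0.
  apply: le_Rintegral => //.
    apply: measurable_bounded_integrable => //.
    - by rewrite /= lebesgue_measure_itv/=; case: ifP => // _; rewrite -EFinD ltry.
    - exists c; split; first exact: num_real.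
      move=> x cx t _; rewrite /= ger0_norm ?ltW//.
      by rewrite (lt_le_trans (eta0 r))// etac// lexx.
  move=> t; rewrite /= in_itv/= => /andP[rt ts]; apply: etac.
  by rewrite (ltW rt).
have NBmax r s c : r <= s -> (forall t, t <= Num.max 0 s -> eta t <= c) ->
    0 <= N s - N r <= c * (Num.max 0 s - Num.max 0 r).
  move=> rs etac; have Nmax t : N t = N (Num.max 0 t) by rewrite /N maxA maxxx.
  rewrite (Nmax s) (Nmax r); apply: NB => [|t /andP[_]]; last exact: etac.
  by rewrite le_max lexx/= ge_max !le_max lexx rs orbT.
exists N; split.
- by move=> r r0; have [e e0 em] := etam r; exists e => // s /andP[_ /em].
- move=> r s rs; have [M etaM'] := etaM (Num.max 0 s).
  by have /andP[] := NBmax _ _ _ rs etaM'; rewrite subr_ge0.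
- move=> r; apply/cvgrPdist_le => e e0.
  have [M0 etaM'] := etaM (Num.max 0 (r + 1)); pose M := `|M0| + 1.
  have M1 : 0 < M by rewrite /M ltr_wpDl.
  suff : \forall s \near r, `|N r - N s| <= e by [].
  apply/near_distP; exists (Num.min 1 (e / M)); first by rewrite lt_min ltr01 divr_gt0.
  have key a b : a <= b -> b <= r + 1 -> b - a <= e / M -> `|N b - N a| <= e.
    move=> ab br bae.
    have mb : Num.max 0 b <= Num.max 0 (r + 1) by rewrite ge_max !le_max lexx br/= orbT.
    have [t tb|n0 n1] := andP (NBmax a b M ab _).
      rewrite /M (le_trans (etaM' t _)) ?(le_trans tb)//.
      by rewrite (le_trans (ler_norm _))// lerDl.
    rewrite ger0_norm// (le_trans n1)// mulrC -ler_pdivlMr// (le_trans _ bae)//.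
    have : Num.max 0 b <= Num.max 0 a + (b - a).
      rewrite ge_max; have : 0 <= Num.max 0 a by rewrite le_max lexx.
      have : a <= Num.max 0 a by rewrite le_max lexx orbT.
      by move=> ? ?; apply/andP; split; lra.
    by lra.
  move=> s; rewrite lt_min => /andP[s1 se].
  have [rs|/ltW sr] := leP r s.
    by rewrite distrC; apply: key => //; move: s1 se; rewrite ger0_norm ?subr_ge0//; lra.
  by apply: key => //; move: s1 se; rewrite ler0_norm ?subr_le0//; lra.
- move=> r r0; have [d d0 etad] := eta2 r; exists d => // s /andP[rs sd].
  have rs0 : 0 <= r <= s by rewrite r0.
  have etar t : r <= t <= s -> eta t <= 2 * eta r.
    by move=> /andP[rt ts]; apply: etad; rewrite rt (le_lt_trans ts).
  by have /andP[] := NB r s _ rs0 etar.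
(* If [N] stayed below [K], monotone convergence along the intervals from 0 to [n] would bound the
   integral over the half-line by [K]. *)
- move=> K; apply: contrapT => nK.
  have NK r : 0 <= r -> N r <= K.
    by move=> r0; rewrite leNgt; apply/negP => ?; apply: nK; exists r.
  have Ioo : (\int[mu]_(x in `[0%R, n%:R]) (eta x)%:E @[n --> \oo] -->
      \int[mu]_(x in `[0%R, +oo[) (eta x)%:E)%E.
    have -> : `[0%R, +oo[%classic = \bigcup_n `[0%R, n%:R]%classic :> set R.
      apply/seteqP; split => [r|r [n _]]; rewrite /= !in_itv/= ?andbT; last by case/andP.
      move=> r0; exists (Num.truncn r).+1 => //=; rewrite in_itv/= r0/=.
      by apply/ltW; exact: truncnS_gt.
    apply: ge0_nondecreasing_set_cvg_integral => //.
    - apply/nondecreasing_seqP => n; rewrite subsetEset => r /=.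
      rewrite !in_itv/= => /andP[-> /le_trans]; apply.
      by rewrite ler_nat.
    - by move=> n; apply/measurable_EFinP; exact: measurable_funTS.
    - by move=> n x _; rewrite lee_fin ltW.
  have IK n : (\int[mu]_(x in `[0%R, n%:R]) (eta x)%:E <= K%:E)%E.
    have := NK n%:R (ler0n _ _); rewrite /N (max_idPr _)//.
    have /fineK H : (\int[mu]_(x in `[0%R, n%:R]) (eta x)%:E \is a fin_num)%E.
      exact: (@integrable_fin_num _ _ _ mu _ _ _ (ieta 0 n%:R true false)).
    rewrite /Rintegral -lee_fin.
    by rewrite H.
  have : (\int[mu]_(x in `[0%R, +oo[) (eta x)%:E <= K%:E)%E.
    have <- := cvg_lim (@ereal_hausdorff R) Ioo.
    by apply: lime_le; [exact: cvgP Ioo|apply: nearW].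
  by rewrite etaoo.
Qed.

Lemma continuous_weight_integrable_growth (eta : R -> R) :
  continuous_weight eta -> exists N, integrable_growth eta N.
Proof.
move=> [[eta0 etaoo] etac].
pose h (r : R) := eta (Num.max 0 r).
have hE r : 0 <= r -> h r = eta r by move=> r0; rewrite /h (max_idPr r0).
have hc : continuous h.
  apply: (@continuous_within_comp R R R _ eta (fun r : R => Num.max 0 r) etac).
    by move=> r; rewrite /= in_itv/= le_max lexx.
  by move=> r; apply: (@continuous_max R R (cst 0) id); [exact: cvg_cst|exact: cvg_id].
have h0 r : 0 < h r by apply: eta0; rewrite le_max lexx.
have hneg r : r <= 0 -> h r = h 0 by move=> r0; rewrite /h (max_idPl r0) maxxx.
have hmax r : h (Num.max 0 r) = h r by rewrite /h; congr eta; apply/max_idPr; rewrite le_max lexx.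
have [|||||N [N1 N2 N3 N4 N5]] := @integrable_growth_of_locally_bounded h hneg h0.
- exact: continuous_measurable_fun.
- move=> r; have r0 : 0 <= Num.max 0 r by rewrite le_max lexx.
  have [c _ cM] := EVT_max r0 (continuous_subspaceT hc).
  exists (h c) => s sr; rewrite -hmax; apply: cM; rewrite in_itv/= le_max lexx/=.
  by rewrite ge_max !le_max lexx sr/= orbT.
- move=> r; have r0 : 0 <= Num.max 0 r by rewrite le_max lexx.
  have [c _ cM] := EVT_min r0 (continuous_subspaceT hc).
  exists (h c) => // s sr; rewrite -[h s]hmax; apply: cM; rewrite in_itv/= le_max lexx/=.
  by rewrite ge_max !le_max lexx sr/= orbT.
- move=> r; have /near_distP[d d0 hd] : \forall s \near r, h s < 2 * h r.
    have : nbhs (h r) [set x | x < 2 * h r].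
      by apply: lt_nbhsl; have := h0 r; lra.
    exact: continuous_near (hc r).
  exists d => // s /andP[rs sd]; apply/ltW/hd.
  by rewrite ger0_norm ?subr_ge0//; lra.
- rewrite -etaoo; apply: eq_integral => r; rewrite inE/= in_itv/= andbT => r0.
  by rewrite hE.
exists N; split => // r r0.
  have [e e0 eh] := N1 r r0; exists e => // s /[dup] /andP[s0 _] /eh.
  by rewrite hE.
by have := N4 r r0; rewrite hE.
Qed.

(** Such a weight may jump, but only downwards, so the one-sided growth bound on [N] survives;
    measurability and the other bounds are monotonicity. *)
Lemma nonincreasing_weight_integrable_growth (eta : R -> R) :
  nonincreasing_weight eta -> exists N, integrable_growth eta N.
Proof.
move=> [[eta0 etaoo] etad].
pose h (r : R) := eta (Num.max 0 r).
have hE r : 0 <= r -> h r = eta r by move=> r0; rewrite /h (max_idPr r0).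
have h0 r : 0 < h r by apply: eta0; rewrite le_max lexx.
have hneg r : r <= 0 -> h r = h 0 by move=> r0; rewrite /h (max_idPl r0) maxxx.
have hd r s : r <= s -> h s <= h r.
  move=> rs; apply: etad; first by rewrite le_max lexx.
  by rewrite ge_max !le_max lexx rs/= orbT.
have [|||||N [N1 N2 N3 N4 N5]] := @integrable_growth_of_locally_bounded h hneg h0.
- exact: nonincreasing_measurable.
- move=> r; exists (h 0) => s _; have [s0|/ltW s0] := leP s 0; first by rewrite hneg.
  exact: hd.
- by move=> r; exists (h r) => // s; exact: hd.
- move=> r; exists 1 => // s /andP[rs _].
  by have := hd _ _ rs; have := h0 r; lra.
- rewrite -etaoo; apply: eq_integral => r; rewrite inE/= in_itv/= andbT => r0.
  by rewrite hE.
exists N; split => // r r0.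
  have [e e0 eh] := N1 r r0; exists e => // s /[dup] /andP[s0 _] /eh.
  by rewrite hE.
by have := N4 r r0; rewrite hE.
Qed.

End weights.

(** * Charts and tangent vectors *)

Section charts.
Context {R : realType} {E : completeNormedModType R} {X : banach_manifold E}.
Implicit Types (c : chart X E) (x : X).

Lemma atlas_bwdK c x : atlas c -> dom c x -> bwd c (fwd c x) = x.
Proof. by move=> /atlas_chart[_ _ K _ _] /K. Qed.

Lemma atlas_dom_nbhs c x : atlas c -> dom c x -> nbhs x (dom c).
Proof. by move=> /atlas_chart[co _ _ _ _] cx; exact: open_nbhs_nbhs. Qed.

Lemma atlas_image_nbhs c x : atlas c -> dom c x -> nbhs (fwd c x) (fwd c @` dom c).
Proof.
move=> /atlas_chart[_ co _ _ _] cx; apply: open_nbhs_nbhs; split; last by exists x.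
exact: co.
Qed.

Lemma atlas_fwd_continuous c x : atlas c -> dom c x -> {for x, continuous (fwd c)}.
Proof.
move=> /[dup] ac /atlas_chart[_ _ _ /within_continuousP cc _] cx W Wx.
suff : \forall y \near x, W (fwd c y) by [].
by apply: filterS2 (atlas_dom_nbhs ac cx) (cc _ cx _ Wx) => y dy; exact.
Qed.

Lemma atlas_bwd_continuous c x : atlas c -> dom c x ->
  {for fwd c x, continuous (bwd c)}.
Proof.
move=> /[dup] ac /atlas_chart[_ _ _ _ /within_continuousP cc] cx W Wx.
suff : \forall y \near fwd c x, W (bwd c y) by [].
have cxi : (fwd c @` dom c) (fwd c x) by exists x.
by apply: filterS2 (atlas_image_nbhs ac cx) (cc _ cxi _ Wx) => y dy; exact.
Qed.

Lemma atlas_fwd_image_nbhs c x (W : set X) : atlas c -> dom c x -> nbhs x W ->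
  nbhs (fwd c x) (fwd c @` (dom c `&` W)).
Proof.
move=> ac cx Wx.
have : \forall y \near fwd c x, W (bwd c y).
  by apply: (continuous_near (atlas_bwd_continuous ac cx)); rewrite atlas_bwdK.
apply: filterS2 (atlas_image_nbhs ac cx) => _ [y cy <-]; rewrite atlas_bwdK// => Wy.
by exists y.
Qed.

Lemma chart_atP x : atlas (chart_at x) /\ dom (chart_at x) x.
Proof. by rewrite /chart_at; case: cid. Qed.

Lemma C1_map_id : @C1_map R E E X X id.
Proof. by split => [x|c c' ac ac']; [|have [] := atlas_compatible ac ac']. Qed.

End charts.

Definition chart_rep (R : realType) (E F : completeNormedModType R)
    (X : banach_manifold E) (Y : banach_manifold F) (f : X -> Y)
    (c : chart X E) (c' : chart Y F) : E -> F := fwd c' \o f \o bwd c.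

Section chart_rep_theory.
Context {R : realType} {E F : completeNormedModType R}
  {X : banach_manifold E} {Y : banach_manifold F} (f : X -> Y).
Hypothesis f1 : C1_map f.
Implicit Types (c : chart X E) (d : chart Y F) (x : X).

Lemma chart_rep_domain_open c (c' : chart Y F) : atlas c -> atlas c' ->
  open (fwd c @` (dom c `&` f @^-1` dom c')).
Proof.
move=> ac ac'; rewrite openE => _ [x [cx cfx] <-].
apply: (atlas_fwd_image_nbhs ac cx).
exact: (continuous_near (f1.1 x) (atlas_dom_nbhs ac' cfx)).
Qed.

Lemma chart_rep_differentiable c (c' : chart Y F) x : atlas c -> atlas c' -> dom c x ->
  dom c' (f x) -> differentiable (chart_rep f c c') (fwd c x).
Proof.
by move=> ac ac' cx cfx; have [] := f1.2 _ _ ac ac' (fwd c x); first by exists x.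
Qed.

Lemma chart_repE c (c' : chart Y F) x : atlas c -> dom c x ->
  chart_rep f c c' (fwd c x) = fwd c' (f x).
Proof. by move=> ac cx; rewrite /chart_rep /= atlas_bwdK. Qed.

End chart_rep_theory.

(** The representative of the composite is the composite of representatives only where [f] stays in
    [dom c'], which is a neighbourhood and so enough for differentials. *)
Lemma chart_rep_comp (R : realType) (E F G : completeNormedModType R)
    (X : banach_manifold E) (Y : banach_manifold F) (Z : banach_manifold G)
    (f : X -> Y) (g : Y -> Z) c c' c'' x v :
  C1_map f -> C1_map g -> atlas c -> atlas c' -> atlas c'' ->
  dom c x -> dom c' (f x) -> dom c'' (g (f x)) ->
  'd (chart_rep (g \o f) c c'') (fwd c x) v =
  'd (chart_rep g c' c'') (fwd c' (f x)) ('d (chart_rep f c c') (fwd c x) v).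
Proof.
move=> f1 g1 ac ac' ac'' cx cfx cgfx.
have df := chart_rep_differentiable f1 ac ac' cx cfx.
have dg := chart_rep_differentiable g1 ac' ac'' cfx cgfx.
rewrite -(chart_repE f c' ac cx) in dg *.
have [_ ->] : differentiable (chart_rep (g \o f) c c'') (fwd c x) /\
  'd (chart_rep (g \o f) c c'') (fwd c x) =
  'd (chart_rep g c' c'' \o chart_rep f c c') (fwd c x) :> (E -> G).
  apply: differentiable_near_eq; last exact: differentiable_comp.
  have fc : {for fwd c x, continuous (fun p => f (bwd c p))}.
    apply: (@continuous_compose _ _ _ (bwd c) f (fwd c x)); last exact: f1.1.
    exact: atlas_bwd_continuous.
  have : \forall p \near fwd c x, dom c' (f (bwd c p)).
    by apply: (continuous_near fc); rewrite atlas_bwdK//; exact: atlas_dom_nbhs.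
  by apply: filterS => p cp; rewrite /chart_rep /= atlas_bwdK.
by rewrite diff_comp.
Qed.

Section tangent_vectors.
Context {R : realType} {E : completeNormedModType R} {X : banach_manifold E}.
Implicit Types (c : chart X E) (x : X).

Lemma chart_rep_id c x v : atlas c -> dom c x ->
  'd (chart_rep (@id X) c c) (fwd c x) v = v.
Proof.
move=> ac cx.
have [_ ->] : differentiable (chart_rep (@id X) c c) (fwd c x) /\
  'd (chart_rep (@id X) c c) (fwd c x) = 'd (@id E) (fwd c x) :> (E -> E).
  apply: differentiable_near_eq; last exact: ex_diff.
  apply: filterS (atlas_image_nbhs ac cx) => _ [y cy <-].
  by rewrite chart_repE.
by rewrite diff_val.
Qed.

(** Tangent coordinates are the differential of the identity read in two charts, so each change of
    chart becomes an instance of [chart_rep_comp]. *)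
Lemma tvecE c x : tvec c x = 'd (chart_rep (@id X) c (chart_at x)) (fwd c x) :> (E -> E).
Proof. by []. Qed.

Lemma tvec_chart_at x v : tvec (chart_at x) x v = v.
Proof. by rewrite tvecE; have [a d] := chart_atP x; exact: chart_rep_id. Qed.

Lemma tvec_transition c c' x v : atlas c -> atlas c' -> dom c x -> dom c' x ->
  tvec c' x ('d (chart_rep (@id X) c c') (fwd c x) v) = tvec c x v.
Proof.
move=> ac ac' cx c'x; rewrite !tvecE; have [a d] := chart_atP x.
by rewrite -(chart_rep_comp v C1_map_id C1_map_id ac ac' a cx c'x d).
Qed.

Lemma tvec_surj c x v : atlas c -> dom c x -> exists w, tvec c x w = v.
Proof.
move=> ac cx; have [a d] := chart_atP x.
exists ('d (chart_rep (@id X) (chart_at x) c) (fwd (chart_at x) x) v).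
by rewrite (tvec_transition v a ac d cx) tvec_chart_at.
Qed.

Lemma tvecZ c x a v : tvec c x (a *: v) = a *: tvec c x v.
Proof. by rewrite !tvecE linearZ. Qed.

Lemma tvecB c x u v : tvec c x (u - v) = tvec c x u - tvec c x v.
Proof. by rewrite !tvecE linearB. Qed.

Lemma tvecD c x u v : tvec c x (u + v) = tvec c x u + tvec c x v.
Proof. by rewrite !tvecE linearD. Qed.

End tangent_vectors.

Lemma tdiff_tvec (R : realType) (E F : completeNormedModType R)
    (X : banach_manifold E) (Y : banach_manifold F) (f : X -> Y) c c' x v :
  C1_map f -> atlas c -> atlas c' -> dom c x -> dom c' (f x) ->
  tdiff f x (tvec c x v) = tvec c' (f x) ('d (chart_rep f c c') (fwd c x) v).
Proof.
move=> f1 ac ac' cx cfx; have [a d] := chart_atP x; have [a' d'] := chart_atP (f x).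
rewrite !tvecE -(chart_rep_comp v f1 C1_map_id ac ac' a' cx cfx d').
by rewrite -(chart_rep_comp v C1_map_id f1 ac a a' cx d d').
Qed.

Section finsler_norms.
Context {R : realType} {E : completeNormedModType R} {X : finsler_manifold E}.
Implicit Types (c : chart X E) (x : X).

Lemma fnorm_equiv_norm x : @equiv_norm R E (@fnorm R E X x).
Proof.
split; first by split; [exact: fnormD|move=> a v; exact: fnormZ].
have [ac cx] := chart_atP x.
have [a [b [a0 b0 ab]]] := fnorm_equiv ac cx; exists a, b; split => // v.
by have := ab v; rewrite tvec_chart_at.
Qed.

Lemma fnorm_seminorm x : @seminorm_on R E (@fnorm R E X x).
Proof. by have [] := fnorm_equiv_norm x. Qed.

Lemma fnorm_ge0 x (v : E) : 0 <= @fnorm R E X x v.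
Proof. exact: seminorm_ge0 (fnorm_seminorm x). Qed.

Lemma tvec_seminorm c x : @seminorm_on R E (fun w => fnorm (tvec c x w)).
Proof.
split=> [u v|a v]; first by rewrite tvecD fnormD.
by rewrite tvecZ fnormZ.
Qed.

(** The norm equivalence at [x0], spread by the local comparison with factor [k], yields constants
    [a] and [b] uniform over the chart. *)
Lemma finsler_chart (x0 : X) (k : R) : 1 < k -> exists (c : chart X E) (a b : R),
  [/\ atlas c, dom c x0, 0 < a, 0 < b &
    forall x w, dom c x ->
      [/\ a * `|w| <= fnorm (tvec c x w) <= b * `|w|,
          fnorm (tvec c x w) <= k * fnorm (tvec c x0 w) &
          fnorm (tvec c x0 w) <= k * fnorm (tvec c x w)]].
Proof.
move=> k1; have k0 : 0 < k by exact: lt_trans k1.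
have [c [ac cx0 ck]] := fnorm_local x0 k1.
have [a [b [a0 b0 ab]]] := fnorm_equiv ac cx0.
exists c, (k^-1 * a), (k * b); split => //; [by rewrite mulr_gt0 ?invr_gt0|by rewrite mulr_gt0|].
move=> x w cx; have /andP[c1 c2] := ck x w cx; have /andP[ab1 ab2] := ab w.
split => //; last by rewrite -ler_pdivrMl.
apply/andP; split.
  by rewrite (le_trans _ c1)// -mulrA ler_pM2l ?invr_gt0.
by rewrite (le_trans c2)// -mulrA ler_pM2l.
Qed.

End finsler_norms.

(** * Lengths of paths *)

Lemma deriv_in_near_eq_in (R : realType) (E : normedModType R) (A : set R)
    (g h : R -> E) t v :
  A t -> (\forall s \near t, A s -> g s = h s) ->
  deriv_in A g t v -> deriv_in A h t v.
Proof.
move=> At gh gv e /gv; have ght := nbhs_singleton gh At.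
by apply: filterS2 gh => s gs + As; move=> /(_ As); rewrite gs// ght.
Qed.

(** Properness makes the limit that defines [chart_deriv] unique, at the endpoints too. *)
Lemma within01_dnbhs_proper (R : realType) (t : R) : 0 <= t <= 1 ->
  ProperFilter (within `[0, 1] t^').
Proof.
move=> /andP[t0 t1]; apply: Build_ProperFilter.
rewrite /within/= => H.
have /near_distP[d d0 dP] : \forall s \near t, s != t -> s \in `[0%R, 1%R] -> False.
  have H' : \forall s \near t^', `[0%R, 1%R]%classic s -> False := H.
  by move: H'; rewrite /dnbhs near_withinE; apply: filterS => s sH st; exact: sH.
have h0 : 0 < Num.min (d / 2) (1 / 2) by rewrite lt_min !divr_gt0.
have hd : Num.min (d / 2) (1 / 2) <= d / 2 by rewrite ge_min lexx.
have h1 : Num.min (d / 2) (1 / 2) <= 1 / 2 by rewrite ge_min lexx orbT.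
have [tl|tg] := leP t (1 / 2).
  apply: (dP (t + Num.min (d / 2) (1 / 2))).
  - by rewrite addrAC subrr add0r gtr0_norm//; lra.
  - by rewrite -subr_eq0 addrAC subrr add0r gt_eqF.
  - by rewrite in_itv/=; apply/andP; split; lra.
apply: (dP (t - Num.min (d / 2) (1 / 2))).
- by rewrite addrAC subrr add0r normrN gtr0_norm//; lra.
- by rewrite -subr_eq0 addrAC subrr add0r oppr_eq0 gt_eqF.
- by rewrite in_itv/=; apply/andP; split; lra.
Qed.

Lemma C1_on_apply_continuous (R : realType) (E F : normedModType R) (U : set E)
    (g : E -> F) (T : topologicalType) (A : set T) (p w : T -> E) t :
  C1_on U g -> U (p t) ->
  (forall W, nbhs (p t) W -> \forall s \near t, A s -> W (p s)) ->
  (forall W, nbhs (w t) W -> \forall s \near t, A s -> W (w s)) ->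
  forall W, nbhs ('d g (p t) (w t)) W ->
    \forall s \near t, A s -> W ('d g (p s) (w s)).
Proof.
move=> gU Up pc wc W /near_distP[e e0 We].
have [gp gC] := gU _ Up.
have [k k0 gk] := linear_lipschitz (diff_continuous gp).
pose e1 := e / 4 / (`|w t| + 1); pose e2 := Num.min 1 (e / 2 / k).
have e10 : 0 < e1 by rewrite !divr_gt0// ltr_wpDl.
have e20 : 0 < e2 by rewrite lt_min ltr01 !divr_gt0.
have w2 : nbhs (w t) [set v | `|v - w t| < e2] by apply/near_distP; exists e2.
apply: filterS2 (pc _ (gC _ e10)) (wc _ w2) => s ps ws As; apply: We.
have {}ps := ps As; have /= {}ws := ws As.
have -> : 'd g (p s) (w s) - 'd g (p t) (w t) =
    ('d g (p s) (w s) - 'd g (p t) (w s)) + 'd g (p t) (w s - w t).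
  by rewrite linearB /= addrA subrK.
rewrite (le_lt_trans (ler_normD _ _))//.
have h1 : `|w s| <= `|w t| + 1.
  rewrite -[w s](subrK (w t)) (le_trans (ler_normD _ _))// addrC lerD//.
  by rewrite (le_trans (ltW ws))// ge_min lexx.
have h2 : e1 * `|w s| <= e / 4.
  rewrite (le_trans (ler_wpM2l (ltW e10) h1))// /e1 divfK// gt_eqF//.
have h3 : k * `|w s - w t| < e / 2.
  rewrite mulrC -ltr_pdivlMr// (lt_le_trans ws)//.
  by rewrite ge_min lexx orbT.
have := ps (w s); have := gk (w s - w t); lra.
Qed.

Section paths.
Context {R : realType} {E : completeNormedModType R} {X : banach_manifold E}.
Implicit Types (a : R -> X) (c : chart X E) (t s : R).

Let I : set R := `[0, 1]%classic.

Lemma chart_derivE a c t v : 0 <= t <= 1 -> deriv_in I (fwd c \o a) t v ->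
  cvg ((fun s => (s - t)^-1 *: (fwd c (a s) - fwd c (a t)))
           @ within `[0, 1] t^') /\ chart_deriv c a t = v.
Proof.
move=> t01 /deriv_inP av; have P := within01_dnbhs_proper t01.
split; first exact: cvgP av.
exact: cvg_lim av.
Qed.

Lemma C1_path_deriv a c t : C1_path a -> 0 <= t <= 1 -> atlas c -> dom c (a t) ->
  deriv_in I (fwd c \o a) t (chart_deriv c a t).
Proof.
move=> [_ ad] t01 ac ca; have [|ac' _] := ad c t ac _ ca; first by rewrite in_itv.
exact/deriv_inP.
Qed.

Lemma C1_path_deriv_continuous a c t : C1_path a -> 0 <= t <= 1 -> atlas c ->
  dom c (a t) -> forall W, nbhs (chart_deriv c a t) W ->
  \forall s \near t, I s -> W (chart_deriv c a s).
Proof.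
move=> [_ ad] t01 ac ca W Wc; have [|_ ac'] := ad c t ac _ ca; first by rewrite in_itv.
have : \forall s \near within I (nbhs t), W (chart_deriv c a s) by exact: ac'.
by rewrite near_withinE.
Qed.

Lemma deriv_in_chart A a c c' t v : A t -> atlas c -> atlas c' ->
  dom c (a t) -> dom c' (a t) ->
  (\forall s \near t, A s -> dom c (a s)) ->
  deriv_in A (fwd c \o a) t v ->
  deriv_in A (fwd c' \o a) t ('d (chart_rep (@id X) c c') (fwd c (a t)) v).
Proof.
move=> At ac ac' ca c'a near_c av.
have d := chart_rep_differentiable C1_map_id ac ac' ca c'a.
have := deriv_in_diff av d; apply: deriv_in_near_eq_in => //.
by apply: filterS near_c => s cs As /=; rewrite chart_repE//; exact: cs.
Qed.

Lemma C1_path_near_dom a c t : C1_path a -> 0 <= t <= 1 -> atlas c ->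
  dom c (a t) -> \forall s \near t, I s -> dom c (a s).
Proof.
move=> [/within_continuousP ac _] t01 cc ca.
by apply: ac; [rewrite /= in_itv|exact: atlas_dom_nbhs].
Qed.

Lemma C1_path_chart_deriv a c c' t : C1_path a -> 0 <= t <= 1 ->
  atlas c -> atlas c' -> dom c (a t) -> dom c' (a t) ->
  chart_deriv c' a t =
  'd (chart_rep (@id X) c c') (fwd c (a t)) (chart_deriv c a t).
Proof.
move=> a1 t01 ac ac' ca c'a.
apply: (@chart_derivE a c' t _ t01 _).2.
apply: deriv_in_chart => //.
  exact: C1_path_near_dom.
exact: C1_path_deriv.
Qed.

Lemma C1_path_velocity a c t : C1_path a -> 0 <= t <= 1 -> atlas c ->
  dom c (a t) -> velocity a t = tvec c (a t) (chart_deriv c a t).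
Proof.
move=> a1 t01 ac ca; rewrite tvecE /velocity; have [b d] := chart_atP (a t).
exact: C1_path_chart_deriv.
Qed.

End paths.

Section admissible_paths.
Context {R : realType} {E : completeNormedModType R} {X : finsler_manifold E}.
Implicit Types (a : R -> X) (c : chart X E) (t s : R) (x y z : X).
Local Notation mu := (@lebesgue_measure R).

(* [g] bounds the Finsler speed of [a] near [t]. *)
Definition local_speed a (g : R -> R) t : Prop :=
  exists (c : chart X E) (w : R -> E), [/\ atlas c, {for t, continuous w} &
    \forall s \near t, [/\ dom c (a s), deriv_in setT (fwd c \o a) s (w s) &
       fnorm (tvec c (a s) (w s)) <= g s]].

(* Unlike the paths of [C1_path], these are smooth and constant outside [0, 1],
   so that they can be concatenated; [L] bounds the length. *)
Definition admissible x y (L : R) : Prop :=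
  exists (a : R -> X) (G g : R -> R),
  [/\ continuous a, forall t, t <= 0 -> a t = x, forall t, 1 <= t -> a t = y,
      forall t, local_speed a g t &
      [/\ continuous g, forall t, deriv_in setT G t (g t),
          forall t, t <= 0 -> G t = 0 & forall t, 1 <= t -> G t = L]].

Lemma local_speed_ge0 a g t : local_speed a g t -> 0 <= g t.
Proof.
by move=> [c [w [_ _ /nbhs_singleton[_ _]]]]; apply: le_trans; exact: fnorm_ge0.
Qed.

Lemma local_speed_le a b g h t : (\forall s \near t, a s = b s) ->
  (\forall s \near t, g s <= h s) -> local_speed a g t -> local_speed b h t.
Proof.
move=> ab gh [c [w [ac wc near_a]]]; exists c, w; split => //.
apply: filterS3 (near_join ab) gh near_a => s abs gs [cs ws fs].
have abs' := nbhs_singleton abs.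
rewrite -abs'; split => //; last exact: le_trans gs.
by apply: deriv_in_near_eq ws; apply: filterS abs => r /= ->.
Qed.

Lemma affine_continuous (k m : R) : continuous (fun s => k * s + m).
Proof. by move=> s; exact: deriv_in_continuous (deriv_in_affine k m s). Qed.

Lemma local_speed_affine a g k m t : local_speed a g (k * t + m) ->
  local_speed (fun s => a (k * s + m)) (fun s => `|k| * g (k * s + m)) t.
Proof.
move=> [c [w [ac wc near_a]]]; exists c, (fun s => k *: w (k * s + m)); split => //.
  apply: cvgZl_tmp; apply: (@continuous_compose _ _ _ (fun s => k * s + m) w t) => //.
  exact: affine_continuous.
have := continuous_near (@affine_continuous k m t) near_a.
apply: filterS => s [cs ws fs]; split => //.
  exact: (@deriv_in_comp R E setT (fwd c \o a) (fun s => k * s + m) s _ k _ ws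
    (deriv_in_affine k m s)).
by rewrite tvecZ fnormZ ler_wpM2l.
Qed.

Lemma admissible_sym x y L : admissible x y L -> admissible y x L.
Proof.
move=> [a [G [g [ac ax ay ag [gc Gg G0 G1]]]]].
exists (fun t => a (-1 * t + 1)), (fun t => L - G (-1 * t + 1)), (fun t => g (-1 * t + 1)).
split.
- by move=> t; apply: (@continuous_compose _ _ _ (fun s => -1 * s + 1) a t);
    [exact: affine_continuous|exact: ac].
- by move=> t t0; apply: ay; lra.
- by move=> t t1; apply: ax; lra.
- move=> t; have := local_speed_affine (ag (-1 * t + 1)); apply: local_speed_le.
    exact: filterE.
  by apply: filterE => s; rewrite normrN1 mul1r.
split.
- by move=> t; apply: (@continuous_compose _ _ _ (fun s => -1 * s + 1) g t);
    [exact: affine_continuous|exact: gc].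
- move=> t; have := @deriv_in_comp R R setT G (fun s => -1 * s + 1) t _ (-1) _
    (Gg (-1 * t + 1)) (deriv_in_affine (-1) 1 t).
  move=> /(_ (fun _ => Logic.I)) H.
  have := deriv_inD (@deriv_in_cst R R setT L t) (deriv_inN H).
  rewrite add0r scaleN1r opprK; exact.
- by move=> t t0; rewrite G1 ?subrr//; lra.
- by move=> t t1; rewrite G0 ?subr0//; lra.
Qed.

Lemma admissible_trans x y z L M :
  admissible x y L -> admissible y z M -> admissible x z (L + M).
Proof.
move=> [a [G [g [ac ax ay ag [gc Gg G0 G1]]]]] [b [H [h [bc bx by_ bh [hc Hh H0 H1]]]]].
(* The first path runs during [0, 1/4] and the second during [3/4, 1], with a rest at [y] in
   between; near every time the concatenation is thus one of the two pieces. *)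
pose u t := a (4 * t + 0); pose v t := b (4 * t + (-3)).
pose q t := if t <= 1 / 2 then u t else v t.
have uq t : t < 3 / 4 -> \forall s \near t, u s = q s.
  move=> t1; apply/near_distP; exists (3 / 4 - t); first by rewrite subr_gt0.
  move=> s; rewrite ltr_norml => /andP[_ st]; rewrite /q; case: leP => // s2.
  by rewrite /u /v ay ?bx//; lra.
have vq t : 1 / 4 < t -> \forall s \near t, v s = q s.
  move=> t1; apply/near_distP; exists (t - 1 / 4); first by rewrite subr_gt0.
  move=> s; rewrite ltr_norml => /andP[st _]; rewrite /q; case: leP => // s2.
  by rewrite /u /v ay ?bx//; lra.
have g_ge0 t : 0 <= g t by exact: local_speed_ge0 (ag t).
have h_ge0 t : 0 <= h t by exact: local_speed_ge0 (bh t).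
have split2 t : t < 3 / 4 \/ 1 / 4 < t by have [|] := ltP t (3 / 4); [left|right; lra].
exists q, (fun t => G (4 * t + 0) + H (4 * t + (-3))),
  (fun t => 4 * g (4 * t + 0) + 4 * h (4 * t + (-3))); split.
- move=> t; have [t1|t1] := split2 t.
    apply: near_eq_continuous (uq _ t1) _.
    by apply: (@continuous_compose _ _ _ (fun s => 4 * s + 0) a t);
      [exact: affine_continuous|exact: ac].
  apply: near_eq_continuous (vq _ t1) _.
  by apply: (@continuous_compose _ _ _ (fun s => 4 * s + (-3)) b t);
    [exact: affine_continuous|exact: bc].
- by move=> t t0; rewrite /q ifT; [apply: ax|]; lra.
- by move=> t t0; rewrite /q ifF; [apply: by_|apply/negbTE; rewrite -ltNge]; lra.
- move=> t; have [t1|t1] := split2 t.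
    have := local_speed_affine (ag (4 * t + 0)).
    apply: local_speed_le (uq _ t1) _; apply: filterE => s.
    by rewrite ger0_norm// lerDl mulr_ge0.
  have := local_speed_affine (bh (4 * t + (-3))).
  apply: local_speed_le (vq _ t1) _; apply: filterE => s.
  by rewrite ger0_norm// lerDr mulr_ge0.
split.
- move=> t; apply: cvgD; apply: cvgMl_tmp.
    by apply: (@continuous_compose _ _ _ (fun s => 4 * s + 0) g t);
      [exact: affine_continuous|exact: gc].
  by apply: (@continuous_compose _ _ _ (fun s => 4 * s + (-3)) h t);
    [exact: affine_continuous|exact: hc].
- move=> t; apply: deriv_inD.
    exact: (@deriv_in_comp R R setT G (fun s => 4 * s + 0) t _ 4 _
      (Gg (4 * t + 0)) (deriv_in_affine 4 0 t)).
  exact: (@deriv_in_comp R R setT H (fun s => 4 * s + (-3)) t _ 4 _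
      (Hh (4 * t + (-3))) (deriv_in_affine 4 (-3) t)).
- by move=> t t0; rewrite G0 ?H0 ?addr0//; lra.
- by move=> t t0; rewrite G1 ?H1//; lra.
Qed.

Lemma C1_path_speed_continuous a : C1_path a ->
  {within `[0, 1], continuous (fun t => fnorm (velocity a t))}.
Proof.
move=> a1; apply/within_continuousP => t /=; rewrite in_itv/= => t01 W.
have [ac ca] := chart_atP (a t); set c := chart_at (a t) in ac ca *.
rewrite (C1_path_velocity a1 t01 ac ca) => Wt.
have /within_continuousP fc := fnorm_continuous ac.
have [[A B] /= [Aa Bw] AB] := fc (a t, chart_deriv c a t) (conj ca Logic.I) W Wt.
have /within_continuousP acont := a1.1.
have i01 : `[0%R, 1%R]%classic t by rewrite /= in_itv.
have hA : \forall s \near t, `[0%R, 1%R]%classic s -> (A `&` dom c) (a s).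
  by apply: acont i01 _ _; apply: filterI => //; exact: atlas_dom_nbhs.
have hB := C1_path_deriv_continuous a1 t01 ac ca Bw.
apply: filterS2 hA hB => s hA hB; rewrite in_itv/= => s01.
have i01s : `[0%R, 1%R]%classic s by rewrite /= in_itv.
have [As cs] := hA i01s.
rewrite (C1_path_velocity a1 s01 ac cs).
by apply: (AB (a s, chart_deriv c a s)) => //=; split => //; exact: hB.
Qed.

Lemma fdist_lb x y : has_lbound [set path_length a | a in
         [set a : R -> X | [/\ C1_path a, a 0 = x & a 1 = y]]].
Proof.
by exists 0 => _ [a _ <-]; apply: Rintegral_ge0 => t _; exact: fnorm_ge0.
Qed.

Lemma admissible_C1_path x y L : admissible x y L ->
  exists a : R -> X, [/\ C1_path a, a 0 = x, a 1 = y & path_length a <= L].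
Proof.
move=> [a [G [g [ac ax ay ag [gc Gg G0 G1]]]]]; exists a.
(* [local_speed] provides one chart, [C1_path] asks for all of them: the derivative is carried over
   by the differential of the transition map. *)
have chartP t c : 0 <= t <= 1 -> atlas c -> dom c (a t) ->
    exists v : R -> E, [/\ {for t, continuous v}, 
      \forall s \near t, 0 <= s <= 1 ->
        deriv_in `[0%R, 1%R]%classic (fwd c \o a) s (v s) &
      fnorm (tvec c (a t) (v t)) <= g t].
  move=> t01 cc ca; have [c1 [w [ac1 wc near_a]]] := ag t.
  have [c1a _ speed] := nbhs_singleton near_a.
  exists (fun s => 'd (chart_rep (@id X) c1 c) (fwd c1 (a s)) (w s)); split.
  - move=> W Wt; have := @C1_on_apply_continuous R E E _ _ R setT
      (fun s => fwd c1 (a s)) w t (C1_map_id.2 c1 c ac1 cc) _ _ _ W Wt.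
    move=> H; apply: filterS (H _ _ _); first by move=> s; exact.
    + by exists (a t).
    + move=> W' W't; have : {for t, continuous (fun s => fwd c1 (a s))}.
        apply: (@continuous_compose _ _ _ a (fwd c1) t); first exact: ac.
        exact: atlas_fwd_continuous.
      by move=> /continuous_near/(_ W't); exact: filterS.
    + by move=> W' W't; apply: filterS (continuous_near wc W't).
  - have c_near : \forall s \near t, dom c (a s).
      exact: (continuous_near (ac t) (atlas_dom_nbhs cc ca)).
    apply: filterS3 c_near near_a (near_join near_a) => s cs [c1s ws _] near_s s01.
    apply: deriv_in_chart => //.
    + by apply: filterS near_s => r [].
    + by apply: deriv_in_subset ws.
  - by rewrite tvec_transition.
have a1 : C1_path a.
  split; first exact: continuous_subspaceT.
  move=> c t cc; rewrite in_itv/= => t01 ca.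
  have [v [vc near_v _]] := chartP t c t01 cc ca.
  have [? ->] := chart_derivE t01 (nbhs_singleton near_v t01).
  split => // W Wv.
  suff : \forall s \near within `[0, 1]%classic (nbhs t), W (chart_deriv c a s) by [].
  rewrite near_withinE; apply: filterS2 near_v (continuous_near vc Wv) => s + Ws.
  by move=> sv; rewrite /= in_itv/= => s01; have [_ ->] := chart_derivE s01 (sv s01).
split => //; [exact: ax|exact: ay|].
have -> : L = \int[mu]_(t in `[0, 1]) g t.
  by rewrite (@Rintegral01_deriv R g G)// (G0 0 (lexx 0)) (G1 1 (lexx 1)) subr0.
apply: le_Rintegral => //.
- apply: continuous_compact_integrable; first exact: segment_compact.
  exact: C1_path_speed_continuous.
- apply: continuous_compact_integrable; first exact: segment_compact.
  exact: continuous_subspaceT.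
- move=> t; rewrite /= in_itv/= => t01; have [cc ca] := chart_atP (a t).
  rewrite (C1_path_velocity a1 t01 cc ca).
  have [v [_ near_v]] := chartP t _ t01 cc ca.
  by have [_ ->] := chart_derivE t01 (nbhs_singleton near_v t01).
Qed.

Lemma fdist_le_admissible x y L : admissible x y L -> fdist x y <= L.
Proof.
move=> /admissible_C1_path[a [a1 a0 aE aL]]; apply: le_trans aL.
by apply: ge_inf; [exact: fdist_lb|exists a].
Qed.

(** Running the path through [smoothstep] keeps its length: with [H] a primitive of the speed, the
    length function is [H] after [smoothstep], up to a constant. *)
Lemma C1_path_admissible a : C1_path a -> admissible (a 0) (a 1) (path_length a).
Proof.
move=> a1; pose sg t := fnorm (velocity a (clamp01 t)).
have sgc : continuous sg.
  apply: (@continuous_within_comp R R R _ _ (@clamp01 R) (C1_path_speed_continuous a1)).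
    by move=> t; rewrite /= in_itv/= clamp01_bounds.
  exact: clamp01_continuous.
have [H Hsg] := primitive_of_continuous sgc.
have Hlen : path_length a = H 1 - H 0.
  rewrite -(Rintegral01_deriv sgc Hsg) /path_length; apply: eq_Rintegral => t.
  by rewrite inE/= in_itv/= => t01; rewrite /sg clamp01_id.
have pb t : 0 <= smoothstep t <= 1 by exact: smoothstep_bounds.
have pi t : `[0%R, 1%R]%classic (smoothstep t) by rewrite /= in_itv/= pb.
have pc t : {for t, continuous (@smoothstep R)}.
  exact: deriv_in_continuous (smoothstep_deriv t).
have p0 t : t <= 0 -> smoothstep t = 0 by exact: smoothstep_le0.
have p1 t : 1 <= t -> smoothstep t = 1 by exact: smoothstep_ge1.
have sp (t : R) : 0 <= t <= 1 -> sg t = fnorm (velocity a t).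
  by move=> t01; rewrite /sg clamp01_id.
pose al t := a (smoothstep t).
have alc : continuous al.
  exact: (@continuous_within_comp R X R _ a (@smoothstep R) a1.1 pi pc).
exists al, (fun t => H (smoothstep t) + - H 0), (fun t => smoothstep' t * sg (smoothstep t)).
split.
- exact: alc.
- by move=> t t0; rewrite /al p0.
- by move=> t t0; rewrite /al p1.
- move=> t; have [ac ca] := chart_atP (al t); set c := chart_at (al t) in ac ca *.
  exists c, (fun s => smoothstep' s *: chart_deriv c a (smoothstep s)); split => //.
    apply: cvgZ; first exact: smoothstep'_continuous.
    move=> W Wc; suff : \forall s \near t, W (chart_deriv c a (smoothstep s)) by [].
    have := continuous_near (pc t) (C1_path_deriv_continuous a1 (pb t) ac ca Wc).
    by apply: filterS => s; exact.
  have := continuous_near (alc t) (atlas_dom_nbhs ac ca).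
  apply: filterS => s cs; split => //.
    exact: (deriv_in_comp pi (C1_path_deriv a1 (pb s) ac cs) (smoothstep_deriv s)).
  rewrite tvecZ fnormZ ger0_norm ?smoothstep'_ge0// sp//.
  by rewrite (C1_path_velocity a1 (pb s) ac cs).
split.
- move=> t; apply: cvgM; first exact: smoothstep'_continuous.
  by apply: (@continuous_compose _ _ _ (@smoothstep R) sg t); [exact: pc|exact: sgc].
- move=> t; rewrite -[X in deriv_in _ _ _ X]addr0; apply: deriv_inD; last exact: deriv_in_cst.
  apply: (@deriv_in_comp R R setT H (@smoothstep R) t _ _ _ _ (smoothstep_deriv t)) => //.
  exact: Hsg.
- by move=> t t0; rewrite p0// subrr.
- by move=> t t0; rewrite p1// Hlen.
Qed.

(** The given path makes the set of lengths nonempty; otherwise its infimum would be the default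
    value 0 and no path would approximate it. *)
Lemma admissible_fdist x y L0 (e : R) : admissible x y L0 -> 0 < e ->
  exists2 L, L < fdist x y + e & admissible x y L.
Proof.
move=> /admissible_C1_path[a0 [a01 a00 a0E _]] e0.
have [|_ [a [a1 ax ay] <-] aL] := @inf_adherent R [set path_length a | a in
         [set a : R -> X | [/\ C1_path a, a 0 = x & a 1 = y]]] e e0.
  by split; [exists (path_length a0), a0|exact: fdist_lb].
by exists (path_length a) => //; rewrite -ax -ay; exact: C1_path_admissible.
Qed.

Lemma fdist_ge0 x y : 0 <= fdist x y.
Proof.
rewrite /fdist; set S := [set _ | _ in _].
have [->|/set0P S0] := eqVneq S set0; first by rewrite inf0.
by apply: lb_le_inf => // _ [a _ <-]; apply: Rintegral_ge0 => t _; exact: fnorm_ge0.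
Qed.

Lemma segment_admissible c x y K : atlas c -> dom c x -> dom c y ->
  (forall t, 0 <= t <= 1 -> (fwd c @` dom c) (fwd c x + t *: (fwd c y - fwd c x))) ->
  (forall z, dom c z -> fnorm (tvec c z (fwd c y - fwd c x)) <= K) ->
  admissible x y K.
Proof.
move=> ac cx cy seg speed; set d := fwd c y - fwd c x in seg speed *.
pose p s : E := fwd c x + smoothstep s *: d; pose a s := bwd c (p s).
have pi s : (fwd c @` dom c) (p s) by apply: seg; exact: smoothstep_bounds.
have ca s : dom c (a s) /\ fwd c (a s) = p s.
  by rewrite /a; have [z cz <-] := pi s; rewrite atlas_bwdK.
have pd s : deriv_in setT p s (smoothstep' s *: d).
  rewrite -[X in deriv_in _ _ _ X]add0r; apply: deriv_inD; first exact: deriv_in_cst.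
  exact: deriv_inZ (smoothstep_deriv s).
exists a, (fun s => smoothstep s * K), (fun s => smoothstep' s * K); split.
- move=> s; apply: (@continuous_compose _ _ _ p (bwd c) s).
    exact: deriv_in_continuous (pd s).
  by have [? <-] := ca s; exact: atlas_bwd_continuous.
- by move=> t t0; rewrite /a /p smoothstep_le0// scale0r addr0 atlas_bwdK.
- by move=> t t1; rewrite /a /p smoothstep_ge1// scale1r addrC subrK atlas_bwdK.
- move=> t; exists c, (fun s => smoothstep' s *: d); split => //.
    by apply: cvgZr_tmp; exact: smoothstep'_continuous.
  apply: filterE => s; have [cs cE] := ca s; split => //.
    apply: deriv_in_near_eq (pd s); apply: filterE => r /=.
    by have [_ ->] := ca r.
  by rewrite tvecZ fnormZ ger0_norm ?smoothstep'_ge0// ler_wpM2l ?smoothstep'_ge0// speed.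
split.
- by move=> t; apply: cvgMr_tmp; exact: smoothstep'_continuous.
- by move=> t; exact: deriv_inZ (smoothstep_deriv t).
- by move=> t t0; rewrite smoothstep_le0// mul0r.
- by move=> t t1; rewrite smoothstep_ge1// mul1r.
Qed.

Lemma local_speed_chart a g c t : continuous a -> local_speed a g t ->
  atlas c -> dom c (a t) ->
  exists2 v, deriv_in setT (fwd c \o a) t v & fnorm (tvec c (a t) v) <= g t.
Proof.
move=> acont [c1 [w [ac1 _ near_a]]] ac ca.
have [c1a wt speed] := nbhs_singleton near_a.
exists ('d (chart_rep (@id X) c1 c) (fwd c1 (a t)) (w t)).
  by apply: deriv_in_chart => //; apply: filterS near_a => s [].
by rewrite tvec_transition.
Qed.

(** The difference of the two sides has right slopes at most [e1], because [cA] bounds [A] times the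
    coordinate speed by [g t]. Dividing [e] by [1 + (s' - s)] also covers [s = s']. *)
Lemma chart_displacement_le a (G g : R -> R) c (A : R) s s' :
  continuous a -> (forall t, local_speed a g t) ->
  (forall t, deriv_in setT G t (g t)) -> atlas c -> 0 < A -> s <= s' ->
  (forall r, s <= r <= s' -> dom c (a r)) ->
  (forall z w, dom c z -> A * `|w| <= fnorm (tvec c z w)) ->
  A * `|fwd c (a s') - fwd c (a s)| <= G s' - G s.
Proof.
move=> acont ag Gg ac A0 ss' ca cA.
have Gc t : {for t, continuous G} by exact: deriv_in_continuous (Gg t).
have cac t : s <= t <= s' -> {for t, continuous (fun r => fwd c (a r))}.
  move=> st; apply: (@continuous_compose _ _ _ a (fwd c) t); first exact: acont.
  by apply: atlas_fwd_continuous => //; exact: ca.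
apply/ler_addgt0Pr => e e0; pose e1 := e / (1 + (s' - s)).
have e1s : 0 < 1 + (s' - s) by rewrite ltr_wpDr ?subr_ge0.
have e10 : 0 < e1 by rewrite divr_gt0.
have e1e : e1 * (s' - s) <= e by rewrite /e1 mulrAC ler_pdivrMr// ler_wpM2l ?(ltW e0)//; lra.
have := @le_of_local_slope R (fun t => A * `|fwd c (a t) - fwd c (a s)| - G t) s s' e1 ss'.
rewrite subrr normr0 mulr0 => H.
suff : A * `|fwd c (a s') - fwd c (a s)| - G s' - (0 - G s) <= e1 * (s' - s) by lra.
apply: H => [t st|t /andP[st ts']].
  apply: cvgB; last exact: Gc.
  apply: cvgMl_tmp; apply: cvg_norm; apply: cvgB; last exact: cvg_cst.
  exact: cac.
have cat : dom c (a t) by apply: ca; rewrite st ltW.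
have [v cv vg] := local_speed_chart acont (ag t) ac cat.
have eA : 0 < e1 / 2 / A by rewrite !divr_gt0.
have e12 : 0 < e1 / 2 by rewrite divr_gt0.
have /near_distP[d d0 cd] := cv _ eA.
have /near_distP[d' d'0 Gd] := Gg t _ e12.
exists (Num.min d d'); first by rewrite lt_min d0.
move=> r /andP[tr rd] _; have r0 : 0 < r - t by rewrite subr_gt0.
have [rd1 rd2] : r - t < d /\ r - t < d'.
  by apply/andP; rewrite -lt_min ltrBlDl.
have := cd r; rewrite gtr0_norm// => /(_ rd1 Logic.I) /= c1.
have := Gd r; rewrite gtr0_norm// => /(_ rd2 Logic.I).
rewrite /GRing.scale/= ler_norml => /andP[G1 _].
have vA : A * `|v| <= g t by rewrite (le_trans (cA _ _ cat)).
have h1 : `|fwd c (a r) - fwd c (a t)| <= (r - t) * `|v| + e1 / 2 / A * (r - t).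
  rewrite -[_ - _](subrK ((r - t) *: v)) (le_trans (ler_normD _ _))//.
  by rewrite normrZ gtr0_norm// addrC lerD2l.
have h2 : A * `|fwd c (a r) - fwd c (a t)| <= (r - t) * g t + e1 / 2 * (r - t).
  rewrite (le_trans (ler_wpM2l (ltW A0) h1))// mulrDr mulrCA lerD//.
    by rewrite ler_wpM2l// ltW.
  rewrite le_eqVlt; apply/orP; left; apply/eqP; field.
  by rewrite gt_eqF.
have h3 := ler_wpM2l (ltW A0) (ler_distD (fwd c (a t)) (fwd c (a r)) (fwd c (a s))).
rewrite mulrDr in h3; lra.
Qed.

End admissible_paths.

(** * The Finsler distance *)

Section finsler_topology.
Context {R : realType} {E : completeNormedModType R} {X : finsler_manifold E}.
Implicit Types (c : chart X E) (x y z : X) (t s : R).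

Lemma finsler_hausdorff : hausdorff_space X.
Proof. by have [] := carrier_paracompact X. Qed.

(** A coordinate ball is convex, so coordinate segments between its points stay in the chart; their
    length is compared with the norm at [x0]. *)
Lemma local_admissible x0 (k : R) : 1 < k -> exists (c : chart X E) (a b : R) (N : set X),
  [/\ atlas c /\ dom c x0, 0 < a /\ 0 < b, nbhs x0 N /\ N `<=` dom c,
    forall x w, dom c x -> a * `|w| <= fnorm (tvec c x w) <= b * `|w| &
    forall p q, N p -> N q ->
      admissible p q (k * fnorm (tvec c x0 (fwd c q - fwd c p)))].
Proof.
move=> k1; have [c [a [b [ac cx0 a0 b0 cab]]]] := finsler_chart x0 k1.
have /near_distP[r r0 rc] := atlas_image_nbhs ac cx0.
exists c, a, b, (dom c `&` [set p | `|fwd c p - fwd c x0| < r]); split => //.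
- split; last by move=> p [].
  apply: filterI; first exact: atlas_dom_nbhs.
  apply: (continuous_near (W := [set q | `|q - fwd c x0| < r]) (atlas_fwd_continuous ac cx0)).
  by apply/near_distP; exists r.
- by move=> x w cx; have [] := cab x w cx.
- move=> p q [cp pr] [cq qr]; apply: (segment_admissible ac cp cq).
    by move=> t t01; apply: rc; exact: segment_in_ball.
  by move=> z cz; have [_ + _] := cab z (fwd c q - fwd c p) cz.
Qed.

(** Nearby points are joined by coordinate segments, so the set of points reachable from [x] is both
    open and closed. *)
Lemma admissible_connected : connected [set: X] ->
  forall x y, exists L, admissible x y L.
Proof.
move=> Xc x.
have nbhd z : exists2 N, nbhs z N & forall p q, N p -> N q -> exists L, admissible p q L.
  have [c [a [b [N [_ _ [Nz _] _ adm]]]]] := @local_admissible z 2 (ltr1n _ 2).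
  by exists N => // p q Np Nq; exists (2 * fnorm (tvec c z (fwd c q - fwd c p))); exact: adm.
pose S := [set y | exists L, admissible x y L].
suff SE : S = setT by move=> y; have : S y by rewrite SE.
apply: Xc.
- have [N Nx adm] := nbhd x; exists x; apply: adm; exact: nbhs_singleton.
- exists S; last by rewrite setTI.
  rewrite openE => y [L xy]; have [N Ny adm] := nbhd y.
  rewrite /interior; move: (Ny); apply: filterS => z Nz; have [M yz] := adm y z (nbhs_singleton Ny) Nz.
  by exists (L + M); exact: admissible_trans xy yz.
- exists S; last by rewrite setTI.
  move=> z Sz; have [N Nz adm] := nbhd z; have [y [[L xy] Ny]] := Sz _ Nz.
  have [M yz] := adm y z Ny (nbhs_singleton Nz).
  by exists (L + M); exact: admissible_trans xy yz.
Qed.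

(* A short admissible path cannot leave a chart ball: its coordinates converge
   at the first exit time because the chart length is finite, and the limit is
   interior. *)
Lemma short_admissible_nbhs x0 (W : set X) : nbhs x0 W ->
  exists2 d : R, 0 < d & forall y L, admissible x0 y L -> L < d -> W y.
Proof.
move=> Wx0; have [c [A [b [N [[ac cx0] [A0 b0] _ cab _]]]]] := @local_admissible x0 2 (ltr1n _ 2).
have cA z w : dom c z -> A * `|w| <= fnorm (tvec c z w).
  by move=> cz; have /andP[] := cab z w cz.
have /near_distP[r r0 rW] := atlas_fwd_image_nbhs ac cx0 Wx0.
(* Length [L] moves the coordinates by at most [L / A], so [L < A * r] keeps the path in a
   coordinate ball whose points come from [W]. *)
exists (A * r); first by rewrite mulr_gt0.
move=> y L [a [G [g [acont ax ay ag [gc Gg G0 G1]]]]] LAr.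
have Gc t : {for t, continuous G} by exact: deriv_in_continuous (Gg t).
have Gmono s t : s <= t -> G s <= G t.
  move=> st; have g0 u : 0 <= g u by exact: local_speed_ge0 (ag u).
  rewrite -subr_ge0; have := @le_of_local_slope R (fun u => - G u) s t 0 st.
  rewrite mul0r => H; suff : - G t - (- G s) <= 0 by lra.
  apply/ler_addgt0Pr => e e0; rewrite add0r.
  have e10 : 0 < e / (1 + (t - s)) by rewrite divr_gt0// ltr_wpDr ?subr_ge0.
  have := @le_of_local_slope R (fun u => - G u) s t _ st (fun u _ => cvgN (Gc u)).
  move=> /(_ (e / (1 + (t - s)))) H'.
  apply: (@le_trans _ _ (e / (1 + (t - s)) * (t - s))); last first.
    by rewrite mulrAC ler_pdivrMr ?ltr_wpDr ?subr_ge0// ler_wpM2l ?(ltW e0)//; lra.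
  apply: H' => u _; have /near_distP[d d0 Gd] := Gg u _ e10.
  exists d => // v /andP[uv vd] _; have v0 : 0 < v - u by rewrite subr_gt0.
  have := Gd v; rewrite gtr0_norm// ltrBlDl => /(_ vd Logic.I).
  rewrite /GRing.scale/= ler_norml => /andP[+ _].
  by have := mulr_ge0 (ltW v0) (g0 u); lra.
have disp s t : s <= t -> (forall u, s <= u <= t -> dom c (a u)) ->
    A * `|fwd c (a t) - fwd c (a s)| <= G t - G s.
  by move=> st cu; exact: (chart_displacement_le acont ag Gg ac A0 st cu cA).
have a00 : a 0 = x0 by exact: ax.
have G00 : G 0 = 0 by exact: G0.
have inball t : 0 <= t <= 1 -> (forall u, 0 <= u <= t -> dom c (a u)) ->
    A * `|fwd c (a t) - fwd c x0| <= L.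
  move=> /andP[t0 t1] cu; rewrite -a00 (le_trans (disp _ _ t0 cu))// G00 subr0.
  by rewrite -(G1 1 (lexx 1)) Gmono.
have doma : forall t, 0 <= t <= 1 -> dom c (a t).
  apply: real_induction; first by rewrite a00.
    move=> t /andP[t0 t1] IH.
    have /near_distP[d d0 cd] :=
      continuous_near (acont t) (atlas_dom_nbhs ac (IH t (introT andP (conj t0 (lexx t))))).
    exists d => // s /andP[ts sd] _; apply: cd.
    by rewrite gtr0_norm ?subr_gt0//; lra.
  move=> t /andP[t0 t1] IH.
  have cvgc : cvg (fwd c (a u) @[u --> t^'-]).
    apply: cauchy_cvg; apply: cauchy_exP => e e0.
    have Ae : 0 < A * e by rewrite mulr_gt0.
    have /near_distP[d d0 Gd] : \forall u \near t, `|G t - G u| < A * e.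
      by move/cvgrPdist_lt : (Gc t); apply.
    pose s := Num.max 0 (t - d / 2).
    have st : s < t by rewrite gt_max t0; lra.
    have ds : t - d / 2 <= s by rewrite le_max lexx orbT.
    have s0 : 0 <= s by rewrite le_max lexx.
    exists (fwd c (a s)).
    suff : \forall u \near t^'-, ball (fwd c (a s)) e (fwd c (a u)) by [].
    apply/near_leftP; exists (t - s); first by rewrite subr_gt0.
    move=> u; rewrite opprB addrCA subrr addr0 => /andP[su ut].
    rewrite -ball_normE /= distrC -(ltr_pM2l A0).
    have := disp s u (ltW su) _.
    have cu v : s <= v <= u -> dom c (a v).
      by move=> /andP[sv vu]; apply: IH; rewrite (le_trans s0 sv) (le_lt_trans vu ut).
    move=> /(_ cu) /le_lt_trans; apply.
    have := Gd s; rewrite ltr0_norm ?subr_lt0// => /(_ ltac:(lra)).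
    have := Gmono _ _ (ltW ut); have := Gmono _ _ (ltW st).
    by move=> h1 h2; rewrite ger0_norm ?subr_ge0//; lra.
  set e := lim (fwd c (a u) @[u --> t^'-]) in cvgc.
  have {}cvgc : fwd c (a u) @[u --> t^'-] --> e by exact: cvgc.
  have near_L : \forall u \near t^'-, A * `|fwd c (a u) - fwd c x0| <= L.
    apply/near_leftP; exists t => // u; rewrite subrr => /andP[u0 ut].
    apply: inball; first by rewrite (ltW u0) (le_trans (ltW ut)).
    by move=> v /andP[v0 vu]; apply: IH; rewrite v0 (le_lt_trans vu).
  have eL : A * `|e - fwd c x0| <= L.
    have : A * `|fwd c (a u) - fwd c x0| @[u --> t^'-] --> A * `|e - fwd c x0|.
      by apply: cvgMl_tmp; apply: cvg_norm; apply: cvgB => //; exact: cvg_cst.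
    exact: (closed_cvg (fun v => v <= L) (@closed_le R L) near_L).
  have [|z [cz Wz] ze] := rW e.
    by rewrite -(ltr_pM2l A0) (le_lt_trans eL).
  have az : a u @[u --> t^'-] --> z.
    have bc : bwd c (fwd c (a u)) @[u --> t^'-] --> z.
      move=> V Vz; have bz : {for e, continuous (bwd c)}.
        by rewrite -ze; exact: atlas_bwd_continuous.
      by apply: (cvgc _ (bz V _)); rewrite -ze atlas_bwdK.
    apply: cvg_trans bc; apply: near_eq_cvg.
    apply/near_leftP; exists t => // u; rewrite subrr => /andP[u0 ut].
    by rewrite atlas_bwdK//; apply: IH; rewrite (ltW u0).
  have at_ : a u @[u --> t^'-] --> a t by apply: cvg_at_left_filter; exact: acont.
  by rewrite (cvg_unique finsler_hausdorff at_ az).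
have [|z [cz Wz] za] := rW (fwd c (a 1)).
  rewrite -(ltr_pM2l A0) (le_lt_trans _ LAr)// inball ?ler01 ?lexx//.
have c1 : dom c (a 1) by apply: doma; rewrite ler01 lexx.
rewrite -(ay 1 (lexx 1)) -(atlas_bwdK ac c1) -za atlas_bwdK//.
Qed.

End finsler_topology.

Section finsler_metric.
Context {R : realType} {E : completeNormedModType R} {X : finsler_manifold E}.
Hypothesis X_connected : connected [set: X].
Implicit Types (x y z : X).

Lemma fdist_approx x y (e : R) : 0 < e ->
  exists2 L, L < fdist x y + e & admissible x y L.
Proof.
by move=> e0; have [L0 xy] := admissible_connected X_connected x y;
   exact: admissible_fdist xy e0.
Qed.

Lemma fdist_triangle x y z : fdist x z <= fdist x y + fdist y z.
Proof.
apply/ler_addgt0Pr => e e0; have e2 : 0 < e / 2 by rewrite divr_gt0.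
have [L Ld xy] := fdist_approx x y e2; have [M Md yz] := fdist_approx y z e2.
have := fdist_le_admissible (admissible_trans xy yz); lra.
Qed.

Lemma fdist_sym x y : fdist x y = fdist y x.
Proof.
have H (u v : X) : fdist u v <= fdist v u.
  apply/ler_addgt0Pr => e e0; have [L Ld vu] := fdist_approx v u e0.
  by rewrite (le_trans (fdist_le_admissible (admissible_sym vu)))// ltW.
by apply/eqP; rewrite eq_le !H.
Qed.

(** The direction that turns a limit for [fdist], as completeness gives it, into a limit in the
    topology of the manifold. *)
Lemma fdist_nbhs x (W : set X) : nbhs x W ->
  exists2 d : R, 0 < d & forall y, fdist x y < d -> W y.
Proof.
move=> /short_admissible_nbhs[d d0 Wd]; exists d => // y xyd.
have e0 : 0 < d - fdist x y by rewrite subr_gt0.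
have [L Ld xy] := fdist_approx x y e0; apply: (Wd y L xy).
by move: Ld; rewrite addrC subrK.
Qed.

Lemma connected_paths x x' :
  exists a : R -> X, [/\ continuous a, a 0 = x & a 1 = x'].
Proof.
have [L [a [G [g [ac ax ay _ _]]]]] := admissible_connected X_connected x x'.
by exists a; split; [exact: ac|exact: ax|exact: ay].
Qed.

End finsler_metric.

(** * Maps expanding the Finsler norms *)

Section expanding_maps.
Context {R : realType} {E F : completeNormedModType R}
  {X : finsler_manifold E} {Y : finsler_manifold F} (f : X -> Y).
Hypothesis f1 : C1_map f.
Implicit Types (x : X).

Definition expands_at x (m : R) : Prop :=
  [/\ 0 < m, forall v : tangent x, m * fnorm v <= fnorm (tdiff f x v) &
      forall w, exists v, tdiff f x v = w].

Lemma expands_at_chart_rep x m (c : chart X E) (c' : chart Y F) : expands_at x m ->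
  atlas c -> atlas c' -> dom c x -> dom c' (f x) ->
  exists k, expanding_bijection ('d (chart_rep f c c') (fwd c x)) k.
Proof.
move=> [m0 mf fsurj] ac ac' cx c'fx; set D := 'd _ _.
have [a [b [a0 b0 ab]]] := fnorm_equiv ac cx.
have [a' [b' [a'0 b'0 ab']]] := fnorm_equiv ac' c'fx.
exists (m * a / b'); split; first by rewrite divr_gt0 ?mulr_gt0.
- move=> v; rewrite mulrAC ler_pdivrMr//.
  have /andP[h1 _] := ab v; have := mf (tvec c x v).
  rewrite (tdiff_tvec v f1 ac ac' cx c'fx) -/D => h2.
  have /andP[_ h3] := ab' (D v).
  rewrite mulrC in h3; apply: le_trans h3; apply: le_trans h2.
  by rewrite -mulrA ler_pM2l.
- move=> w; have [v0 v0w] := fsurj (tvec c' (f x) w).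
  have [v vv0] := tvec_surj v0 ac cx; exists v.
  have := tdiff_tvec v f1 ac ac' cx c'fx; rewrite vv0 v0w -/D => e.
  apply/eqP; rewrite -subr_eq0 -normr_le0 -(ler_pM2l a'0) mulr0.
  have /andP[h _] := ab' (D v - w); rewrite (le_trans h)// tvecB e subrr.
  by rewrite (seminorm0 (fnorm_seminorm _)).
Qed.

Lemma expanding_local_homeomorphism :
  (forall x, exists m, expands_at x m) -> local_homeomorphism f.
Proof.
move=> fexp; have [fcont frep] := f1.
have loc x : exists (c : chart X E) (c' : chart Y F) (k r : R),
  [/\ [/\ atlas c, atlas c', dom c x & dom c' (f x)], 0 < k, 0 < r,
    forall u v, `|u - fwd c x| < r -> `|v - fwd c x| < r ->
       k * `|u - v| <= `|chart_rep f c c' u - chart_rep f c c' v| &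
    forall s y, 0 < s -> s < r -> `|y - chart_rep f c c' (fwd c x)| <= k * s ->
      exists u, `|u - fwd c x| <= s /\ chart_rep f c c' u = y].
  have [m fm] := fexp x.
  have [ac cx] := chart_atP x; have [ac' c'x] := chart_atP (f x).
  exists (chart_at x), (chart_at (f x)).
  have [k kb] := expands_at_chart_rep fm ac ac' cx c'x.
  have xU : (fwd (chart_at x) @` (dom (chart_at x) `&` f @^-1` dom (chart_at (f x))))
      (fwd (chart_at x) x) by exists x.
  have [r [r0 rinj rsurj]] := local_inverse (chart_rep_domain_open f1 ac ac')
    (frep _ _ ac ac') xU kb.
  exists (k / 2), r; split => //.
  by case: kb => k0 _ _; rewrite divr_gt0.
split => //.
- move=> x W Wx; have [c [c' [k [r [[ac ac' cx c'x] k0 r0 _ rsurj]]]]] := loc x.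
  have Wd : nbhs x (W `&` f @^-1` dom c').
    by apply: filterI => //; apply: (continuous_near (fcont x) (atlas_dom_nbhs ac' c'x)).
  have /near_distP[d d0 dW] := atlas_fwd_image_nbhs ac cx Wd.
  pose s := Num.min (d / 2) (r / 2).
  have s0 : 0 < s by rewrite lt_min !divr_gt0.
  have sr : s < r by rewrite gt_min; apply/orP; right; lra.
  have sd : s < d by rewrite gt_min; apply/orP; left; lra.
  have ks : 0 < k * s by rewrite mulr_gt0.
  have : \forall y \near f x, `|fwd c' y - fwd c' (f x)| < k * s.
    apply: (continuous_near (W := [set q | `|q - fwd c' (f x)| < k * s])
      (atlas_fwd_continuous ac' c'x)).
    by apply/near_distP; exists (k * s).
  apply: filterS2 (atlas_dom_nbhs ac' c'x) => y c'y yks.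
  have [|u [us uy]] := rsurj s (fwd c' y) s0 sr.
    by rewrite chart_repE// ltW.
  have [|z [cz [Wz c'z]] zu] := dW u; first exact: le_lt_trans us sd.
  exists z => //; move: uy; rewrite -zu chart_repE// => /(congr1 (bwd c')).
  by rewrite !atlas_bwdK.
- move=> x; have [c [c' [k [r [[ac ac' cx c'x] k0 r0 rinj _]]]]] := loc x.
  exists (dom c `&` [set p | `|fwd c p - fwd c x| < r]).
    apply: filterI; first exact: atlas_dom_nbhs.
    apply: (continuous_near (W := [set q | `|q - fwd c x| < r]) (atlas_fwd_continuous ac cx)).
    by apply/near_distP; exists r.
  move=> p q [cp pr] [cq qr] fpq; have := rinj _ _ pr qr.
  rewrite !chart_repE// fpq subrr normr0 pmulr_rle0// normr_le0 subr_eq0 => /eqP e.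
  by rewrite -(atlas_bwdK ac cp) e atlas_bwdK.
Qed.

Lemma expanding_inverse_C1_map (g : Y -> X) :
  (forall x, exists m, expands_at x m) -> cancel f g -> cancel g f -> C1_map g.
Proof.
move=> fexp fK gK; have [_ fopen _] := expanding_local_homeomorphism fexp.
have gc : continuous g.
  move=> y W Wy; suff : \forall z \near y, W (g z) by [].
  have := fopen _ _ Wy; rewrite gK; apply: filterS => _ [x Wx <-].
  by rewrite fK.
split => // c' c ac' ac.
pose V := fwd c' @` (dom c' `&` g @^-1` dom c).
have Vo : open V.
  rewrite openE => _ [y [cy cgy] <-]; apply: (atlas_fwd_image_nbhs ac' cy).
  exact: (continuous_near (gc y) (atlas_dom_nbhs ac cgy)).
apply: (@C1_inverse R E F _ V (chart_rep f c c') (chart_rep g c' c)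
  (chart_rep_domain_open f1 ac ac') Vo (f1.2 _ _ ac ac')).
- move=> _ [x [cx c'fx] <-]; have [m fm] := fexp x.
  exact: expands_at_chart_rep fm ac ac' cx c'fx.
- move=> _ [y [c'y cgy] <-]; rewrite !chart_repE//; split.
  + by exists (g y) => //; split => //=; rewrite gK.
  + by rewrite gK.
  + apply: (@continuous_compose _ _ _ (fun p => g (bwd c' p)) (fwd c)); last first.
      by rewrite atlas_bwdK//; exact: atlas_fwd_continuous.
    apply: (@continuous_compose _ _ _ (bwd c') g); last exact: gc.
    exact: atlas_bwd_continuous.
Qed.

(** With [S] the norm at [x] of the coordinate displacement, the linearization error is at most
    [m / 4 * S], whence [3/4 * m * S <= b' * |df|]; the distance is at most [3/2 * S], and 3/2 times
    4/3 is the factor 2. *)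
Lemma fdist_local_expansion x m (c' : chart Y F) (b' : R) : expands_at x m ->
  atlas c' -> dom c' (f x) -> 0 < b' ->
  (forall w, fnorm (tvec c' (f x) w) <= b' * `|w|) ->
  exists2 N, nbhs x N & forall p q, N p -> N q ->
    fdist p q <= 2 * b' / m * `|fwd c' (f q) - fwd c' (f p)|.
Proof.
move=> [m0 mf _] ac' c'fx b'0 fb'.
have k1 : 1 < (3 / 2 : R) by lra.
have [c [a [b [N [[ac cx] [a0 b0] [Nx Nc] cab adm]]]]] := local_admissible x k1.
set D := 'd (chart_rep f c c') (fwd c x).
have e0 : 0 < m * a / b' / 4 by rewrite !divr_gt0// mulr_gt0.
have xU : (fwd c @` (dom c `&` f @^-1` dom c')) (fwd c x) by exists x.
have [r r0 rD] := @C1_strict_differentiability R E F _ (chart_rep f c c') _ _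
  (chart_rep_domain_open f1 ac ac') (f1.2 _ _ ac ac') xU e0.
exists (N `&` [set p | `|fwd c p - fwd c x| < r]).
  apply: filterI => //.
  apply: (continuous_near (W := [set q | `|q - fwd c x| < r]) (atlas_fwd_continuous ac cx)).
  by apply/near_distP; exists r.
move=> p q [Np pr] [Nq qr]; have cp := Nc _ Np; have cq := Nc _ Nq.
have [_ _] := rD _ _ qr pr; rewrite !chart_repE//.
set df := fwd c' (f q) - fwd c' (f p); set du := fwd c q - fwd c p => h.
apply: le_trans (fdist_le_admissible (adm _ _ Np Nq)) _; rewrite -/du.
set S := fnorm (tvec c x du).
have h1 : a * `|du| <= S by have /andP[] := cab x du cx.
have h2 : m * S <= fnorm (tvec c' (f x) (D du)).
  by rewrite -(tdiff_tvec du f1 ac ac' cx c'fx); exact: mf.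
have h3 : fnorm (tvec c' (f x) (D du)) <= b' * `|df| + b' * `|df - D du|.
  have := seminormB (D du) df (tvec_seminorm c' (f x)).
  rewrite [`|df - _|]distrC => /le_trans; apply; apply: lerD; exact: fb'.
have h4 : b' * `|df - D du| <= m / 4 * S.
  apply: (@le_trans _ _ (b' * (m * a / b' / 4 * `|du|))).
    by rewrite ler_pM2l.
  have -> : b' * (m * a / b' / 4 * `|du|) = m / 4 * (a * `|du|).
    by field; rewrite gt_eqF.
  by rewrite ler_pM2l// divr_gt0.
have -> : 2 * b' / m * `|df| = (2 * (b' * `|df|)) / m by field; rewrite gt_eqF.
rewrite ler_pdivlMr//; lra.
Qed.

End expanding_maps.

(** * Global inversion *)

Section global_inversion.
Context {R : realType} {E F : completeNormedModType R}
  {X : finsler_manifold E} {Y : finsler_manifold F} (f : X -> Y).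
Hypothesis X_connected : connected [set: X].
Hypothesis X_complete : finsler_complete X.
Hypothesis f1 : C1_map f.
Variables (eta N : R -> R) (x0 : X).
Hypothesis etaN : integrable_growth eta N.

Definition weighted_expansion (al : R) (V : set Y) : Prop :=
  0 < al /\ forall x, V (f x) -> expands_at f x (al * eta (fdist x0 x)).

Hypothesis f_expands : forall y : Y, exists al V, nbhs y V /\ weighted_expansion al V.

Let eta_gt0 r : 0 <= r -> 0 < eta r.
Proof.
by move=> r0; have [/(_ r r0)[e e0 em] _ _ _ _] := etaN; rewrite (lt_le_trans e0)// em// r0 lexx.
Qed.

Lemma weighted_expands_at x : exists m, expands_at f x m.
Proof.
have [al [V [Vy [al0 fV]]]] := f_expands (f x).
by exists (al * eta (fdist x0 x)); apply: fV; exact: nbhs_singleton.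
Qed.

Let flh : local_homeomorphism f.
Proof. exact: expanding_local_homeomorphism f1 weighted_expands_at. Qed.

Let hX : hausdorff_space X. Proof. exact: finsler_hausdorff. Qed.
Let hY : hausdorff_space Y. Proof. exact: finsler_hausdorff. Qed.

(** * Lifting a coordinate segment up to its end time *)

Section segment.
Variables (al b : R) (V : set Y) (c : chart Y F) (u w : F) (x : X) (h : R -> Y).
Hypothesis alV : weighted_expansion al V.
Hypothesis ac : atlas c.
Hypothesis b0 : 0 < b.
Hypothesis cb : forall z v, dom c z -> fnorm (tvec c z v) <= b * `|v|.
Hypothesis hV : forall t, [/\ V (h t), dom c (h t) & fwd c (h t) = u + clamp01 t *: w].

Variables (T : R) (g : R -> X).
Hypothesis T0 : 0 < T.
Hypothesis hx : h 0 = f x.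
Hypothesis hg : lift_before f h x T g.

Let al0 : 0 < al. Proof. by have [] := alV. Qed.

Let h_le0 t : t <= 0 -> h t = h 0.
Proof.
move=> t0; have [_ ct e] := hV t; have [_ c0 e0] := hV 0.
rewrite -(atlas_bwdK ac ct) -(atlas_bwdK ac c0) e e0.
by rewrite !clamp01_le0.
Qed.

Let fg t : t < T -> f (g t) = h t.
Proof.
move=> tT; have [g0 _ gh] := hg; have [t0|/ltW t0] := leP t 0; last by rewrite gh ?t0.
by rewrite g0// h_le0.
Qed.

Let r t := fdist x0 (g t).

Let r_ge0 t : 0 <= r t. Proof. exact: fdist_ge0. Qed.

(** The local Lipschitz constant of the lift at time [t]: the coordinate speed [|w|] times the
    factor of [fdist_local_expansion] for the expansion rate [al * eta (r t)]. *)
Let kappa t := 2 * b / (al * eta (r t)) * `|w|.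

Let g_lipschitz_at t : t < T -> \forall s \near t,
  fdist (g t) (g s) <= kappa t * `|s - t|.
Proof.
move=> tT; have [_ gc _] := hg; have [Vt ct _] := hV t.
have ft : expands_at f (g t) (al * eta (r t)) by apply: alV.2; rewrite fg.
have cfg : dom c (f (g t)) by rewrite fg.
have [Nt Ntn NtP] := fdist_local_expansion f1 ft ac cfg b0 (fun v => cb v cfg).
have sT : \forall s \near t, s < T by exact: lt_nbhsl.
apply: filterS2 (continuous_near (gc t tT) Ntn) sT => s Ns sT.
apply: (le_trans (NtP _ _ (nbhs_singleton Ntn) Ns)).
rewrite /kappa -[leRHS]mulrA ler_wpM2l//.
  by rewrite divr_ge0 ?mulr_ge0 ?(ltW b0)// ?(ltW al0)// ltW// eta_gt0.
rewrite !fg//; have [_ _ ->] := hV s; have [_ _ ->] := hV t.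
rewrite opprD addrACA subrr add0r -scalerBl normrZ mulrC ler_wpM2l//.
exact: clamp01_lipschitz.
Qed.

Let kappa_ge0 t : 0 <= kappa t.
Proof.
by rewrite mulr_ge0// divr_ge0 ?mulr_ge0 ?(ltW b0)// ?(ltW al0)// ltW// eta_gt0.
Qed.

Let g_fdist_continuous y t : t < T -> {for t, continuous (fun s => fdist y (g s))}.
Proof.
move=> tT; apply/cvgrPdist_le => e e0.
suff : \forall s \near t, `|fdist y (g t) - fdist y (g s)| <= e by [].
have k1 : 0 < kappa t + 1 by rewrite ltr_wpDl.
have st : \forall s \near t, `|s - t| < e / (kappa t + 1).
  by apply/near_distP; exists (e / (kappa t + 1)) => //; rewrite divr_gt0.
apply: filterS2 (g_lipschitz_at tT) st => s gs st.
have : fdist (g t) (g s) <= e.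
  rewrite (le_trans gs)// (@le_trans _ _ ((kappa t + 1) * `|s - t|))//.
    by rewrite ler_wpM2r// lerDl.
  by rewrite mulrC -ler_pdivlMr// ltW.
have := fdist_triangle X_connected y (g t) (g s).
have := fdist_triangle X_connected y (g s) (g t).
rewrite (fdist_sym X_connected (g s) (g t)) ler_norml => h1 h2 h3.
by apply/andP; split; lra.
Qed.

(* The Gronwall-type estimate that keeps the lift at bounded distance from [x0]. *)
Let N_growth t : 0 <= t < T -> N (r t) <= N (r 0) + 4 * b * `|w| / al * T.
Proof.
move=> /andP[t0 tT]; have [_ Nmono Nc Nd _] := etaN.
have C0 : 0 <= 4 * b * `|w| / al.
  by rewrite divr_ge0 ?mulr_ge0// ltW.
suff H : N (r t) - N (r 0) <= 4 * b * `|w| / al * (t - 0).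
  rewrite -lerBlDl (le_trans H)// ler_wpM2l// subr0; exact: ltW.
apply: (@le_of_local_slope R (fun s => N (r s)) 0 t _ t0) => [s /andP[s0 st]|s /andP[s0 st]].
  apply: (@continuous_compose _ _ _ r N s); last exact: Nc.
  exact: g_fdist_continuous (le_lt_trans st tT).
have sT := lt_trans st tT.
have [d d0 Nd'] := Nd (r s) (r_ge0 s).
have k1 : 0 < kappa s + 1 by rewrite ltr_wpDl.
have /near_distP[d1 d10 gs1] := g_lipschitz_at sT.
exists (Num.min d1 (d / (kappa s + 1))); first by rewrite lt_min d10 divr_gt0.
move=> s' /andP[ss' s'd] _; have ds : 0 < s' - s by rewrite subr_gt0.
have /andP[ds1 ds2] : (s' - s < d1) && (s' - s < d / (kappa s + 1)).
  by rewrite -lt_min ltrBlDl.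
have := gs1 s'; rewrite gtr0_norm// => /(_ ds1) gs'.
have kd : kappa s * (s' - s) < d.
  rewrite (@le_lt_trans _ _ ((kappa s + 1) * (s' - s)))//.
    by rewrite ler_wpM2r ?(ltW ds)// lerDl.
  by rewrite mulrC -ltr_pdivlMr.
have rs' : r s' <= r s + kappa s * (s' - s).
  by rewrite (le_trans (fdist_triangle X_connected x0 (g s) (g s')))// lerD2l.
have ks0 : 0 <= kappa s * (s' - s) by rewrite mulr_ge0// ltW.
have := Nd' (r s + kappa s * (s' - s)); rewrite lerDl ks0 ltrD2l kd => /(_ isT).
rewrite addrAC subrr add0r => h1.
(* The weight cancels here: the slope of [N] along the lift is bounded independently of the distance
   reached. *)
have h2 : 2 * eta (r s) * (kappa s * (s' - s)) = 4 * b * `|w| / al * (s' - s).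
  rewrite /kappa; field; rewrite gt_eqF//= gt_eqF//; exact: eta_gt0.
have := Nmono _ _ rs'; lra.
Qed.

Let g_uniformly_lipschitz : exists2 k : R, 0 <= k &
  forall s t, 0 <= s -> s <= t -> t < T -> fdist (g s) (g t) <= k * (t - s).
Proof.
have [etam Nmono _ _ Ninfty] := etaN.
(* [N] at [rho] exceeds every value it can take along the lift, so by monotonicity the distance
   stays below [rho], where [eta] is at least [e]. *)
have [rho rho0 Nrho] := Ninfty (N (r 0) + 4 * b * `|w| / al * T).
have [e e0 em] := etam rho rho0.
pose k := 2 * b / (al * e) * `|w|.
have k0 : 0 <= k.
  by rewrite mulr_ge0// divr_ge0 ?mulr_ge0// ltW.
have kk t : 0 <= t -> t < T -> kappa t <= k.
  move=> t0 tT; have rt : r t <= rho.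
    rewrite leNgt; apply/negP => /ltW/Nmono.
    have := N_growth (introT andP (conj t0 tT)); lra.
  have ee : e <= eta (r t) by apply: em; rewrite r_ge0 rt.
  rewrite /kappa /k ler_wpM2r// ler_pM2l ?mulr_gt0//.
  rewrite lef_pV2 ?posrE ?mulr_gt0// ?ler_pM2l//.
  exact: eta_gt0.
exists k => // s t s0 st tT.
have gss : fdist (g s) (g s) = 0.
  have := nbhs_singleton (g_lipschitz_at (le_lt_trans st tT)).
  rewrite subrr normr0 mulr0 => h1; apply/eqP; rewrite eq_le h1.
  exact: fdist_ge0.
have := @le_of_local_slope R (fun v => fdist (g s) (g v)) s t k st.
rewrite gss subr0; apply=> [v /andP[sv vt]|v /andP[sv vt]].
  exact: g_fdist_continuous (le_lt_trans vt tT).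
have vT := lt_trans vt tT.
have /near_distP[d d0 gv] := g_lipschitz_at vT.
exists d => // v' /andP[vv' v'd] _; have ds : 0 < v' - v by rewrite subr_gt0.
have := gv v'; rewrite gtr0_norm// ltrBlDl => /(_ v'd) gv'.
rewrite lerBlDl (le_trans (fdist_triangle X_connected _ (g v) _))// lerD2l.
rewrite (le_trans gv')// ler_wpM2r ?(ltW ds)// kk//.
exact: le_trans sv.
Qed.

Lemma segment_lift_limit : exists x' : X, g t @[t --> T^'-] --> x'.
Proof.
have [k k0 gk] := g_uniformly_lipschitz.
(* Completeness concerns sequences: it is applied along times increasing to [T], and the Lipschitz
   bound extends the limit to all times close to [T]. *)
pose tn (n : nat) : R := T - T / n.+1%:R.
have tnT n : tn n < T by rewrite /tn gtrBl divr_gt0.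
have tn0 n : 0 <= tn n.
  by rewrite subr_ge0 ler_pdivrMr// ler_peMr ?(ltW T0)// ler1n.
have tn_lim (d : R) : 0 < d -> exists M, forall n, (M <= n)%N -> T - tn n < d.
  move=> d0; exists (Num.truncn (T / d)) => n Mn.
  rewrite /tn subKr ltr_pdivrMr// mulrC -ltr_pdivrMr//.
  by rewrite (lt_le_trans (truncnS_gt _))// ler_nat.
have k1 : 0 < k + 1 by rewrite ltr_wpDl.
have gkS s t (d : R) : 0 <= s -> s < T -> 0 <= t -> t < T -> T - s < d -> T - t < d ->
    fdist (g s) (g t) <= k * d.
  move=> s0 sT t0 tT sd td; have [st|/ltW ts] := leP s t.
    by rewrite (le_trans (gk _ _ s0 st tT))// ler_wpM2l//; lra.
  by rewrite (fdist_sym X_connected) (le_trans (gk _ _ t0 ts sT))// ler_wpM2l//; lra.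
have kd (e : R) : 0 < e -> k * (e / (k + 1)) < e.
  by move=> e0; rewrite mulrA ltr_pdivrMr// mulrC ltr_pM2l// ltrDl.
have [e e0|x' gx'] := @X_complete (g \o tn).
  have ek : 0 < e / (k + 1) by rewrite divr_gt0.
  have [M MP] := tn_lim _ ek; exists M => m n Mm Mn.
  by apply: le_lt_trans (kd _ e0); apply: gkS => //; exact: MP.
exists x' => W Wx'; suff : \forall t \near T^'-, W (g t) by [].
have [d d0 dW] := fdist_nbhs X_connected Wx'.
have d2 : 0 < d / 2 by rewrite divr_gt0.
have dk : 0 < d / 2 / (k + 1) by rewrite divr_gt0.
have [M MP] := tn_lim _ dk.
have /cvgrPdist_lt/(_ _ d2)[M' _ M'P] := gx'.
pose n := maxn M M'.
have := M'P n (leq_maxr _ _); rewrite /= sub0r normrN ger0_norm ?fdist_ge0// => nx'.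
have nT := MP n (leq_maxl _ _).
apply/near_leftP; exists (T - tn n); first by rewrite subr_gt0.
move=> t; rewrite subKr => /andP[nt tT]; apply: dW.
have t0 : 0 <= t by exact: le_trans (tn0 n) (ltW nt).
have h1 : fdist (g (tn n)) (g t) <= k * (d / 2 / (k + 1)).
  by apply: gkS => //; lra.
have := kd _ d2; have := fdist_triangle X_connected x' (g (tn n)) (g t).
rewrite (fdist_sym X_connected x' (g (tn n))) => h2 h3; lra.
Qed.

End segment.

(** [V] is a coordinate ball, so the segment from [f x] to any [z] in [V] stays in [V], whichever
    point [x] above [V] is taken. For [z = f x] the segment is constant, hence the section passes
    through [x]. *)
Lemma weighted_has_local_sections : has_local_sections f.
Proof.
move=> y; have [al [V0 [V0y alV0]]] := f_expands y.
have [c [a [b [ac cy a0 b0 cab]]]] := finsler_chart y (ltr1n R 2).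
have cb z v : dom c z -> fnorm (tvec c z v) <= b * `|v|.
  by move=> cz; have [/andP[]] := cab z v cz.
have /near_distP[rho rho0 rhoV] := atlas_fwd_image_nbhs ac cy V0y.
pose V := dom c `&` [set z | `|fwd c z - fwd c y| < rho].
have VV0 z : V z -> V0 z.
  by move=> [cz /rhoV[z' [cz' V0z'] /(congr1 (bwd c))]]; rewrite !atlas_bwdK// => <-.
have alV : weighted_expansion al V.
  by case: alV0 => al0 alV0; split => // x /VV0; exact: alV0.
have Vo : open V.
  rewrite openE => z [cz zr]; rewrite /interior; apply: filterI.
    exact: atlas_dom_nbhs.
  apply: (continuous_near (W := [set q | `|q - fwd c y| < rho]) (atlas_fwd_continuous ac cz)).
  apply/near_distP; exists (rho - `|fwd c z - fwd c y|); first by rewrite subr_gt0.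
  move=> q qz /=; rewrite -[q - _](subrKA (fwd c z)) (le_lt_trans (ler_normD _ _))//.
  by rewrite -ltrBrDr.
exists V; split => //; first by split => //=; rewrite subrr normr0.
move=> x Vfx; set u := fwd c (f x).
pose h z t := bwd c (u + clamp01 t *: (fwd c z - u)).
have himage z t : V z -> exists2 z', V z' & fwd c z' = u + clamp01 t *: (fwd c z - u).
  move=> Vz; have t01 := clamp01_bounds t.
  have inb : `|u + clamp01 t *: (fwd c z - u) - fwd c y| < rho.
    by apply: segment_in_ball => //; [case: Vz|case: Vfx].
  have [z' [cz' _] zE] := rhoV _ inb; exists z' => //; split => //=.
  by rewrite zE.
have hV z : V z -> forall t, [/\ V (h z t), dom c (h z t) &
    fwd c (h z t) = u + clamp01 t *: (fwd c z - u)].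
  move=> Vz t; rewrite /h; have [z' Vz' <-] := himage z t Vz.
  by have [cz' _] := Vz'; rewrite atlas_bwdK.
have hclamp z t : h z (clamp01 t) = h z t.
  by rewrite /h (clamp01_id (clamp01_bounds t)).
have hcont z t : V z -> {for (t, z), continuous (fun p : R * Y => h p.2 p.1)}.
  move=> Vz; have [cz _] := Vz.
  apply: (@continuous_compose _ _ _
    (fun p : R * Y => u + clamp01 p.1 *: (fwd c p.2 - u)) (bwd c) (t, z)).
    apply: cvgD; first exact: cvg_cst.
    apply: cvgZ.
      apply: (@continuous_compose _ _ _ fst (@clamp01 R) (t, z)); first exact: cvg_fst.
      exact: clamp01_continuous.
    apply: cvgB; last exact: cvg_cst.
    apply: (@continuous_compose _ _ _ snd (fwd c) (t, z)); first exact: cvg_snd.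
    exact: atlas_fwd_continuous.
  have [z' [cz' _] /= <-] := himage z t Vz.
  exact: atlas_bwd_continuous.
have hc z : V z -> continuous (h z).
  move=> Vz t; apply: (@continuous_compose _ _ _ (fun t => (t, z))
    (fun p : R * Y => h p.2 p.1) t); last exact: hcont.
  move=> W [[A B] /= [At Bz] AB]; suff : \forall t' \near t, W (t', z) by [].
  by apply: filterS At => t' At'; apply: AB; split => //; exact: nbhs_singleton.
have z01 : 0 <= (0 : R) <= 1 by rewrite lexx ler01.
have o01 : 0 <= (1 : R) <= 1 by rewrite lexx ler01.
have h0 z : h z 0 = f x.
  by rewrite /h (clamp01_id z01) scale0r addr0 atlas_bwdK//; case: Vfx.
have h1 z : V z -> h z 1 = z.
  move=> [cz _]; rewrite /h (clamp01_id o01) scale1r addrC subrK.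
  by rewrite atlas_bwdK.
have /choice[G GP] z : exists g : R -> X, V z ->
    [/\ continuous g, g 0 = x & forall t, f (g t) = h z t].
  have [Vz|] := pselect (V z); last by exists (cst x).
  have [T g /andP[T0 T1] gl|g [gc g0 gh]] :=
    @lift_exists R X Y f flh hX hY (h z) x 1 (hc z Vz) (esym (h0 z)) ler01.
    exact: (segment_lift_limit alV ac b0 cb (hV z Vz) T0 (h0 z) gl).
  exists (fun t => g (clamp01 t)) => _; split.
  - move=> t; apply: (@continuous_compose _ _ _ (@clamp01 R) g t); last exact: gc.
    exact: clamp01_continuous.
  - by rewrite (clamp01_id z01); exact: g0.
  - by move=> t; rewrite gh ?hclamp//; exact: clamp01_bounds.
exists (fun z => G z 1); split.
  have [Gc G0 Gh] := GP _ Vfx; rewrite -[RHS]G0.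
  apply/esym; apply: (@lift_unique R X Y f flh hX (cst (G (f x) 0)) (G (f x)) 0 1 ler01) => //.
  move=> t _; split; [exact: cvg_cst|exact: Gc|].
  by rewrite !Gh /h -/u subrr !scaler0.
move=> z Vz; split; first by have [_ _ ->] := GP z Vz; rewrite h1.
have Vn z' : V z' -> nbhs z' V by move=> Vz'; exact: open_nbhs_nbhs.
apply: (lift_continuous_param flh hX) => //.
- by apply: filterS (Vn _ Vz) => z' /GP[].
- move=> t _; apply: near_eq_continuous (hcont z t Vz).
  exists (setT, V) => /=; first by split; [exact: filterT|exact: Vn].
  by move=> [t' z'] [_ /= Vz']; have [_ _ ->] := GP z' Vz'.
- apply: (@near_eq_continuous _ _ (cst x)); last exact: cvg_cst.
  by apply: filterS (Vn _ Vz) => z' /GP[_ ->].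
Qed.

Theorem weighted_global_diffeomorphism : simply_connected R Y ->
  global_diffeomorphism f.
Proof.
move=> Ysc; have [finj fsurj] := covering_bijective flh weighted_has_local_sections
  hX hY Ysc (carrier_nonempty X) (connected_paths X_connected).
have /choice[g gK] := fsurj.
have fK : cancel f g by move=> x; apply: finj; rewrite gK.
split => //; exists g; split => //.
exact: (expanding_inverse_C1_map f1 weighted_expands_at fK gK).
Qed.

End global_inversion.

(** * The moduli *)

Section moduli.
Context {R : realType} {E F : completeNormedModType R}
  {X : finsler_manifold E} {Y : finsler_manifold F} (f : X -> Y).
Hypothesis f1 : C1_map f.
Implicit Types (x : X) (m : R).

Lemma tdiff_continuous x : continuous (tdiff f x : E -> F).
Proof.
have [ac cx] := chart_atP x; have [ac' cfx] := chart_atP (f x).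
exact: diff_continuous (chart_rep_differentiable f1 ac ac' cx cfx).
Qed.

Lemma expands_at_le x m m' : 0 < m' -> m' <= m -> expands_at f x m ->
  expands_at f x m'.
Proof.
move=> m'0 m'm [m0 mf fs]; split => // v; apply: le_trans (mf v).
by rewrite ler_wpM2r// fnorm_ge0.
Qed.

Lemma le_inj_modulus x m : expands_at f x m -> (m%:E <= inj_modulus f x)%E.
Proof.
move=> [m0 mf _]; apply: le_ereal_inf_tmp => _ [v /= v1 <-].
by rewrite lee_fin; have := mf v; rewrite v1 mulr1.
Qed.

(** If [v] maps to a vector [w] of norm at most 1, then [m *: v] has norm at most 1, so
    [m * |l w| <= D]. Were [D < m], it would be finite and [l] would have dual norm at most
    [D / m < 1]. *)
Lemma le_sur_modulus x m : expands_at f x m -> (m%:E <= sur_modulus f x)%E.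
Proof.
move=> [m0 mf fs]; apply: le_ereal_inf_tmp => _ [l [lc l1] <-].
set D := dual_norm _.
have Dl w : fnorm w <= 1 -> ((m * `|l w|)%:E <= D)%E.
  move=> w1; have [v vw] := fs w.
  have h : fnorm (m *: v : tangent x) <= 1.
    by rewrite fnormZ gtr0_norm// (le_trans (mf v))// vw.
  apply: (@le_trans _ _ (`|l (tdiff f x (m *: v))|%:E)).
    by rewrite linearZ /= vw linearZ /= normrM gtr0_norm.
  by apply: ereal_sup_ubound; exists (m *: v).
rewrite leNgt; apply/negP => Dm.
have D0 : (0 <= D)%E.
  have := Dl 0; rewrite (seminorm0 (fnorm_seminorm _)) ler01 => /(_ isT).
  by rewrite linear0 normr0 mulr0.
have : (dual_norm l <= (fine D / m)%:E)%E.
  apply: ge_ereal_sup => _ [w /= w1 <-]; rewrite lee_fin ler_pdivlMr// mulrC.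
  rewrite -lee_fin fineK ?Dl// ge0_fin_numE// (lt_le_trans Dm)// leey.
  by [].
rewrite l1 lee_fin ler_pdivlMr// mul1r -lee_fin fineK; last first.
  by rewrite ge0_fin_numE// (lt_le_trans Dm)// leey.
by rewrite leNgt Dm.
Qed.

Lemma quotient_dim0_range (E' F' : lmodType R) (T : {linear E' -> F'}) :
  quotient_dim setT (range T) 0 -> forall w, exists v, T v = w.
Proof.
move=> [e [_ _ gen]] w; have [a [v _ ve]] := gen w Logic.I.
by exists v; rewrite ve big_ord0 subr0.
Qed.

Hypothesis f_fredholm : fredholm_index0 f.

Lemma inj_modulus_expands_at x m : 0 < m -> (m%:E <= inj_modulus f x)%E ->
  expands_at f x m.
Proof.
move=> m0 mi.
have mf (v : tangent x) : m * fnorm v <= fnorm (tdiff f x v).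
  have [v0|v0] := eqVneq (fnorm v) 0.
    by rewrite v0 mulr0 fnorm_ge0.
  have v_gt0 : 0 < fnorm v by rewrite lt0r v0 fnorm_ge0.
  have n1 : fnorm ((fnorm v)^-1 *: v) = 1.
    by rewrite fnormZ gtr0_norm ?invr_gt0// mulVf.
  have : (m%:E <= (fnorm (tdiff f x ((fnorm v)^-1 *: v)))%:E)%E.
    apply: (le_trans mi); apply: ereal_inf_lbound.
    by exists ((fnorm v)^-1 *: v).
  rewrite lee_fin linearZ fnormZ gtr0_norm ?invr_gt0// mulrC ler_pdivlMr//.
split => //.
have [n [[e [eker efree _]] fr]] := f_fredholm x.
have e0 i : e i = 0.
  apply: fnorm_eq0; apply/eqP; rewrite eq_le fnorm_ge0 andbT.
  have := mf (e i); rewrite (eker i) (seminorm0 (fnorm_seminorm _)).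
  by rewrite pmulr_rle0.
(* The kernel vectors [e i] all vanish, so for [n > 0] the coefficients 1 would contradict their
   independence. *)
have n0 : n = 0%N.
  case: n => // n in e eker efree fr e0 *.
  have := efree (fun=> 1) _ ord0; rewrite big1 => [|i _]; last by rewrite e0 scaler0.
  by move=> /(_ erefl)/eqP; rewrite oner_eq0.
by move: fr; rewrite n0; exact: quotient_dim0_range.
Qed.

(** Dividing [l] by its dual norm [d], finite by continuity and positive when [l w] is nonzero,
    gives a unit functional to which the infimum applies; this yields [m * d <= K]. *)
Lemma sur_modulus_adjoint x m (l : {linear F -> R^o}) (K : R) : 0 < m ->
  (m%:E <= sur_modulus f x)%E -> continuous l -> 0 <= K ->
  (forall v : E, `|l (tdiff f x v)| <= K * fnorm (v : tangent x)) ->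
  forall w : F, m * `|l w| <= K * fnorm (w : tangent (f x)).
Proof.
move=> m0 ms lc K0 lK w.
have [NS [a [b [a0 b0 ab]]]] := fnorm_equiv_norm (f x).
have [k k0 lk] := linear_lipschitz lc.
have [lw0|lw0] := eqVneq (l w) 0.
  by rewrite lw0 normr0 mulr0 mulr_ge0// fnorm_ge0.
have lN v : fnorm (v : tangent (f x)) <= 1 -> `|l v| <= k / a.
  move=> v1; rewrite (le_trans (lk v))// ler_wpM2l ?(ltW k0)//.
  rewrite -[leRHS]mul1r ler_pdivlMr// mulrC.
  by have /andP[h _] := ab v; exact: le_trans h v1.
pose d := sup [set `|l v| | v in [set v : tangent (f x) | fnorm v <= 1]].
have hs : has_sup [set `|l v| | v in [set v : tangent (f x) | fnorm v <= 1]].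
  split; last by exists (k / a) => _ [v /= v1 <-]; exact: lN.
  by exists `|l 0|, 0 => //=; rewrite (seminorm0 NS).
have ld v : `|l v| <= d * fnorm (v : tangent (f x)).
  have [v0|v0] := eqVneq (fnorm (v : tangent (f x))) 0.
    have v00 : v = 0 by exact: (fnorm_eq0 v0).
    by rewrite v0 v00 linear0 normr0 mulr0.
  have v_gt0 : 0 < fnorm (v : tangent (f x)) by rewrite lt0r v0 fnorm_ge0.
  rewrite -ler_pdivrMr// mulrC -[X in X * _]gtr0_norm ?invr_gt0// -normrM.
  apply: ub_le_sup; first exact: hs.2.
  exists ((fnorm (v : tangent (f x)))^-1 *: v) => /=.
    by rewrite fnormZ gtr0_norm ?invr_gt0// mulVf.
  by rewrite linearZ.
have d0 : 0 < d.
  rewrite ltNge; apply/negP => dle.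
  have : `|l w| <= 0.
    rewrite (le_trans (ld w))// mulr_le0_ge0// fnorm_ge0.
    by [].
  by rewrite normr_le0 (negbTE lw0).
pose l' : {linear tangent (f x) -> R^o} := d^-1 \*: l.
have l'c : continuous l'.
  by move=> v; apply: (@cvgM _ _ _ _ (cst d^-1) l); [exact: cvg_cst|exact: lc].
have l'1 : dual_norm l' = 1%:E.
  apply/eqP; rewrite eq_le; apply/andP; split.
    apply: ge_ereal_sup => _ [v /= v1 <-]; rewrite lee_fin normrM gtr0_norm ?invr_gt0//.
    rewrite mulrC ler_pdivrMr// mul1r (le_trans (ld v))//.
    by rewrite ler_piMr// ltW.
  apply/lee_addgt0Pr => e e0.
  have [_ [v /= v1 <-]] := sup_adherent (mulr_gt0 d0 e0) hs.
  rewrite -/d => dv; rewrite -leeBlDr// -EFinB.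
  apply: (@le_trans _ _ `|l' v|%:E); last by apply: ereal_sup_ubound; exists v.
  rewrite lee_fin normrM [X in X * _]gtr0_norm ?invr_gt0// mulrC ler_pdivlMr//.
  by rewrite ltW// (le_lt_trans _ dv)//; lra.
have : (m%:E <= (K / d)%:E)%E.
  apply: (le_trans ms); apply: (@le_trans _ _ (dual_norm (l' \o tdiff f x))).
    by apply: ereal_inf_lbound; exists l'.
  apply: ge_ereal_sup => _ [v /= v1 <-]; rewrite lee_fin.
  rewrite normrM [X in X * _]gtr0_norm ?invr_gt0// mulrC ler_wpM2r ?invr_ge0 ?(ltW d0)//.
  by rewrite (le_trans (lK v))// ler_piMr.
rewrite lee_fin ler_pdivlMr// => mdK.
apply: (@le_trans _ _ (m * (d * fnorm (w : tangent (f x))))).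
  by rewrite ler_pM2l.
by rewrite mulrA ler_wpM2r// fnorm_ge0.
Qed.

(** Surjectivity makes the common dimension [n] zero, hence the kernel trivial. The preimage of
    bounded norm is then [v] itself, and its bound with constant [4 / m] reads as expansion by
    [m / 4]. *)
Lemma sur_modulus_expands_at x m : 0 < m -> (m%:E <= sur_modulus f x)%E ->
  expands_at f x (m / 4).
Proof.
move=> m0 ms.
have sol := bounded_below_adjoint_solution (@tdiff_continuous x) (fnorm_equiv_norm x)
  (fnorm_equiv_norm (f x)) m0 (fun l K lc K0 lK => sur_modulus_adjoint m0 ms lc K0 lK).
have fs w : exists v, tdiff f x v = w by have [v []] := sol w; exists v.
have [n [[k [_ _ kgen]] [e [_ efree _]]]] := f_fredholm x.
have n0 : n = 0%N.
  case: n => // n in e efree k kgen *.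
  have := efree (fun=> 1) _ ord0; case: (fs (\sum_(i < n.+1) 1 *: e i)) => v ve.
  by move=> /(_ (ex_intro2 _ _ v Logic.I ve))/eqP; rewrite oner_eq0.
have fker v : tdiff f x v = 0 -> v = 0.
  move=> v0; have [a] := kgen v v0.
  by rewrite big1 ?subr0// => i; have := ltn_ord i; rewrite {2}n0.
split => // [|v]; first by rewrite divr_gt0.
have [v' [v'v v'n]] := sol (tdiff f x v).
have vv' : v' = v.
  by apply/eqP; rewrite -subr_eq0; apply/eqP/fker; rewrite linearB /= v'v subrr.
rewrite vv' in v'n; rewrite mulrAC ler_pdivrMr//.
move: v'n; rewrite mulrAC ler_pdivlMr// => h.
by rewrite mulrC (le_trans h)// mulrC.
Qed.

End moduli.

(** In charts at [y] and [g y], the differential [D'] of the inverse is bounded near [y] by [k + 1],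
    by continuity. It is inverse to [D], and passing between coordinate and Finsler norms costs [b]
    and [a']. *)
Lemma global_diffeomorphism_expands (R : realType) (E F : completeNormedModType R)
    (X : finsler_manifold E) (Y : finsler_manifold F) (f : X -> Y) (y : Y) :
  global_diffeomorphism f ->
  exists m V, [/\ 0 < m, nbhs y V & forall x, V (f x) -> expands_at f x m].
Proof.
move=> [f1 [g [fK gK g1]]].
have [c' [a' [b' [ac' c'y a'0 b'0 ab']]]] := finsler_chart y (ltr1n R 2).
have [c [a [b [ac cgy a0 b0 ab]]]] := finsler_chart (g y) (ltr1n R 2).
pose D' z := 'd (chart_rep g c' c) (fwd c' z).
have [dg gnear] : differentiable (chart_rep g c' c) (fwd c' y) /\ forall e : R, 0 < e ->
    \forall q \near fwd c' y, forall v,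
      `|'d (chart_rep g c' c) q v - D' y v| <= e * `|v|.
  by apply: (g1.2 _ _ ac' ac); exists y.
have [k k0 kD'] : exists2 k, 0 < k & forall v, `|D' y v| <= k * `|v|.
  exact: linear_lipschitz (diff_continuous dg).
have k10 : 0 < k + 1 by rewrite addr_gt0.
pose V := [set z | [/\ dom c' z, dom c (g z) & forall v, `|D' z v| <= (k + 1) * `|v|]].
exists (a' / (b * (k + 1))), V; split; first by rewrite divr_gt0// mulr_gt0.
  near=> z; split; first by near: z; exact: atlas_dom_nbhs.
    by near: z; exact: (continuous_near (g1.1 y) (atlas_dom_nbhs ac cgy)).
  move=> v; rewrite -[D' z v](subrK (D' y v)) mulrDl addrC (le_trans (ler_normD _ _))//.
  apply: lerD; first exact: kD'.
  move: v; near: z.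
  exact: (continuous_near (atlas_fwd_continuous ac' c'y) (gnear _ ltr01)).
move=> x [c'fx]; rewrite fK => cx kx.
pose D := 'd (chart_rep f c c') (fwd c x).
have DK u : D' (f x) (D u) = u.
  have gf : g \o f = id by apply/funext => ? /=; rewrite fK.
  have cgfx : dom c (g (f x)) by rewrite fK.
  by rewrite /D' /D -(chart_rep_comp u f1 g1 ac ac' ac cx c'fx cgfx) gf chart_rep_id.
have D'K u : D (D' (f x) u) = u.
  have fg : f \o g = id by apply/funext => ? /=; rewrite gK.
  have cgfx : dom c (g (f x)) by rewrite fK.
  have c'fgfx : dom c' (f (g (f x))) by rewrite !fK.
  have := chart_rep_comp u g1 f1 ac' ac ac' c'fx cgfx c'fgfx.
  by rewrite fg chart_rep_id// fK => <-.
split; first by rewrite divr_gt0// mulr_gt0.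
  move=> v; have [u <-] := tvec_surj v ac cx.
  rewrite (tdiff_tvec u f1 ac ac' cx c'fx) -/D mulrAC ler_pdivrMr ?mulr_gt0//.
  have [/andP[_ h1] _ _] := ab _ u cx; have [/andP[h2 _] _ _] := ab' _ (D u) c'fx.
  have h3 := kx (D u); rewrite DK in h3.
  apply: (@le_trans _ _ (a' * (b * ((k + 1) * `|D u|)))).
    by rewrite ler_pM2l// (le_trans h1)// ler_pM2l.
  rewrite (_ : _ * _ = (b * (k + 1)) * (a' * `|D u|)); last by ring.
  by rewrite mulrC ler_pM2r ?mulr_gt0.
move=> w; have [u <-] := tvec_surj w ac' c'fx.
by exists (tvec c x (D' (f x) u)); rewrite (tdiff_tvec _ f1 ac ac' cx c'fx) -/D D'K.
Unshelve. all: by end_near.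
Qed.

(** * The implications between the five statements *)

Lemma weight_cst1 (R : realType) : weight (cst 1 : R -> R).
Proof.
split=> [r _|]; first exact: ltr01.
rewrite (_ : integral _ _ _ = integral lebesgue_measure `[0%R, +oo[ (cst 1%E))//.
by rewrite integral_cst//= mul1e lebesgue_measure_itv/= ltry.
Qed.

Lemma weighted_modulus_ge (R : realType) (al e : R) (mu : \bar R) : 0 < e ->
  (al%:E <= mu * (e^-1)%:E)%E -> ((al * e)%:E <= mu)%E.
Proof.
move=> e0; case: mu => [m| |] /=.
- by rewrite -EFinM !lee_fin ler_pdivlMr.
- by rewrite leey.
- by rewrite gt0_mulNye ?lte_fin ?invr_gt0// leeNy_eq.
Qed.

Section equivalences.
Context {R : realType} {E F : completeNormedModType R}
  {X : finsler_manifold E} {Y : finsler_manifold F} (f : X -> Y) (mu : X -> \bar R).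
Hypothesis f1 : C1_map f.
Hypothesis f_fredholm : fredholm_index0 f.
Hypothesis mu_def : mu = inj_modulus f \/ mu = sur_modulus f.

(** The constant [m / 4] comes from Sur; it is used for Inj too so that both moduli share one
    statement. *)
Lemma modulus_expands_at x m : 0 < m -> (m%:E <= mu x)%E -> expands_at f x (m / 4).
Proof.
move=> m0; case: mu_def => ->; last exact: sur_modulus_expands_at.
move=> h; have := inj_modulus_expands_at f_fredholm m0 h.
by apply: expands_at_le; lra.
Qed.

Lemma expands_at_modulus_ge x m : expands_at f x m -> (m%:E <= mu x)%E.
Proof.
by case: mu_def => ->; [exact: le_inj_modulus|exact: le_sur_modulus].
Qed.

Lemma global_diffeomorphism_earle_eells : global_diffeomorphism f -> earle_eells f mu.
Proof.
move=> fd y; have [m [V [m0 Vy Vf]]] := global_diffeomorphism_expands y fd.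
by exists m, V; split => // x /Vf; exact: expands_at_modulus_ge.
Qed.

(** The unweighted condition is the weighted one for the constant weight 1. *)
Lemma earle_eells_weighted : earle_eells f mu -> earle_eells_nonincreasing_weight f mu.
Proof.
move=> fe; have [x0 _] := carrier_nonempty X; exists (cst 1), x0; split.
  by split; [exact: weight_cst1|].
move=> y; have [al [V [al0 Vy Vf]]] := fe y; exists al, V; split => // x Vx.
by rewrite /= invr1 mule1; exact: Vf.
Qed.

Lemma strong_submersion_weighted : strong_submersion f ->
  strong_submersion_continuous_weight f.
Proof.
move=> fs; have [x0 _] := carrier_nonempty X; exists (cst 1), x0; split.
  split; first exact: weight_cst1.
  by apply: continuous_subspaceT => x; exact: cvg_cst.
move=> [u [y [uy us]]]; apply: fs; exists u, y; split => //.
by apply: cvg_trans us; apply: near_eq_cvg; near=> n; rewrite /= invr1 mule1.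
Unshelve. all: by end_near.
Qed.

Hypothesis X_connected : connected [set: X].
Hypothesis X_complete : finsler_complete X.
Hypothesis Y_simply_connected : simply_connected R Y.

Lemma weighted_modulus_global_diffeomorphism (eta N : R -> R) x0 :
  weight eta -> integrable_growth eta N ->
  (forall y : Y, exists (al : R) V, [/\ 0 < al, nbhs y V &
     forall x, V (f x) -> (al%:E <= mu x * ((eta (fdist x0 x))^-1)%:E)%E]) ->
  global_diffeomorphism f.
Proof.
move=> [eta0 _] etaN fe.
apply: (weighted_global_diffeomorphism X_connected X_complete f1 etaN (x0 := x0)) => // y.
have [al [V [al0 Vy Vf]]] := fe y; exists (al / 4), V; split => //.
split; first by rewrite divr_gt0.
move=> x Vx; have e0 := eta0 _ (fdist_ge0 x0 x).
rewrite mulrAC; apply: modulus_expands_at; first by rewrite mulr_gt0.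
exact: weighted_modulus_ge (Vf x Vx).
Qed.

Lemma earle_eells_nonincreasing_weight_global_diffeomorphism :
  earle_eells_nonincreasing_weight f mu -> global_diffeomorphism f.
Proof.
move=> [eta [x0 [etaw fe]]]; have [N etaN] := nonincreasing_weight_integrable_growth etaw.
by apply: weighted_modulus_global_diffeomorphism etaN _; [exact: etaw.1|exact: fe].
Qed.

End equivalences.

Lemma global_diffeomorphism_strong_submersion (R : realType)
    (E F : completeNormedModType R) (X : finsler_manifold E)
    (Y : finsler_manifold F) (f : X -> Y) :
  global_diffeomorphism f -> strong_submersion f.
Proof.
move=> fd [u [y [uy us]]].
have [m [V [m0 Vy Vf]]] := global_diffeomorphism_expands y fd.
have : \forall n \near \oo, (m%:E <= sur_modulus f (u n))%E.
  by near=> n; apply/le_sur_modulus/Vf; near: n; exact: (uy _ Vy).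
move=> h; have : (m%:E <= 0%:E)%E by exact: cvge_ge h us.
by rewrite lee_fin leNgt m0.
Unshelve. all: by end_near.
Qed.

Lemma sur_modulus_ge0 (R : realType)
    (E F : completeNormedModType R) (X : finsler_manifold E)
    (Y : finsler_manifold F) (f : X -> Y) x : (0 <= sur_modulus f x)%E.
Proof.
apply: le_ereal_inf_tmp => _ [l _ <-]; apply: (@le_trans _ _ `|(l \o tdiff f x) 0|%:E).
  by rewrite lee_fin.
by apply: ereal_sup_ubound; exists 0 => //=; rewrite (seminorm0 (fnorm_seminorm _)).
Qed.

(** If no weighted lower bound held near [y], the coordinate balls of radius [1 / (n + 1)] with the
    bounds [1 / (n + 1)] would each provide a point, and these points would form a forbidden
    sequence. *)
Lemma strong_submersion_continuous_weight_global_diffeomorphism (R : realType)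
    (E F : completeNormedModType R) (X : finsler_manifold E)
    (Y : finsler_manifold F) (f : X -> Y) :
  connected [set: X] -> finsler_complete X -> simply_connected R Y ->
  C1_map f -> fredholm_index0 f ->
  strong_submersion_continuous_weight f -> global_diffeomorphism f.
Proof.
move=> X_connected X_complete Ysc f1 ff [eta [x0 [etaw fs]]].
have [N etaN] := continuous_weight_integrable_growth etaw.
apply: (weighted_modulus_global_diffeomorphism f1 ff _ X_connected X_complete Ysc
  (mu := sur_modulus f) (x0 := x0) etaw.1 etaN); first by right.
move=> y; apply: contrapT => ny; apply: fs.
have [cy cyy] := chart_atP y; set c := chart_at y in cy cyy *.
pose V (n : nat) := dom c `&` [set z | `|fwd c z - fwd c y| < n.+1%:R^-1].
have Vy n : nbhs y (V n).
  apply: filterI; first exact: atlas_dom_nbhs.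
  suff : \forall z \near y, `|fwd c z - fwd c y| < n.+1%:R^-1 by [].
  apply: (@continuous_near _ _ (fwd c) y [set w | `|w - fwd c y| < n.+1%:R^-1]).
    exact: (atlas_fwd_continuous cy cyy).
  by apply/near_distP; exists n.+1%:R^-1; rewrite ?invr_gt0.
have /choice[u uP] n : exists x, V n (f x) /\
    (sur_modulus f x * ((eta (fdist x0 x))^-1)%:E < (n.+1%:R^-1)%:E)%E.
  apply: contrapT => nx; apply: ny; exists n.+1%:R^-1, (V n).
  split => //.
  by move=> x Vx; rewrite leNgt; apply/negP => h; apply: nx; exists x.
have inv0 : (n.+1%:R^-1 : R) @[n --> \oo] --> (0 : R) by exact: cvg_harmonic.
exists u, y; split.
  have cu : fwd c (f (u n)) @[n --> \oo] --> fwd c y.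
    apply/cvgrPdist_lt => e e0.
    apply: filterS (near_infty_natSinv_lt (PosNum e0)) => n; apply: le_lt_trans.
    by rewrite distrC ltW//; have [[]] := uP n.
  have : bwd c (fwd c (f (u n))) @[n --> \oo] --> bwd c (fwd c y).
    by apply: (@cvg_comp _ _ _ (fun n => fwd c (f (u n))) (bwd c)) cu _; exact: atlas_bwd_continuous.
  rewrite atlas_bwdK//; apply: cvg_trans; apply: near_eq_cvg.
  by near=> n; rewrite atlas_bwdK//; have [[]] := uP n.
apply: (@squeeze_cvge _ _ _ _ (fun=> 0%E) _ (fun n => (n.+1%:R^-1)%:E)).
- near=> n; rewrite (ltW (uP n).2) andbT mule_ge0 ?sur_modulus_ge0// lee_fin invr_ge0 ltW//.
  by apply: etaw.1.1; exact: fdist_ge0.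
- exact: cvg_cst.
- by apply/fine_cvgP; split; [near=> n|].
Unshelve. all: by end_near.
Qed.

Theorem mainTheorem7 (R : realType) (E F : completeNormedModType R)
    (X : finsler_manifold E) (Y : finsler_manifold F)
    (f : X -> Y) (mu : X -> \bar R)
    (X_connected : connected [set: X])
    (Y_connected : connected [set: Y])
    (X_complete : finsler_complete X)
    (Y_simply_connected : simply_connected R Y)
    (f_C1 : C1_map f)
    (f_fredholm : fredholm_index0 f)
    (mu_def : mu = inj_modulus f \/ mu = sur_modulus f) :
  [<-> strong_submersion f;
       strong_submersion_continuous_weight f;
       earle_eells f mu;
       earle_eells_nonincreasing_weight f mu;
       global_diffeomorphism f].
Proof.
tfae.
- exact: strong_submersion_weighted.
(* The second statement speaks of Sur, while [mu] in the third may be Inj; the passage through the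
   diffeomorphism serves both. *)
- move=> /strong_submersion_continuous_weight_global_diffeomorphism fd.
  exact: global_diffeomorphism_earle_eells (fd _ _ _ _ _).
- exact: earle_eells_weighted.
- exact: earle_eells_nonincreasing_weight_global_diffeomorphism.
- exact: global_diffeomorphism_strong_submersion.
Qed.
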